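(* Let $n\ge 2$ and $1\le k\le n-1$. The space $M^k=\{A\in\mathbb S:\lambda_1(A)\ne\lambda_{k+1}(A)\}$ has the homotopy type of the Thom space of a real vector bundle over the Grassmannian $Gr_k(n-1)$; the dimension (real rank) of the bundle equals $\frac{k(k+1)}2+k-1$ in the real case and $k^2+2k-1$ in the Hermitian case.
   Context: Two cases are treated in parallel: the real case, $X=\mathbb R^n$, and the Hermitian case, $X=\mathbb C^n$, with the standard inner (Hermitian) product. For a self-adjoint linear operator $A:X\to X$, $\lambda_1(A)\le\cdots\le\lambda_n(A)$ are its ordered eigenvalues, counted with multiplicity. $\mathbb S$ is the space of all non-scalar self-adjoint operators on $X$ modulo the equivalence relation $A\sim\alpha A+\beta I$, $\alpha>0$, $\beta\in\mathbb R$ (equivalently, the space of self-adjoint $A$ with $\sum_i\lambda_i(A)=0$, $\sum_i\lambda_i^2(A)=1$). It is a sphere of dimension $\frac{n(n+1)}2-2$ in the real case and $n^2-2$ in the Hermitian case. The conditions $\lambda_i(A)=\lambda_j(A)$ do not depend on the representative. $Gr_k(m)$ denotes the Grassmannian of $k$-dimensional subspaces of $\mathbb R^m$ in the real case and of $k$-dimensional complex subspaces of $\mathbb C^m$ in the Hermitian case. *)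

(* Defs.v *)
From HB Require Import structures.
From mathcomp Require Import all_boot all_order all_algebra.
From mathcomp Require Import generic_quotient complex.
From mathcomp Require Import all_classical all_reals all_analysis.

Set Implicit Arguments.
Unset Strict Implicit.
Unset Printing Implicit Defensive.

Import Order.TTheory GRing.Theory Num.Theory.
Import numFieldNormedType.Exports.

Local Open Scope classical_set_scope.
Local Open Scope ring_scope.
Local Open Scope quotient_scope.

Section Homotopy.
Variable R : realType.

Definition homotopic (X Y : topologicalType) (f g : X -> Y) : Prop :=
  exists H : X * R -> Y,
    [/\ {within setT `*` `[0, 1]%classic, continuous H},
        forall x, H (x, 0) = f x &
        forall x, H (x, 1) = g x].

Definition homotopy_equivalent (X Y : topologicalType) : Prop :=
  exists (f : X -> Y) (g : Y -> X),
    [/\ continuous f, continuous g,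
        homotopic (g \o f) id & homotopic (f \o g) id].

End Homotopy.

(* The quotient X / A, for A nonempty. (For empty A this is X itself, without
   the extra point required by the other usual convention.) *)
Section Collapse.
Variables (X : topologicalType) (A : set X).

Definition collapse_rel_bool (x y : X) : bool :=
  (x == y) || ((x \in A) && (y \in A)).

Lemma collapse_rel_refl : reflexive collapse_rel_bool.
Proof. by move=> x; rewrite /collapse_rel_bool eqxx. Qed.

Lemma collapse_rel_sym : symmetric collapse_rel_bool.
Proof. by move=> x y; rewrite /collapse_rel_bool eq_sym andbC. Qed.

Lemma collapse_rel_trans : transitive collapse_rel_bool.
Proof.
move=> y x z /predU1P[-> //|] + /predU1P[<- //|]; rewrite /collapse_rel_bool.
by move=> /andP[xA _] /andP[_ zA]; rewrite xA zA orbT.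
Qed.

Definition collapse_rel :=
  EquivRel _ collapse_rel_refl collapse_rel_sym collapse_rel_trans.

Definition collapse := {eq_quot collapse_rel}.

HB.instance Definition _ :=
  Topological.copy collapse (quotient_topology collapse).
HB.instance Definition _ := Quotient.on collapse.

End Collapse.

(* The fibre operations are total functions, meaningful only on pairs of
   vectors of the same fibre. The vector space axioms on the fibres are not
   listed because they follow from local triviality: a trivialization over U
   maps each fibre over U bijectively onto R^r and carries [vb_add] and
   [vb_scale] to the operations of R^r. *)
Record vector_bundle (R : realType) (B : topologicalType) (r : nat) :=
  VectorBundle {
  vb_total :> topologicalType;
  vb_proj : vb_total -> B;
  vb_add : vb_total -> vb_total -> vb_total;
  vb_scale : R -> vb_total -> vb_total;
  vb_proj_continuous : continuous vb_proj;
  vb_proj_add : forall e f, vb_proj e = vb_proj f ->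
    vb_proj (vb_add e f) = vb_proj e;
  vb_proj_scale : forall a e, vb_proj (vb_scale a e) = vb_proj e;
  vb_locally_trivial : forall b : B,
    exists (U : set B) (phi : vb_total -> 'rV[R]_r)
           (psi : B * 'rV[R]_r -> vb_total),
      [/\ open U /\ U b,
          {within vb_proj @^-1` U, continuous phi} /\
          {within U `*` setT, continuous psi},
          forall c v, U c -> vb_proj (psi (c, v)) = c /\ phi (psi (c, v)) = v,
          forall e, U (vb_proj e) -> psi (vb_proj e, phi e) = e &
          (forall e f, U (vb_proj e) -> vb_proj e = vb_proj f ->
             phi (vb_add e f) = phi e + phi f) /\
          (forall a e, U (vb_proj e) -> phi (vb_scale a e) = a *: phi e)] }.

(* Here [vb_scale E 0 e] is the zero vector of the fibre of e. *)
Record bundle_metric (R : realType) (B : topologicalType) (r : nat)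
    (E : vector_bundle R B r) := BundleMetric {
  bm_dot :> E -> E -> R;
  bm_continuous :
    {within [set p : E * E | vb_proj p.1 = vb_proj p.2],
      continuous (fun p : E * E => bm_dot p.1 p.2)};
  bm_sym : forall e f, vb_proj e = vb_proj f -> bm_dot e f = bm_dot f e;
  bm_add : forall e f h, vb_proj e = vb_proj f -> vb_proj f = vb_proj h ->
    bm_dot (vb_add e f) h = bm_dot e h + bm_dot f h;
  bm_scale : forall a e f, vb_proj e = vb_proj f ->
    bm_dot (vb_scale a e) f = a * bm_dot e f;
  bm_pos : forall e, e <> vb_scale 0 e -> 0 < bm_dot e e }.

Section Thom.
Variables (R : realType) (B : topologicalType) (r : nat).
Variables (E : vector_bundle R B r) (g : bundle_metric E).

Definition disc_bundle : set E := [set e | g e e <= 1].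

Definition sphere_bundle : set (set_type disc_bundle) :=
  [set e | g (\val e) (\val e) = 1].

(* Up to homeomorphism independent of g; the collapsed set is nonempty as soon
   as B is nonempty and r is positive. *)
Definition thom_space : topologicalType := collapse sphere_bundle.

End Thom.

(* Subspaces of F^m are row spaces of matrices of full row rank, and the
   Grassmannian has the quotient topology of the space of k-frames. *)
Section Grassmannian.
Variables (F : numFieldType) (k m : nat).

Definition frames : set 'M[F]_(k, m) := [set A | row_free A].

Definition same_span (A B : set_type frames) : bool := (\val A == \val B)%MS.

Lemma same_span_refl : reflexive same_span.
Proof. by move=> A; rewrite /same_span submx_refl. Qed.

Lemma same_span_sym : symmetric same_span.
Proof. by move=> A B; rewrite /same_span andbC. Qed.

Lemma same_span_trans : transitive same_span.
Proof.
move=> B A C /andP[AB BA] /andP[BC CB].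
by rewrite /same_span (submx_trans AB BC) (submx_trans CB BA).
Qed.

Definition same_span_equiv :=
  EquivRel same_span same_span_refl same_span_sym same_span_trans.

Definition grassmannian := {eq_quot same_span_equiv}.

HB.instance Definition _ :=
  Topological.copy grassmannian (quotient_topology grassmannian).
HB.instance Definition _ := Quotient.on grassmannian.

End Grassmannian.

(* The real case is F = R, theta = idfun; the Hermitian case is F = R[i],
   theta = Num.conj. Operators on F^n are n x n matrices with their usual
   topology. *)
Section Operators.
Variables (F : numFieldType) (theta : {rmorphism F -> F}) (n : nat).

Definition nonscalar_selfadjoint : set 'M[F]_n :=
  [set A | A \is hermitianmx n false theta /\ ~~ is_scalar_mx A].

(* In F = R[i] the order is partial, and 0 < a forces a to be real. *)
Definition affine_eq (A B : set_type nonscalar_selfadjoint) : bool :=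
  `[< exists a b : F,
        [/\ 0 < a, b \is Num.real & \val B = a *: \val A + b%:M] >].

Lemma affine_eq_refl : reflexive affine_eq.
Proof.
move=> A; apply/asboolP; exists 1, 0; split; [exact: ltr01|exact: real0|].
by rewrite scale1r raddf0 addr0.
Qed.

Lemma affine_eq_sym : symmetric affine_eq.
Proof.
suff h A B : affine_eq A B -> affine_eq B A by move=> A B; apply/idP/idP; exact: h.
move=> /asboolP[a [b [a0 br AB]]]; apply/asboolP.
exists a^-1, (- (a^-1 * b)); split.
- by rewrite invr_gt0.
- by rewrite realN realM// realV gtr0_real.
- rewrite AB scalerDr scalerA mulVf ?gt_eqF// scale1r scale_scalar_mx.
  by rewrite raddfN/= addrK.
Qed.

Lemma affine_eq_trans : transitive affine_eq.
Proof.
move=> B A C /asboolP[a [b [a0 br BA]]] /asboolP[c [d [c0 dr CB]]].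
apply/asboolP; exists (c * a), (c * b + d); split.
- by rewrite mulr_gt0.
- by rewrite realD// realM// gtr0_real.
- by rewrite CB BA scalerDr scalerA scale_scalar_mx raddfD/= addrA.
Qed.

Definition affine_equiv :=
  EquivRel affine_eq affine_eq_refl affine_eq_sym affine_eq_trans.

Definition operator_sphere := {eq_quot affine_equiv}.

HB.instance Definition _ :=
  Topological.copy operator_sphere (quotient_topology operator_sphere).
HB.instance Definition _ := Quotient.on operator_sphere.

(* For self-adjoint A such a sequence exists and is unique, has length n, and
   consists of real elements of F; it lists the eigenvalues in nondecreasing
   order with multiplicity. *)
Definition ordered_eigenvalues (A : 'M[F]_n) : seq F :=
  xget [::] [set s : seq F | sorted <=%R s /\
                             char_poly A = \prod_(a <- s) ('X - a%:P)].

(* Indexed from 1. *)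
Definition lambda (i : nat) (A : 'M[F]_n) : F := (ordered_eigenvalues A)`_i.-1.

(* The condition is independent of the representative. *)
Definition M_space (k : nat) : set operator_sphere :=
  [set x | lambda 1 (\val (repr x)) != lambda k.+1 (\val (repr x))].

End Operators.

(* Main.v *)
(* Let n = m + 1. Every class of S has a unique representative with
   (k+1)-st eigenvalue 0, up to a positive factor; its positive and negative
   parts A and B satisfy A B = 0, rank B <= k and rank A <= n - k - 1, and the
   class lies in M^k iff B <> 0. Shrinking A to 0 deforms M^k to the space X of
   positive semidefinite B of trace 1 and rank at most k.
     Let C be the set of the B in X whose lower right m x m block has rank < k,
   and let e be the first basis vector. The segment from B in C to the
   projection e e^* stays in X, so collapsing C does not change the homotopy
   type of X; a homotopy realising this is written down explicitly.
     A matrix B in X outside C is Z^* Z for a unique m x n matrix Z = (u^*, H)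
   with H positive semidefinite of rank k and u in the range W of H. Writing
   H = (t + s) P + S, with P the orthogonal projection onto W, S self-adjoint
   and traceless on W, and - s the least eigenvalue of S on W, the condition
   rank H = k means t > 0. Up to scaling, B thus amounts to a point of the open
   disc bundle, of radius coordinate 1 - t, of the bundle of the pairs (u, S)
   over Gr_k(m), and X / C is its Thom space. Both spaces being compact,
   continuous bijections between the relevant quotients are homeomorphisms. *)

Require Import Defs.
From mathcomp Require Import all_boot all_order all_algebra.
From mathcomp Require Import generic_quotient complex zify ring lra perm.
From mathcomp Require Import spectral.
From mathcomp Require Import all_classical all_reals all_analysis.

Set Implicit Arguments.
Unset Strict Implicit.
Unset Printing Implicit Defensive.

Import Order.TTheory GRing.Theory Num.Theory.
Import numFieldNormedType.Exports.

Local Open Scope classical_set_scope.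
Local Open Scope ring_scope.
Local Open Scope quotient_scope.

(** * Continuity of maps and of matrix operations *)

(** Uniqueness of [Z] is polar decomposition: a k-row factor of a Gram matrix of rank k is
    determined up to a unitary on the left, and asking for a positive semidefinite second part fixes
    it. The coordinate t comes from the shape of the cone of positive definite forms on W: splitting
    off the least eigenvalue turns it into a half space t > 0 over a vector space. As every formula
    is homogeneous, its slice where t and the norm of (u, S) add up to 1 is an open disc. The
    segments contract only C; the obstacle is to extend this contraction to X. The disc coordinates
    do it: interior points move outward along their rays and follow the segments only after the
    boundary is reached. The other obstacle is the continuity of maps that exist by choice, namely
    the splitting of an operator and the disc coordinates of a matrix. They are inverse to explicit
    maps out of compact spaces, so only the explicit maps need formulas. *)

(** A closed set pulled back to the compact space [X] is compact, and so is its image under [p],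
    which is therefore closed in [Y]. This yields the continuity of every map below that is defined
    through a choice of preimages. *)
Lemma compact_factor_continuous (X Y Z : topologicalType) (p : X -> Y)
    (f : Y -> Z) :
  compact [set: X] -> hausdorff_space Y -> continuous p ->
  continuous (f \o p) -> {within range p, continuous f}.
Proof.
move=> cX hY cp cfp; apply/continuous_closedP => C cC.
apply/closed_subspaceP; exists (p @` ((f \o p) @^-1` C)).
  apply: compact_closed => //; apply: continuous_compact.
    exact: continuous_subspaceT.
  apply: subclosed_compact cX _ => //.
  by move/continuous_closedP : cfp; apply.
rewrite eqEsubset; split=> y [].
  by move=> [x /= fpx <-] [x' _ _]; split => //; exists x.
by move=> Cfy [x _ pxy]; split; [exists x => //=; rewrite pxy|exists x].
Qed.

(** Used to show that the quotient spaces are Hausdorff, by injecting them into spaces of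
    matrices. *)
Lemma injective_hausdorff (X Y : topologicalType) (f : X -> Y) :
  continuous f -> injective f -> hausdorff_space Y -> hausdorff_space X.
Proof.
move=> cf fI hY x y xy; apply: fI; apply: hY => A B fxA fyB.
have [z [Az Bz]] := xy _ _ (cf _ _ fxA) (cf _ _ fyB).
by exists (f z).
Qed.

Lemma set_type_continuous (X Y : topologicalType) (A : set Y) (f : X -> A) :
  continuous (fun x => set_val (f x)) -> continuous f.
Proof. exact: continuous_comp_initial. Qed.

Lemma set_val_continuous (X : topologicalType) (A : set X) :
  continuous (set_val : A -> X).
Proof. exact: initial_continuous. Qed.

Lemma set_val_in (X : Type) (A : set X) (x : A) : A (set_val x).
Proof. exact: set_valP. Qed.

Lemma compact_set_type (X : topologicalType) (A : set X) :
  compact A -> compact [set: A].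
Proof.
move=> cA; have [[a Aa]|A0] := pselect (A !=set0); last first.
  move=> F FF _; exfalso; have [x _] := @filter_ex _ F FF _ (@filterT _ F _).
  by apply: A0; exists (set_val x); exact: set_val_in.
(* The value [a] outside [A] is arbitrary: only the restriction of [g] to [A], which is the
   identity, has to be continuous. *)
pose g (x : X) : A := if pselect (A x) is left Ax then exist _ x (mem_set Ax)
  else exist _ a (mem_set Aa).
have gE (x : A) : g (set_val x) = x.
  rewrite /g; case: pselect => [Ax|]; last by have := set_val_in x.
  exact: eq_sig_hprop.
have -> : [set: A] = g @` A.
  rewrite eqEsubset; split => // x _; exists (set_val x) => //.
  exact: set_val_in.
apply: continuous_compact => //; apply/subspace_sigL_continuousP.
have -> : sigL A g = fun x => x by rewrite funeqE => x; exact: gE.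
by move=> x; exact: cvg_id.
Qed.

Lemma within_comp_continuous (X Y Z : topologicalType) (P : set Y)
    (f : Y -> Z) (g : X -> Y) :
  {within P, continuous f} -> continuous g -> (forall x, P (g x)) ->
  continuous (f \o g).
Proof.
move=> /subspace_continuousP cf cg Pg x; apply: cvg_comp (cf _ (Pg x)).
move=> A /= wA; have := cg _ _ wA.
by apply: (@filterS _ (nbhs x)) => y /= h; exact: (h (Pg y)).
Qed.

Lemma pair_continuous (X Y Z : topologicalType) (f : X -> Y) (g : X -> Z) :
  continuous f -> continuous g -> continuous (fun x => (f x, g x)).
Proof. by move=> cf cg x; apply: cvg_pair; [exact: cf|exact: cg]. Qed.

Lemma fst_continuous (Y Z : topologicalType) : continuous (@fst Y Z).
Proof. by move=> x; exact: cvg_fst. Qed.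

Lemma snd_continuous (Y Z : topologicalType) : continuous (@snd Y Z).
Proof. by move=> x; exact: cvg_snd. Qed.

Lemma comp_continuous (X Y Z : topologicalType) (f : X -> Y) (g : Y -> Z) :
  continuous f -> continuous g -> continuous (fun x => g (f x)).
Proof. by move=> cf cg x; apply: continuous_comp; [exact: cf|exact: cg]. Qed.

Section FieldContinuity.
Variables (X : topologicalType) (K : numFieldType).
Implicit Types f g : X -> K.

Lemma fct_cst_continuous (Y : topologicalType) (a : Y) :
  continuous (fun _ : X => a).
Proof. exact: cst_continuous. Qed.

Lemma fct_add_continuous f g :
  continuous f -> continuous g -> continuous (fun x => f x + g x).
Proof. by move=> cf cg x; apply: continuousD; [exact: cf|exact: cg]. Qed.

Lemma fct_opp_continuous f : continuous f -> continuous (fun x => - f x).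
Proof. by move=> cf x; apply: continuousN; exact: cf. Qed.

Lemma fct_mul_continuous f g :
  continuous f -> continuous g -> continuous (fun x => f x * g x).
Proof. by move=> cf cg x; apply: continuousM; [exact: cf|exact: cg]. Qed.

Lemma fct_inv_continuous f : (forall x, f x != 0) -> continuous f ->
  continuous (fun x => (f x)^-1).
Proof. by move=> f0 cf x; apply: continuousV; [exact: f0|exact: cf]. Qed.

Lemma fct_sum_continuous (I : Type) (r : seq I) (P : pred I) (f : I -> X -> K) :
  (forall i, continuous (f i)) ->
  continuous (fun x => \sum_(i <- r | P i) f i x).
Proof.
move=> cf; elim: r => [|i r IHr].
  rewrite (_ : (fun _ => _) = fun=> 0); first exact: fct_cst_continuous.
  by apply/funext => x; rewrite big_nil.
rewrite (_ : (fun _ => _) = fun x => (if P i then f i x else 0) +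
    \sum_(i <- r | P i) f i x).
  apply: fct_add_continuous => //.
  by case: (P i) => //; exact: fct_cst_continuous.
by apply/funext => x; rewrite big_cons; case: ifP; rewrite ?add0r.
Qed.

Lemma fct_prod_continuous (I : Type) (r : seq I) (P : pred I) (f : I -> X -> K) :
  (forall i, continuous (f i)) ->
  continuous (fun x => \prod_(i <- r | P i) f i x).
Proof.
move=> cf; elim: r => [|i r IHr].
  rewrite (_ : (fun _ => _) = fun=> 1); first exact: fct_cst_continuous.
  by apply/funext => x; rewrite big_nil.
rewrite (_ : (fun _ => _) = fun x => (if P i then f i x else 1) *
    \prod_(i <- r | P i) f i x).
  apply: fct_mul_continuous => //.
  by case: (P i) => //; exact: fct_cst_continuous.
by apply/funext => x; rewrite big_cons; case: ifP; rewrite ?mul1r.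
Qed.

End FieldContinuity.

Section MatrixContinuity.
Variables (X : topologicalType) (K : numFieldType).

Lemma mx_continuous m n (f : X -> 'M[K]_(m, n)) :
  (forall i j, continuous (fun x => f x i j)) -> continuous f.
Proof.
move=> cf x A [/= B fxB BA].
suff : \forall y \near x, forall i j, B i j (f y i j).
  by apply: filterS => y; exact: BA.
apply: filter_forall => i; apply: filter_forall => j.
exact: (cf i j x _ (fxB i j)).
Qed.

Lemma entry_continuous m n (f : X -> 'M[K]_(m, n)) i j :
  continuous f -> continuous (fun x => f x i j).
Proof. by move=> cf; exact: comp_continuous cf (@coord_continuous K m n i j). Qed.

Lemma mxmul_continuous m n p (f : X -> 'M[K]_(m, n)) (g : X -> 'M[K]_(n, p)) :
  continuous f -> continuous g -> continuous (fun x => f x *m g x).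
Proof.
move=> cf cg; apply: mx_continuous => i j.
under eq_fun do rewrite mxE; apply: fct_sum_continuous => l.
by apply: fct_mul_continuous; exact: entry_continuous.
Qed.

Lemma mxadd_continuous m n (f g : X -> 'M[K]_(m, n)) :
  continuous f -> continuous g -> continuous (fun x => f x + g x).
Proof. by move=> cf cg x; apply: continuousD; [exact: cf|exact: cg]. Qed.

Lemma mxopp_continuous m n (f : X -> 'M[K]_(m, n)) :
  continuous f -> continuous (fun x => - f x).
Proof. by move=> cf x; apply: continuousN; exact: cf. Qed.

Lemma mxscale_continuous m n (a : X -> K) (f : X -> 'M[K]_(m, n)) :
  continuous a -> continuous f -> continuous (fun x => a x *: f x).
Proof.
move=> ca cf; apply: mx_continuous => i j; under eq_fun do rewrite mxE.
by apply: fct_mul_continuous => //; exact: entry_continuous.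
Qed.

Lemma trmx_continuous m n (f : X -> 'M[K]_(m, n)) :
  continuous f -> continuous (fun x => (f x)^T).
Proof.
move=> cf; apply: mx_continuous => i j; under eq_fun do rewrite mxE.
exact: entry_continuous.
Qed.

Lemma scalar_mx_continuous n (a : X -> K) :
  continuous a -> continuous (fun x => scalar_mx (a x) : 'M[K]_n).
Proof.
move=> ca; apply: mx_continuous => i j; under eq_fun do rewrite mxE.
by case: (i == j) => //; exact: fct_cst_continuous.
Qed.

Lemma mxtrace_continuous n (f : X -> 'M[K]_n) :
  continuous f -> continuous (fun x => \tr (f x)).
Proof.
by move=> cf; apply: fct_sum_continuous => i; exact: entry_continuous.
Qed.

Lemma det_continuous n (f : X -> 'M[K]_n) :
  continuous f -> continuous (fun x => \det (f x)).
Proof.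
move=> cf; apply: fct_sum_continuous => s.
apply: fct_mul_continuous; first exact: fct_cst_continuous.
by apply: fct_prod_continuous => i; exact: entry_continuous.
Qed.

Lemma adjugate_continuous n (f : X -> 'M[K]_n) :
  continuous f -> continuous (fun x => \adj (f x)).
Proof.
move=> cf; apply: mx_continuous => i j; under eq_fun do rewrite mxE.
apply: fct_mul_continuous; first exact: fct_cst_continuous.
apply: det_continuous; apply: mx_continuous => a b.
by under eq_fun do rewrite !mxE; exact: entry_continuous.
Qed.

(** Cramer's rule: near [x] the inverse is the adjugate divided by a nonvanishing determinant. *)
Lemma invmx_continuous_at n (f : X -> 'M[K]_n) (x : X) :
  continuous f -> f x \in unitmx -> {for x, continuous (fun x => invmx (f x))}.
Proof.
move=> cf fx; have d0 : \det (f x) != 0 by rewrite -unitfE -unitmxE.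
have cd := det_continuous cf.
pose h y := (\det (f y))^-1 *: \adj (f y).
have hf : h x = invmx (f x) by rewrite /invmx fx.
suff : h y @[y --> x] --> h x.
  rewrite hf; apply: cvg_trans; apply: near_eq_cvg.
  have : \forall y \near x, \det (f y) != 0 by apply: (cvgr_neq0 _ (cd x)).
  by apply: filterS => y y0; rewrite /h /invmx unitmxE unitfE y0.
apply: (@continuousZ K _ X); last exact: adjugate_continuous.
by apply: (@continuousV K X) => //; exact: cd.
Qed.

Lemma invmx_continuous n (f : X -> 'M[K]_n) :
  continuous f -> (forall x, f x \in unitmx) ->
  continuous (fun x => invmx (f x)).
Proof. by move=> cf fu x; exact: invmx_continuous_at. Qed.

Lemma row_mx_continuous m n1 n2 (f : X -> 'M[K]_(m, n1))
    (g : X -> 'M[K]_(m, n2)) :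
  continuous f -> continuous g -> continuous (fun x => row_mx (f x) (g x)).
Proof.
move=> cf cg; apply: mx_continuous => i j.
by case: (split_ordP j) => l ->; under eq_fun do rewrite ?row_mxEl ?row_mxEr;
  exact: entry_continuous.
Qed.

End MatrixContinuity.

Lemma map_mx_continuous (X : topologicalType) (K L : numFieldType) m n (h : K -> L)
    (f : X -> 'M[K]_(m, n)) :
  continuous h -> continuous f -> continuous (fun x => map_mx h (f x)).
Proof.
move=> ch cf; apply: mx_continuous => i j; under eq_fun do rewrite mxE.
exact: comp_continuous (entry_continuous cf) ch.
Qed.

(** * The vector bundle of a continuous family of idempotents *)

(** In a rank factorization [Q = C *m D] the factor [C] has a left inverse and [D] a right inverse,
    so [C D C D = C D] cancels to [D C = 1]. *)
Lemma idempotent_rank_factor (K : fieldType) N r (Q : 'M[K]_N) :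
  Q *m Q = Q -> \rank Q = r ->
  exists (L : 'M[K]_(N, r)) (S : 'M[K]_(r, N)), Q = L *m S /\ S *m L = 1%:M.
Proof.
move=> QQ; case: _ /; exists (col_base Q), (row_base Q).
split; first by rewrite mulmx_base.
have /row_freeP[L' L'E] : row_free (col_base Q)^T.
  by rewrite /row_free mxrank_tr; exact: col_base_full.
have /row_freeP[S' S'E] := row_base_free Q.
have CE : L'^T *m col_base Q = 1%:M.
  by rewrite -[col_base Q]trmxK -trmx_mul L'E trmx1.
have := mulmx_base Q; rewrite -/(\rank Q) => CD.
move: (\rank Q) L' S' {L'E} (col_base Q) (row_base Q) CE S'E CD.
move=> s L' S' C D CE DE CD.
have := congr1 (fun X => L'^T *m X *m S') QQ; rewrite -CD.
by rewrite !mulmxA CE mul1mx -!mulmxA DE mulmx1.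
Qed.

Section ProjectionBundle.
Variables (R : realType) (B : topologicalType) (N r : nat).
Variable P : B -> 'M[R]_N.
Hypothesis P_continuous : continuous P.
Hypothesis P_idem : forall b, P b *m P b = P b.
Hypothesis P_rank : forall b, \rank (P b) = r.

Definition projection_total : set (B * 'rV[R]_N) :=
  [set e | e.2 *m P e.1 = e.2].

Let E : Type := set_type projection_total.

Definition pb_proj (e : E) : B := (set_val e).1.
Definition pb_vec (e : E) : 'rV[R]_N := (set_val e).2.

Lemma pb_vecP (e : E) : pb_vec e *m P (pb_proj e) = pb_vec e.
Proof. exact: (set_val_in e). Qed.

Lemma pb_mk_subproof b x : (b, x *m P b) \in projection_total.
Proof. by rewrite inE /projection_total /= -mulmxA P_idem. Qed.

(** Projecting [x] makes this a total continuous function on [B * 'rV_N], with no membership proof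
    to carry along. *)
Definition pb_mk (b : B) (x : 'rV[R]_N) : E :=
  exist _ (b, x *m P b) (pb_mk_subproof b x).

Lemma pb_eq (e f : E) : pb_proj e = pb_proj f -> pb_vec e = pb_vec f -> e = f.
Proof.
rewrite /pb_proj /pb_vec; case: e f => -[b x] ? [[c y] ?] /= bc xy.
by apply: eq_sig_hprop => //=; rewrite bc xy.
Qed.

Lemma pb_proj_mk b x : pb_proj (pb_mk b x) = b. Proof. by []. Qed.

Lemma pb_vec_mk b x : x *m P b = x -> pb_vec (pb_mk b x) = x.
Proof. by []. Qed.

Lemma pb_mkK (e : E) : pb_mk (pb_proj e) (pb_vec e) = e.
Proof. by apply: pb_eq => //; exact: pb_vecP. Qed.

Lemma pb_proj_continuous : continuous pb_proj.
Proof.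
by apply: (comp_continuous (@set_val_continuous _ _)); exact: fst_continuous.
Qed.

Lemma pb_vec_continuous : continuous pb_vec.
Proof.
by apply: (comp_continuous (@set_val_continuous _ _)); exact: snd_continuous.
Qed.

Lemma pb_mk_continuous (X : topologicalType) (b : X -> B) (x : X -> 'rV[R]_N) :
  continuous b -> continuous x -> continuous (fun z => pb_mk (b z) (x z)).
Proof.
move=> cb cx; apply: set_type_continuous; apply: pair_continuous => //.
by apply: mxmul_continuous => //; exact: comp_continuous cb P_continuous.
Qed.

Definition pb_add (e f : E) : E := pb_mk (pb_proj e) (pb_vec e + pb_vec f).
Definition pb_scale (a : R) (e : E) : E := pb_mk (pb_proj e) (a *: pb_vec e).

Lemma pb_vec_add e f : pb_proj e = pb_proj f ->
  pb_vec (pb_add e f) = pb_vec e + pb_vec f.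
Proof.
move=> ef; rewrite /pb_add pb_vec_mk// mulmxDl pb_vecP; congr +%R.
by rewrite ef pb_vecP.
Qed.

Lemma pb_vec_scale a e : pb_vec (pb_scale a e) = a *: pb_vec e.
Proof. by rewrite /pb_scale pb_vec_mk// -scalemxAl pb_vecP. Qed.

(* The standard intertwiner [g = P c P b + (1 - P c)(1 - P b)] of two close
   projections identifies the fibres over [c] and [b]. *)
Lemma pb_locally_trivial (b : B) :
  exists (U : set B) (phi : E -> 'rV[R]_r) (psi : B * 'rV[R]_r -> E),
    [/\ open U /\ U b,
        {within pb_proj @^-1` U, continuous phi} /\
        {within U `*` setT, continuous psi},
        forall c v, U c -> pb_proj (psi (c, v)) = c /\ phi (psi (c, v)) = v,
        forall e, U (pb_proj e) -> psi (pb_proj e, phi e) = e &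
        (forall e f, U (pb_proj e) -> pb_proj e = pb_proj f ->
           phi (pb_add e f) = phi e + phi f) /\
        (forall a e, U (pb_proj e) -> phi (pb_scale a e) = a *: phi e)].
Proof.
have [L [S [LS SL]]] := idempotent_rank_factor (P_idem b) (P_rank b).
pose g c := P c *m P b + (1%:M - P c) *m (1%:M - P b).
have Pg c : P c *m g c = P c *m P b.
  rewrite /g mulmxDr !mulmxA P_idem [P c *m (_ - _)]mulmxBr mulmx1 P_idem.
  by rewrite subrr mul0mx addr0.
have gP c : g c *m P b = P c *m P b.
  rewrite /g mulmxDl -!mulmxA P_idem [(_ - _) *m P b]mulmxBl mul1mx P_idem.
  by rewrite subrr mulmx0 addr0.
have cg : continuous g.
  apply: mxadd_continuous; apply: mxmul_continuous => //;
    try exact: fct_cst_continuous.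
  by apply: mxadd_continuous; [exact: fct_cst_continuous|exact: mxopp_continuous].
have gb : g b = 1%:M.
  rewrite /g P_idem mulmxBl mul1mx [P b *m _]mulmxBr mulmx1 P_idem subrr subr0.
  by rewrite addrC subrK.
(* Where [g c] is invertible it carries the range of [P c] onto that of [P b], on which [L] and [S]
   are mutually inverse coordinates. *)
exists [set c | g c \in unitmx], (fun e => pb_vec e *m g (pb_proj e) *m L),
  (fun cv => pb_mk cv.1 (cv.2 *m S *m invmx (g cv.1))).
have inv c v : g c \in unitmx ->
    v *m S *m invmx (g c) *m P c = v *m S *m invmx (g c).
  move=> gu; have : P c *m g c = g c *m P b by rewrite Pg gP.
  move=> /(congr1 (fun X => invmx (g c) *m X *m invmx (g c))).
  rewrite -!mulmxA mulmxV// mulmx1 mulKmx// => ->.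
  by rewrite LS -!mulmxA (mulmxA S L) SL mul1mx.
split.
- split; last by rewrite /= gb unitmx1.
  rewrite (_ : mkset _ = (fun c => \det (g c)) @^-1` [set x | x != 0]).
    by apply: open_comp; [move=> ? _; exact: det_continuous|exact: open_neq].
  by apply/seteqP; split => c /=; rewrite unitmxE unitfE.
- split.
    apply: continuous_subspaceT; apply: mxmul_continuous; last first.
      exact: fct_cst_continuous.
    apply: mxmul_continuous; first exact: pb_vec_continuous.
    exact: comp_continuous pb_proj_continuous cg.
  apply/subspace_sigL_continuousP; apply: pb_mk_continuous.
    apply: (comp_continuous (@set_val_continuous _ _)); exact: fst_continuous.
  apply: mxmul_continuous.
    apply: mxmul_continuous; last exact: fct_cst_continuous.
    apply: (comp_continuous (@set_val_continuous _ _)); exact: snd_continuous.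
  apply: invmx_continuous; last by move=> x; have [] := set_val_in x.
  apply: comp_continuous cg.
  apply: (comp_continuous (@set_val_continuous _ _)); exact: fst_continuous.
- move=> c v gu; split => //; rewrite pb_vec_mk ?inv// pb_proj_mk.
  by rewrite mulmxKV// -mulmxA SL mulmx1.
- move=> e gu; apply: pb_eq => //; rewrite /= pb_vec_mk ?inv//.
  rewrite -(mulmxA _ L) -LS -(mulmxA (pb_vec e)) gP -Pg.
  by rewrite (mulmxA (pb_vec e)) pb_vecP mulmxK.
- split=> [e f _ ef|a e _]; first by rewrite (pb_vec_add ef) -ef !mulmxDl.
  by rewrite pb_vec_scale -!scalemxAl.
Qed.

Definition projection_bundle : vector_bundle R B r :=
  @VectorBundle R B r (set_type projection_total) pb_proj pb_add pb_scale
    pb_proj_continuous (fun e f _ => erefl (pb_proj e))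
    (fun a e => erefl (pb_proj e)) pb_locally_trivial.

Definition pb_dot (e f : E) : R := (pb_vec e *m (pb_vec f)^T) 0 0.

Lemma rV_dot_gt0 (x : 'rV[R]_N) : x != 0 -> 0 < (x *m x^T) 0 0.
Proof.
have sq i : 0 <= x 0 i * x^T i 0 by rewrite mxE -expr2 sqr_ge0.
move=> x0; rewrite mxE lt_def sumr_ge0 ?andbT => [|i _]; last exact: sq.
apply: contra x0 => /eqP/(psumr_eq0P (fun i _ => sq i)) h; apply/eqP/rowP => i.
by apply/eqP; have /eqP := h i isT; rewrite !mxE mulf_eq0 orbb.
Qed.

Lemma pb_dot_continuous : {within [set p : projection_bundle * projection_bundle
  | vb_proj p.1 = vb_proj p.2],
  continuous (fun p : projection_bundle * projection_bundle => pb_dot p.1 p.2)}.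
Proof.
apply: continuous_subspaceT; apply: entry_continuous; apply: mxmul_continuous.
  exact: comp_continuous (@fst_continuous _ _) pb_vec_continuous.
apply: trmx_continuous.
exact: comp_continuous (@snd_continuous _ _) pb_vec_continuous.
Qed.

Program Definition projection_metric : bundle_metric projection_bundle :=
  @BundleMetric _ _ _ projection_bundle pb_dot pb_dot_continuous _ _ _ _.
Next Obligation.
by move=> e f _; rewrite /pb_dot -[pb_vec e *m _]trmxK mxE trmx_mul trmxK.
Qed.
Next Obligation.
by move=> e f h ef _; rewrite /pb_dot pb_vec_add// mulmxDl mxE.
Qed.
Next Obligation.
by move=> a e f _; rewrite /pb_dot pb_vec_scale -scalemxAl mxE.
Qed.
Next Obligation.
move=> e e0; apply: rV_dot_gt0; apply: contra_notN e0 => /eqP e0.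
by apply: pb_eq => //; rewrite [RHS]pb_vec_scale e0 scaler0.
Qed.

End ProjectionBundle.

(** * Linear algebra over the real or the complex numbers *)

(* A common interface to R and R[i]. The real case has [sc_i = 0] and
   [sc_im x = 0], so that [sc_im sc_i + 1] is the dimension over [R]. *)
Record scalars (R : realType) := Scalars {
  sc_field :> numFieldType;
  sc_conj : {rmorphism sc_field -> sc_field};
  sc_of : {rmorphism R -> sc_field};
  sc_re : sc_field -> R;
  sc_im : sc_field -> R;
  sc_i : sc_field;
  sc_conjK : involutive sc_conj;
  sc_conj_of : forall a, sc_conj (sc_of a) = sc_of a;
  sc_mul_conj : forall x, x * sc_conj x = sc_of (sc_re x ^+ 2 + sc_im x ^+ 2);
  sc_add_conj : forall x, x + sc_conj x = sc_of (sc_re x *+ 2);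
  sc_of_ge0 : forall a, (0 <= sc_of a) = (0 <= a);
  sc_ge0_of : forall x, 0 <= x -> x = sc_of (sc_re x);
  sc_rect : forall x, x = sc_of (sc_re x) + sc_i * sc_of (sc_im x);
  sc_reD : forall x y, sc_re (x + y) = sc_re x + sc_re y;
  sc_imD : forall x y, sc_im (x + y) = sc_im x + sc_im y;
  sc_reZ : forall a x, sc_re (sc_of a * x) = a * sc_re x;
  sc_imZ : forall a x, sc_im (sc_of a * x) = a * sc_im x;
  sc_re1 : sc_re 1 = 1;
  sc_im1 : sc_im 1 = 0;
  sc_re_i : forall x, sc_re (sc_i * x) = - sc_im x;
  sc_im_i : forall x, sc_im (sc_i * x) = sc_im sc_i * sc_re x;
  sc_cases : sc_im sc_i = 1 \/ (sc_im sc_i = 0 /\ sc_conj =1 id);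
  sc_conj_continuous : continuous sc_conj;
  sc_of_continuous : continuous sc_of;
  sc_re_continuous : continuous sc_re;
  sc_im_continuous : continuous sc_im;
  sc_spectral : forall n (A : 'M[sc_field]_n), (map_mx sc_conj A)^T = A ->
    exists (U : 'M[sc_field]_n) (l : 'rV[R]_n),
      U *m (map_mx sc_conj U)^T = 1%:M /\
      A = (map_mx sc_conj U)^T *m diag_mx (map_mx sc_of l) *m U }.

Definition adjoint (R : realType) (K : scalars R) m n (A : 'M[K]_(m, n)) :
  'M[K]_(n, m) := (map_mx (@sc_conj R K) A)^T.

Notation "A ^h" := (adjoint A) (at level 8, format "A ^h") : ring_scope.

Section Scalars.
Variables (R : realType) (K : scalars R).
Implicit Types (a b : R) (x y : K).

Local Notation of_ := (@sc_of R K).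
Local Notation re := (@sc_re R K).
Local Notation im := (@sc_im R K).
Local Notation cj := (@sc_conj R K).

Lemma sc_re0 : re 0 = 0.
Proof. by have := sc_reZ 0 (0 : K); rewrite rmorph0 mul0r => ->; rewrite mul0r. Qed.

Lemma sc_im0 : im 0 = 0.
Proof. by have := sc_imZ 0 (0 : K); rewrite rmorph0 mul0r => ->; rewrite mul0r. Qed.

Lemma sc_re_of a : re (of_ a) = a.
Proof. by rewrite -[of_ a]mulr1 sc_reZ sc_re1 mulr1. Qed.

Lemma sc_im_of a : im (of_ a) = 0.
Proof. by rewrite -[of_ a]mulr1 sc_imZ sc_im1 mulr0. Qed.

Lemma sc_of_inj : injective of_.
Proof. by move=> a b ab; rewrite -[a]sc_re_of ab sc_re_of. Qed.

Lemma sc_of_le a b : (of_ a <= of_ b) = (a <= b).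
Proof. by rewrite -subr_ge0 -rmorphB sc_of_ge0 subr_ge0. Qed.

Lemma sc_of_lt a b : (of_ a < of_ b) = (a < b).
Proof. by rewrite !lt_def sc_of_le (inj_eq sc_of_inj). Qed.

Lemma sc_of_gt0 a : (0 < of_ a) = (0 < a).
Proof. by rewrite -sc_of_lt rmorph0. Qed.

Lemma sc_of_eq0 a : (of_ a == 0) = (a == 0).
Proof. by rewrite -(inj_eq sc_of_inj) rmorph0. Qed.

Lemma sc_reN x : re (- x) = - re x.
Proof. by apply/eqP; rewrite -subr_eq0 opprK -sc_reD addNr sc_re0. Qed.

Lemma sc_imN x : im (- x) = - im x.
Proof. by apply/eqP; rewrite -subr_eq0 opprK -sc_imD addNr sc_im0. Qed.

Lemma sc_re_sum I (r : seq I) (P : pred I) (F : I -> K) :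
  re (\sum_(i <- r | P i) F i) = \sum_(i <- r | P i) re (F i).
Proof.
by elim/big_rec2: _ => [|i y1 y2 _ <-]; rewrite ?sc_re0 ?sc_reD.
Qed.

Lemma sc_conj_fixed x : cj x = x -> x = of_ (re x).
Proof.
move=> cx; have := sc_add_conj x; rewrite cx -mulr2n rmorphMn /=.
by move=> /eqP; rewrite -subr_eq0 -mulrnBl mulrn_eq0 /= subr_eq0 => /eqP.
Qed.

Lemma sc_ge0 x : (0 <= x) = (x == of_ (re x)) && (0 <= re x).
Proof.
apply/idP/andP => [x0|[/eqP -> ]]; last by rewrite sc_of_ge0 sc_re_of.
by rewrite -(@sc_of_ge0 R K) -sc_ge0_of// x0.
Qed.

Lemma sc_real_of x : x \is Num.real -> x = of_ (re x).
Proof.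
case/orP => [/sc_ge0_of //|x0].
rewrite -[LHS]opprK (sc_ge0_of (_ : 0 <= - x)) ?oppr_ge0//.
by rewrite -rmorphN sc_reN opprK.
Qed.

Lemma sc_of_real a : of_ a \is Num.real.
Proof.
case: (lerP 0 a) => a0; first by rewrite ger0_real// sc_of_ge0.
by rewrite ler0_real// -oppr_ge0 -rmorphN sc_of_ge0 oppr_ge0 ltW.
Qed.

Lemma sc_re_conj x : re (cj x) = re x.
Proof.
have := congr1 re (sc_add_conj x).
by rewrite sc_re_of sc_reD mulr2n => /addrI.
Qed.

Lemma sc_eq x y : re x = re y -> im x = im y -> x = y.
Proof. by move=> h1 h2; rewrite (sc_rect x) (sc_rect y) h1 h2. Qed.

Definition sqn x : R := re x ^+ 2 + im x ^+ 2.

Lemma sqn_ge0 x : 0 <= sqn x.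
Proof. by rewrite addr_ge0 ?sqr_ge0. Qed.

Lemma sqn_eq0 x : sqn x = 0 -> x = 0.
Proof.
move=> /eqP; rewrite paddr_eq0 ?sqr_ge0// !sqrf_eq0 => /andP[/eqP r0 /eqP i0].
by apply: sc_eq; rewrite ?sc_re0 ?sc_im0.
Qed.

Section Adjoint.
Variables m n p : nat.
Implicit Types (A B : 'M[K]_(m, n)).

Lemma adjointK A : (A^h)^h = A.
Proof. by apply/matrixP => i j; rewrite !mxE sc_conjK. Qed.

Lemma adjointD A B : (A + B)^h = A^h + B^h.
Proof. by apply/matrixP => i j; rewrite !mxE rmorphD. Qed.

Lemma adjointN A : (- A)^h = - A^h.
Proof. by apply/matrixP => i j; rewrite !mxE rmorphN. Qed.

Lemma adjointB A B : (A - B)^h = A^h - B^h.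
Proof. by rewrite adjointD adjointN. Qed.

Lemma adjoint0 : (0 : 'M[K]_(m, n))^h = 0.
Proof. by apply/matrixP => i j; rewrite !mxE rmorph0. Qed.

Lemma adjointZ a A : (of_ a *: A)^h = of_ a *: A^h.
Proof. by apply/matrixP => i j; rewrite !mxE rmorphM /= sc_conj_of. Qed.

Lemma adjointM A (B : 'M[K]_(n, p)) : (A *m B)^h = B^h *m A^h.
Proof. by rewrite /adjoint map_mxM trmx_mul. Qed.

Lemma mxrank_adjoint A : \rank A^h = \rank A.
Proof. by rewrite /adjoint mxrank_tr mxrank_map. Qed.

(** The square of the Frobenius norm. *)
Definition frob A : R := \sum_i \sum_j sqn (A i j).

Lemma frob_ge0 A : 0 <= frob A.
Proof. by apply: sumr_ge0 => i _; apply: sumr_ge0 => j _; exact: sqn_ge0. Qed.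

Lemma frob_eq0 A : frob A = 0 -> A = 0.
Proof.
have h1 i : 0 <= \sum_j sqn (A i j).
  by apply: sumr_ge0 => j _; exact: sqn_ge0.
move=> /(psumr_eq0P (fun i _ => h1 i)) h; apply/matrixP => i j; rewrite mxE.
apply: sqn_eq0.
exact: (psumr_eq0P (fun j _ => sqn_ge0 (A i j)) (h i isT)).
Qed.

Lemma frobE A : \tr (A *m A^h) = of_ (frob A).
Proof.
rewrite /mxtrace raddf_sum; apply: eq_bigr => i _.
rewrite mxE raddf_sum; apply: eq_bigr => j _.
by rewrite !mxE sc_mul_conj.
Qed.

End Adjoint.

Lemma mulmx_adjoint_eq0 m n (A : 'M[K]_(m, n)) : A *m A^h = 0 -> A = 0.
Proof.
move=> AA; apply: frob_eq0; apply: sc_of_inj.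
by rewrite -frobE AA linear0 rmorph0.
Qed.

Lemma frob_adjoint m n (A : 'M[K]_(m, n)) : frob A^h = frob A.
Proof. by apply: sc_of_inj; rewrite -!frobE adjointK mxtrace_mulC. Qed.

Lemma adjoint_scalar n a : ((of_ a)%:M : 'M[K]_n)^h = (of_ a)%:M.
Proof.
apply/matrixP => i j; rewrite !mxE eq_sym.
by case: (_ == _); rewrite ?mulr1n ?mulr0n ?rmorph0 ?sc_conj_of.
Qed.

Lemma adjoint1 n : (1%:M : 'M[K]_n)^h = 1%:M.
Proof. by rewrite -(rmorph1 of_) adjoint_scalar. Qed.

Lemma adjoint_diag n (l : 'rV[R]_n) :
  (diag_mx (map_mx of_ l))^h = diag_mx (map_mx of_ l).
Proof.
apply/matrixP => i j; rewrite !mxE eq_sym.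
by case: eqP => [->|_]; rewrite ?mulr1n ?mulr0n ?rmorph0 ?sc_conj_of.
Qed.

Lemma adjoint_row_mx m n1 n2 (A : 'M[K]_(m, n1)) (B : 'M[K]_(m, n2)) :
  (row_mx A B)^h = col_mx A^h B^h.
Proof. by rewrite /adjoint map_row_mx tr_row_mx. Qed.

Lemma adjoint_inv n (A : 'M[K]_n) : (invmx A)^h = invmx A^h.
Proof. by rewrite /adjoint map_invmx trmx_inv. Qed.

Lemma tr_adjoint n (A : 'M[K]_n) : \tr A^h = cj (\tr A).
Proof. by rewrite /adjoint mxtrace_tr trace_map_mx. Qed.

Lemma herm_trace_real n (A : 'M[K]_n) : A^h = A -> \tr A = of_ (re (\tr A)).
Proof. by move=> hA; apply: sc_conj_fixed; rewrite -tr_adjoint hA. Qed.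

Lemma sc_ofV a : of_ a^-1 = (of_ a)^-1.
Proof. exact: fmorphV. Qed.

Definition qform n (A : 'M[K]_n) (v : 'rV[K]_n) : K := (v *m A *m v^h) 0 0.

Definition psd n (A : 'M[K]_n) := A^h = A /\ forall v, 0 <= qform A v.

Lemma qformD n (A B : 'M[K]_n) v : qform (A + B) v = qform A v + qform B v.
Proof. by rewrite /qform mulmxDr mulmxDl mxE. Qed.

Lemma qformZ n c (A : 'M[K]_n) v : qform (c *: A) v = c * qform A v.
Proof. by rewrite /qform -scalemxAr -scalemxAl mxE. Qed.

Lemma qform_gram m n (A : 'M[K]_(m, n)) v :
  qform (A^h *m A) v = of_ (frob (v *m A^h)).
Proof.
rewrite -frobE adjointM adjointK /qform !mulmxA.
by rewrite /mxtrace big_ord1.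
Qed.

Lemma qform1 n (v : 'rV[K]_n) : qform 1%:M v = of_ (frob v).
Proof. by rewrite -frobE /qform mulmx1 /mxtrace big_ord1. Qed.

Lemma gram_psd m n (A : 'M[K]_(m, n)) : psd (A^h *m A).
Proof.
split; first by rewrite adjointM adjointK.
by move=> v; rewrite qform_gram sc_of_ge0 frob_ge0.
Qed.

Lemma psd_herm n (A : 'M[K]_n) : psd A -> A^h = A. Proof. by case. Qed.

Lemma psd0 n : psd (0 : 'M[K]_n).
Proof.
by split=> [|v]; rewrite ?adjoint0// /qform mulmx0 mul0mx mxE.
Qed.

Lemma psdD n (A B : 'M[K]_n) : psd A -> psd B -> psd (A + B).
Proof.
move=> [hA pA] [hB pB]; split; first by rewrite adjointD hA hB.
by move=> v; rewrite qformD addr_ge0.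
Qed.

Lemma psdZ n a (A : 'M[K]_n) : 0 <= a -> psd A -> psd (of_ a *: A).
Proof.
move=> a0 [hA pA]; split; first by rewrite adjointZ hA.
by move=> v; rewrite qformZ mulr_ge0// sc_of_ge0.
Qed.

Lemma psd_conj m n (A : 'M[K]_n) (B : 'M[K]_(n, m)) :
  psd A -> psd (B^h *m A *m B).
Proof.
move=> [hA pA]; split; first by rewrite !adjointM adjointK hA mulmxA.
move=> v; have := pA (v *m B^h); rewrite /qform adjointM adjointK.
by rewrite !mulmxA.
Qed.

Lemma psd_diag n (l : 'rV[R]_n) : (forall i, 0 <= l 0 i) ->
  psd (diag_mx (map_mx of_ l)).
Proof.
move=> l0; split; first exact: adjoint_diag.
move=> v; rewrite /qform mxE; apply: sumr_ge0 => i _.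
rewrite mul_mx_diag !mxE mulrAC sc_mul_conj -rmorphM sc_of_ge0.
by rewrite mulr_ge0 ?addr_ge0 ?sqr_ge0.
Qed.

(** The square roots of the eigenvalues are taken in an orthonormal eigenbasis; the eigenvalues are
    nonnegative because they are the values of the form at the rows of [U]. *)
Lemma psd_gram n (A : 'M[K]_n) : psd A ->
  exists2 S : 'M[K]_n, psd S & S *m S = A.
Proof.
move=> [hA pA]; have hA' : (map_mx cj A)^T = A by exact: hA.
have [U [l [UU AE]]] := sc_spectral hA'.
rewrite -/(adjoint U) in UU AE.
have l0 i : 0 <= l 0 i.
  have := pA (row i U); rewrite /qform rowE adjointM AE !mulmxA.
  rewrite -(mulmxA _ U) UU mulmx1 -(mulmxA _ U) UU mulmx1.
  rewrite mul_mx_diag mxE (bigD1 i)//= big1 ?addr0 => [|j ji].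
    by rewrite !mxE !eqxx /= mul1r rmorph1 mulr1 sc_of_ge0.
  by rewrite !mxE (negPf ji) andbF mul0r mul0r.
exists (U^h *m diag_mx (map_mx of_ (map_mx Num.sqrt l)) *m U).
  by apply: psd_conj; apply: psd_diag => i; rewrite mxE sqrtr_ge0.
rewrite !mulmxA -(mulmxA _ U) UU mulmx1 AE; congr (_ *m _).
rewrite -mulmxA; congr (_ *m _); rewrite mulmx_diag; congr diag_mx.
apply/rowP => i; rewrite !mxE -rmorphM; congr (of_ _).
by rewrite -expr2 sqr_sqrtr.
Qed.

Lemma psd_factor n (A : 'M[K]_n) : psd A -> exists Y : 'M[K]_n, A = Y^h *m Y.
Proof. by case/psd_gram=> S [hS _] <-; exists S; rewrite hS. Qed.

(** With [A = Y^h *m Y] the form at [v] is the squared norm of [v *m Y^h]. *)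
Lemma psd_null n (A : 'M[K]_n) (v : 'rV[K]_n) :
  psd A -> qform A v = 0 -> v *m A = 0.
Proof.
case/psd_factor=> Y ->; rewrite qform_gram => /eqP.
by rewrite sc_of_eq0 => /eqP/frob_eq0; rewrite mulmxA => ->; rewrite mul0mx.
Qed.

(** With [A = Y^h *m Y] the trace becomes that of [Y *m B *m Y^h], the sum of the values of the form
    of [B] at the rows of [Y]. *)
Lemma psd_trM_ge0 n (A B : 'M[K]_n) : psd A -> psd B -> 0 <= \tr (A *m B).
Proof.
case/psd_factor=> Y -> [_ pB]; rewrite mxtrace_mulC mulmxA mxtrace_mulC mulmxA.
apply: sumr_ge0 => i _; have := pB (row i Y); rewrite /qform.
rewrite -row_mul; congr (0 <= _); rewrite !mxE; apply: eq_bigr => j _.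
by rewrite !mxE.
Qed.

Lemma psd_tr_ge0 n (A : 'M[K]_n) : psd A -> 0 <= re (\tr A).
Proof.
case/psd_factor=> Y ->; rewrite mxtrace_mulC frobE sc_re_of.
exact: frob_ge0.
Qed.

Lemma psd_tr_eq0 n (A : 'M[K]_n) : psd A -> re (\tr A) = 0 -> A = 0.
Proof.
case/psd_factor=> Y ->; rewrite mxtrace_mulC frobE sc_re_of.
by move=> /frob_eq0 ->; rewrite mulmx0.
Qed.

(** The left kernels of [Y^h *m Y] and of [Y^h] agree, as [v Y^h Y v^h] is a squared norm. *)
Lemma mxrank_gram m n (Y : 'M[K]_(m, n)) : \rank (Y^h *m Y) = \rank Y.
Proof.
apply/eqP; rewrite eqn_leq mxrankM_maxr /=.
have : (kermx (Y^h *m Y) <= kermx Y^h)%MS.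
  apply/sub_kermxP; apply: mulmx_adjoint_eq0.
  by rewrite adjointM adjointK mulmxA -(mulmxA _ Y^h) mulmx_ker mul0mx.
move=> /mxrankS; rewrite !mxrank_ker mxrank_adjoint.
have := rank_leq_col Y; have := rank_leq_col (Y^h *m Y); lia.
Qed.

(** If [D] is a row basis of [A] with right inverse [S], then [A] equals
    [D^h *m (S^h *m A *m S) *m D]. The square root of the small middle matrix, times [D], is the
    required factor. *)
Lemma psd_factor_rank n (A : 'M[K]_n) : psd A ->
  exists Y : 'M[K]_(\rank A, n), A = Y^h *m Y.
Proof.
move=> pA; have hA := psd_herm pA.
have /row_freeP[S RS] := row_base_free A.
have AE := mulmx_base A.
move: (\rank A) (col_base A) (row_base A) S RS AE => r C D S DS AE.
have AS : A *m S *m D = A by rewrite -{1}AE -(mulmxA C) DS mulmx1 AE.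
have SA : D^h *m S^h *m A = A.
  by have := congr1 (@adjoint _ _ _ _) AS; rewrite !adjointM hA mulmxA.
have AD : A = D^h *m (S^h *m A *m S) *m D by rewrite !mulmxA SA AS.
have [M [hM _] ME] := psd_gram (psd_conj S pA).
by exists (M *m D); rewrite AD -ME adjointM hM !mulmxA.
Qed.

(** For [D = A - B], the sum [D (A + B) + (A + B) D] is twice the difference of the squares, hence
    0. So [D A D] and [D B D] are positive semidefinite with traces adding up to 0, and both vanish.
    Their difference is the cube of the self-adjoint [D], whence [D = 0]. *)
Lemma psd_sqrt_unique n (A B : 'M[K]_n) :
  psd A -> psd B -> A *m A = B *m B -> A = B.
Proof.
move=> pA pB AB; pose D := A - B.
have hD : D^h = D by rewrite adjointB (psd_herm pA) (psd_herm pB).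
have D0 : D *m (A + B) + (A + B) *m D = 0.
  rewrite /D !mulmxDl !mulmxDr !mulNmx !mulmxN AB.
  move: (B *m B) (A *m B) (B *m A) => p q r.
  by apply/matrixP => i j; rewrite !mxE; ring.
have t0 : \tr (D *m A *m D) + \tr (D *m B *m D) = 0.
  rewrite -mxtraceD -mulmxDl -mulmxDr; set t := \tr _.
  have : t + t = 0.
    rewrite {1}/t mxtrace_mulC {1}/t -mulmxA -mxtraceD -mulmxDr D0 mulmx0.
    exact: linear0.
  by rewrite -mulr2n => /eqP; rewrite mulrn_eq0 => /eqP.
have p1 : psd (D *m A *m D) by rewrite -{1}hD; exact: psd_conj.
have p2 : psd (D *m B *m D) by rewrite -{1}hD; exact: psd_conj.
have := psd_tr_ge0 p1; have := psd_tr_ge0 p2.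
have := congr1 re t0; rewrite sc_reD sc_re0 => t0' ge2 ge1.
have D1 : D *m A *m D = 0 by apply: psd_tr_eq0 => //; lra.
have D2 : D *m B *m D = 0 by apply: psd_tr_eq0 => //; lra.
have D3 : D *m (A - B) *m D = 0 
  by rewrite [D *m (A - B)]mulmxBr [(_ - _) *m D]mulmxBl D1 D2 subr0.
rewrite -/D in D3.
have D4 : D *m D = 0.
  by apply: mulmx_adjoint_eq0; rewrite adjointM hD mulmxA D3 mul0mx.
by apply/eqP; rewrite -subr_eq0; apply/eqP/mulmx_adjoint_eq0; rewrite hD.
Qed.
End Scalars.

(** * Grassmannians as spaces of orthogonal projections *)

Section ScalarTopology.
Variables (R : realType) (K : scalars R).

Local Notation of_ := (@sc_of R K).
Local Notation re := (@sc_re R K).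
Local Notation im := (@sc_im R K).

Section Continuity.
Variable X : topologicalType.

Lemma adjoint_continuous m n (f : X -> 'M[K]_(m, n)) :
  continuous f -> continuous (fun x => (f x)^h).
Proof.
move=> cf; apply: trmx_continuous; apply: map_mx_continuous cf.
exact: sc_conj_continuous.
Qed.

Lemma re_continuous (f : X -> K) : continuous f -> continuous (fun x => re (f x)).
Proof. by move=> cf; exact: comp_continuous cf (@sc_re_continuous R K). Qed.

Lemma of_continuous (f : X -> R) : continuous f -> continuous (fun x => of_ (f x)).
Proof. by move=> cf; exact: comp_continuous cf (@sc_of_continuous R K). Qed.

Lemma frob_continuous m n (f : X -> 'M[K]_(m, n)) :
  continuous f -> continuous (fun x => frob (f x)).
Proof.
move=> cf; apply: fct_sum_continuous => i; apply: fct_sum_continuous => j.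
have cfij : continuous (fun x => f x i j) by exact: entry_continuous.
have cre := comp_continuous cfij (@sc_re_continuous R K).
have cim := comp_continuous cfij (@sc_im_continuous R K).
by apply: fct_add_continuous; exact: fct_mul_continuous.
Qed.

Lemma qform_continuous n (f : X -> 'M[K]_n) v :
  continuous f -> continuous (fun x => qform (f x) v).
Proof.
move=> cf; apply: entry_continuous; apply: mxmul_continuous.
  by apply: mxmul_continuous => //; exact: fct_cst_continuous.
exact: fct_cst_continuous.
Qed.

Lemma closed_fct_eq (Y : topologicalType) (f : X -> Y) (c : Y) :
  hausdorff_space Y -> continuous f -> closed [set x | f x = c].
Proof.
move=> hY cf; apply: (@closed_comp _ _ f [set c]) => [x _|]; first exact: cf.
by apply: accessible_closed_set1; exact: hausdorff_accessible.
Qed.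

Lemma closed_fct_le (f g : X -> R) :
  continuous f -> continuous g -> closed [set x | f x <= g x].
Proof.
move=> cf cg; have cgf : continuous (fun x => g x - f x).
  by apply: fct_add_continuous => //; exact: fct_opp_continuous.
rewrite (_ : mkset _ = (fun x => g x - f x) @^-1` [set y | 0 <= y]).
  by apply: closed_comp => [x _|]; [exact: cgf|exact: closed_ge].
by apply/seteqP; split => x /=; rewrite subr_ge0.
Qed.

Lemma closed_psd n (f : X -> 'M[K]_n) :
  continuous f -> closed [set x | psd (f x)].
Proof.
move=> cf; rewrite (_ : mkset _ = [set x | (f x)^h - f x = 0] `&`
   \bigcap_v [set x | 0 <= re (qform (f x) v)]).
  apply: closedI.
    apply: closed_fct_eq; first exact: norm_hausdorff.
    apply: mxadd_continuous; first exact: adjoint_continuous.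
    exact: mxopp_continuous.
  apply: closed_bigI => v _; apply: closed_fct_le.
    exact: fct_cst_continuous.
  by apply: re_continuous; exact: qform_continuous.
apply/seteqP; split => x /=.
  move=> [hf pf]; split; first by rewrite hf subrr.
  by move=> v _; have := pf v; rewrite sc_ge0 => /andP[].
move=> [/eqP]; rewrite subr_eq0 => /eqP hf pf; split => // v.
rewrite sc_ge0 (pf v I) andbT; apply/eqP/sc_conj_fixed.
rewrite /qform -[in LHS](adjointK (v *m f x *m v^h)) mxE mxE sc_conjK.
by rewrite !adjointM adjointK hf mulmxA.
Qed.

(** A rank above [r] is witnessed by a compression [C *m f x *m D] of size [r.+1] with nonzero
    determinant, an open condition on [x]. Arbitrary [C] and [D] take the place of minors; Gaussian
    elimination supplies them. *)
Lemma closed_rank m n r (f : X -> 'M[K]_(m, n)) :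
  continuous f -> closed [set x | (\rank (f x) <= r)%N].
Proof.
move=> cf; rewrite -[X in closed X]setCK; apply: open_closedC.
rewrite (_ : ~` _ = \bigcup_(CD in [set: 'M[K]_(r.+1, m) * 'M[K]_(n, r.+1)])
   [set x | \det (CD.1 *m f x *m CD.2) != 0]).
  apply: bigcup_open => -[C D] _ /=.
  apply: (@open_comp _ _ (fun x => \det (C *m f x *m D)) [set y | y != 0]).
    move=> x _; apply: det_continuous.
    apply: mxmul_continuous; last exact: fct_cst_continuous.
    by apply: mxmul_continuous => //; exact: fct_cst_continuous.
  rewrite (_ : mkset _ = ~` [set 0]); last first.
    by apply/seteqP; split => y /= /eqP.
  apply: closed_openC; apply: accessible_closed_set1.
  by apply: hausdorff_accessible; exact: norm_hausdorff.
apply/seteqP; split => x /=.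
  move=> /negP; rewrite -ltnNge => rx.
  exists (pid_mx r.+1 *m invmx (col_ebase (f x)),
          invmx (row_ebase (f x)) *m pid_mx r.+1) => //=.
  rewrite -unitfE -unitmxE -{2}(mulmx_ebase (f x)) !mulmxA.
  rewrite mulmxKV ?col_ebase_unit// -!mulmxA mulKVmx ?row_ebase_unit//.
  rewrite !mul_pid_mx.
  have := rank_leq_row (f x); have := rank_leq_col (f x) => h1 h2.
  rewrite (_ : minn _ _ = r.+1); last by lia.
  by rewrite pid_mx_1 unitmx1.
move=> [[C D] _ /=]; rewrite -unitfE -unitmxE -row_free_unit => /eqP CfD.
apply/negP; rewrite -ltnNge -[r.+1]CfD.
by apply: leq_trans (mxrankM_maxl _ _) _; exact: mxrankM_maxr.
Qed.

End Continuity.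

Definition sc_box (M : R) : set K :=
  (fun ab => of_ ab.1 + sc_i K * of_ ab.2) @` (`[- M, M] `*` `[- M, M]).

Lemma sc_box_compact M : compact (sc_box M).
Proof.
apply: continuous_compact; last by apply: compact_setX; exact: segment_compact.
apply: continuous_subspaceT; apply: fct_add_continuous.
  exact: comp_continuous (@fst_continuous _ _) (@sc_of_continuous R K).
apply: fct_mul_continuous; first exact: fct_cst_continuous.
exact: comp_continuous (@snd_continuous _ _) (@sc_of_continuous R K).
Qed.

(** The Heine-Borel theorem, with boxes that are images of real squares so that it covers both
    fields. *)
Lemma compact_frob m n (A : set 'M[K]_(m, n)) (M : R) :
  closed A -> (forall x, A x -> frob x <= M) -> compact A.
Proof.
(* From [a ^+ 2 <= M] follows that [a] lies between [- (1 + M)] and [1 + M]; this crude bound avoids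
   a square root. *)
move=> clA AM; pose N := 1 + M.
have cbox : compact [set v : 'rV[K]_(m * n) | forall i, sc_box N (v ord0 i)].
  by apply: (@rV_compact _ _ (fun=> sc_box N)) => i; exact: sc_box_compact.
have : compact (vec_mx @` [set v : 'rV[K]_(m * n) |
    forall i, sc_box N (v ord0 i)] : set 'M[K]_(m, n)).
  apply: continuous_compact cbox; apply: continuous_subspaceT.
  apply: mx_continuous => i j; under eq_fun do rewrite mxE.
  exact: coord_continuous.
move=> /subclosed_compact; apply => // x Ax.
exists (mxvec x); last exact: mxvecK.
move=> ij; case/mxvec_indexP: ij => i j; rewrite mxvecE.
have xM : sqn (x i j) <= M.
  apply: le_trans (AM _ Ax); rewrite /frob (bigD1 i)//= (bigD1 j)//=.
  rewrite -addrA lerDl addr_ge0//; first by apply: sumr_ge0 => l _; exact: sqn_ge0.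
  by apply: sumr_ge0 => l _; apply: sumr_ge0 => l' _; exact: sqn_ge0.
have sq1 (a b : R) : a ^+ 2 + b ^+ 2 <= M -> - N <= a <= N.
  move=> h; have b0 : 0 <= b ^+ 2 by exact: sqr_ge0.
  by rewrite /N; apply/andP; split; nra.
exists (re (x i j), im (x i j)); last by rewrite [RHS]sc_rect.
by split => /=; rewrite in_itv /=; [apply: sq1 xM|apply: (@sq1 _ (re (x i j)));
  rewrite addrC].
Qed.

Section GrassmannianProjection.
Variables (k m : nat).

Lemma gram_unit (A : 'M[K]_(k, m)) : row_free A -> A *m A^h \in unitmx.
Proof.
move=> fA; rewrite -row_free_unit /row_free -{1}(adjointK A) mxrank_gram.
by rewrite mxrank_adjoint.
Qed.

(** The polar decomposition, with [M] the square root of [A *m A^h]. *)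
Lemma row_free_polar (A : 'M[K]_(k, m)) : row_free A ->
  exists (M : 'M[K]_k) (V : 'M[K]_(k, m)),
    [/\ psd M, M \in unitmx, V *m V^h = 1%:M & A = M *m V].
Proof.
move=> fA; have uA := gram_unit fA.
have [M pM ME] : exists2 M : 'M[K]_k, psd M & M *m M = A *m A^h.
  by apply: psd_gram; rewrite -{1}(adjointK A); exact: gram_psd.
have uM : M \in unitmx by move: uA; rewrite -ME unitmx_mul andbb.
exists M, (invmx M *m A); split => //; last by rewrite mulKVmx.
rewrite adjointM adjoint_inv (psd_herm pM) mulmxA -(mulmxA _ A) -ME.
by rewrite mulKmx// mulmxV.
Qed.

(** The orthogonal projection onto the row space of a frame [A]. It depends on the span only, and so
    embeds the Grassmannian into a space of matrices. *)
Definition orth_proj (A : 'M[K]_(k, m)) := A^h *m invmx (A *m A^h) *m A.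

Lemma orth_proj_herm A : (orth_proj A)^h = orth_proj A.
Proof.
by rewrite /orth_proj !adjointM adjoint_inv adjointM adjointK mulmxA.
Qed.

Lemma orth_proj_id A : row_free A -> A *m orth_proj A = A.
Proof.
by move=> /gram_unit uA; rewrite /orth_proj !mulmxA mulmxV// mul1mx.
Qed.

Lemma orth_projM A : row_free A -> orth_proj A *m orth_proj A = orth_proj A.
Proof. by move=> fA; rewrite {1}/orth_proj -mulmxA orth_proj_id. Qed.

Lemma orth_proj_eqmx A : row_free A -> (orth_proj A :=: A)%MS.
Proof.
move=> fA; apply/eqmxP; rewrite submxMl /=.
by rewrite -{1}(orth_proj_id fA) submxMl.
Qed.

(** Equal row spaces give [P Q = P] and [Q P = Q]; the adjoint of the first equation is
    [Q P = P]. *)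
Lemma proj_unique (P Q : 'M[K]_m) : P^h = P -> Q^h = Q -> P *m P = P ->
  Q *m Q = Q -> (P == Q)%MS -> P = Q.
Proof.
move=> hP hQ PP QQ /andP[/submxP[X PE] /submxP[Y QE]].
have PQ : P *m Q = P by rewrite {1}PE -mulmxA QQ -PE.
have QP : Q *m P = Q by rewrite {1}QE -mulmxA PP -QE.
by rewrite -[LHS]hP -[in LHS]PQ adjointM hP hQ.
Qed.

Local Notation Gr := (grassmannian K k m).

Definition gr_proj (W : Gr) : 'M[K]_m := orth_proj (set_val (repr W)).

Lemma frames_row_free (A : set_type (@frames K k m)) : row_free (set_val A).
Proof. exact: (set_val_in A). Qed.

Lemma orth_proj_span (A B : set_type (@frames K k m)) :
  same_span A B = (orth_proj (set_val A) == orth_proj (set_val B)).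
Proof.
apply/idP/eqP => [AB|AB].
  apply: proj_unique; rewrite ?orth_proj_herm ?orth_projM ?frames_row_free//.
  apply/eqmxP.
  apply: eqmx_trans (orth_proj_eqmx (frames_row_free A)) _.
  apply: eqmx_trans (eqmx_sym (orth_proj_eqmx (frames_row_free B))).
  exact/eqmxP.
apply/eqmxP.
apply: eqmx_trans (eqmx_sym (orth_proj_eqmx (frames_row_free A))) _.
by rewrite AB; exact: orth_proj_eqmx (frames_row_free B).
Qed.

Lemma gr_proj_pi (A : set_type (@frames K k m)) :
  gr_proj (\pi_Gr A) = orth_proj (set_val A).
Proof.
apply/eqP; rewrite -orth_proj_span.
by have /eqmodP := reprK (\pi_Gr A).
Qed.

Lemma gr_pi_continuous :
  continuous (fun A : set_type (@frames K k m) => \pi_Gr A).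
Proof. exact: (@pi_continuous _ {eq_quot (@same_span_equiv K k m)}). Qed.

Lemma gr_proj_inj : injective gr_proj.
Proof.
move=> V W /eqP; rewrite -orth_proj_span => VW.
rewrite -[V]reprK -[W]reprK.
by apply/(@eqmodP _ (@same_span_equiv K k m)).
Qed.

Lemma gr_proj_continuous : continuous gr_proj.
Proof.
apply/quotient_continuous.
rewrite (_ : _ \o _ = fun A => orth_proj (set_val A)); last first.
  by apply/funext => A /=; rewrite gr_proj_pi.
have cA := @set_val_continuous _ (@frames K k m).
apply: mxmul_continuous => //; apply: mxmul_continuous.
  exact: adjoint_continuous.
apply: invmx_continuous => [|A]; last exact: gram_unit (frames_row_free A).
by apply: mxmul_continuous => //; exact: adjoint_continuous.
Qed.

Lemma gr_proj_herm W : (gr_proj W)^h = gr_proj W.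
Proof. exact: orth_proj_herm. Qed.

Lemma gr_proj_idem W : gr_proj W *m gr_proj W = gr_proj W.
Proof. by rewrite orth_projM// frames_row_free. Qed.

Lemma gr_of_frame (V : 'M[K]_(k, m)) : V *m V^h = 1%:M ->
  exists W, gr_proj W = V^h *m V.
Proof.
move=> VV; have fV : row_free V by apply/row_freeP; exists V^h.
pose A : set_type (@frames K k m) := exist _ V (mem_set fV).
exists (\pi_Gr A); rewrite gr_proj_pi /orth_proj /=.
by rewrite VV invmx1 mulmx1.
Qed.

Lemma gr_frame W : exists2 V : 'M[K]_(k, m),
  V *m V^h = 1%:M & gr_proj W = V^h *m V.
Proof.
have [M [V [pM uM VV AE]]] := row_free_polar (frames_row_free (repr W)).
exists V => //; apply: proj_unique; rewrite ?gr_proj_herm ?gr_proj_idem//.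
- by rewrite adjointM adjointK.
- by rewrite !mulmxA -(mulmxA _ V) VV mulmx1.
apply/eqmxP; apply: eqmx_trans (orth_proj_eqmx (frames_row_free _)) _.
apply/eqmxP; rewrite AE; apply/andP; split.
  apply: submx_trans (submxMl _ _) _.
  by rewrite -{1}[V]mul1mx -VV -mulmxA submxMl.
apply: submx_trans (submxMl _ _) _.
by rewrite -{1}[V](mulKmx uM) submxMl.
Qed.

(** The Grassmannian is the image of the orthonormal frames, which form a closed set on which [frob]
    is constantly [k]. *)
Lemma gr_compact : compact [set: Gr].
Proof.
pose O := [set V : 'M[K]_(k, m) | V *m V^h = 1%:M].
have cO : compact O.
  apply: (@compact_frob _ _ O k%:R).
    apply: closed_fct_eq; first exact: norm_hausdorff.
    apply: mxmul_continuous; first by move=> x; exact: cvg_id.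
    by apply: adjoint_continuous => x; exact: cvg_id.
  move=> V VV; rewrite -(sc_of_le K) -frobE VV mxtrace1 rmorph_nat//.
have fV (V : set_type O) : row_free (set_val V).
  by apply/row_freeP; exists (set_val V)^h; exact: (set_val_in V).
pose h (V : set_type O) : Gr :=
  \pi_Gr (exist _ (set_val V) (mem_set (fV V)) : set_type (@frames K k m)).
have -> : [set: Gr] = range h.
  apply/seteqP; split => // W _; have [V VV WE] := gr_frame W.
  exists (exist _ V (mem_set VV)) => //.
  apply: gr_proj_inj; rewrite gr_proj_pi /orth_proj /= VV WE.
  by rewrite invmx1 mulmx1.
apply: continuous_compact; last exact: compact_set_type.
apply: continuous_subspaceT.
apply: (@comp_continuous _ _ _ (fun V : set_type O =>
  exist _ (set_val V) (mem_set (fV V)) : set_type (@frames K k m)) _ _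
  gr_pi_continuous).
by apply: set_type_continuous; exact: set_val_continuous.
Qed.

End GrassmannianProjection.
End ScalarTopology.

(** * The least eigenvalue *)

Section LeastEigenvalue.
Variables (R : realType) (K : scalars R).

Local Notation of_ := (@sc_of R K).
Local Notation re := (@sc_re R K).

Lemma spectral_herm n (A : 'M[K]_n) : A^h = A ->
  exists (U : 'M[K]_n) (l : 'rV[R]_n),
    U *m U^h = 1%:M /\ A = U^h *m diag_mx (map_mx of_ l) *m U.
Proof. exact: sc_spectral. Qed.

Lemma unitary_scalar n (U : 'M[K]_n) (a : K) :
  U *m U^h = 1%:M -> U^h *m a%:M *m U = a%:M.
Proof.
move=> /mulmx1C UU.
by rewrite scalar_mxC -mulmxA UU mulmx1.
Qed.

Lemma diag_mx_shift n (l : 'rV[R]_n) (a : R) :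
  diag_mx (map_mx of_ l) + (of_ a)%:M = diag_mx (map_mx of_ (l + const_mx a)).
Proof.
by apply/matrixP => i j; rewrite !mxE rmorphD mulrnDl.
Qed.

(* [neg_eig S] is minus the least eigenvalue of the self-adjoint matrix [S]. *)
Definition neg_eig_spec n (S : 'M[K]_n) (a : R) :=
  psd (S + (of_ a)%:M) /\
  exists2 w : 'rV[K]_n, w != 0 & w *m S = of_ (- a) *: w.

Definition neg_eig n (S : 'M[K]_n) : R := xget 0 (neg_eig_spec S).

Section Hermitian.
Variables (n : nat).
Hypothesis n_gt0 : (0 < n)%N.
Implicit Types S T : 'M[K]_n.

Lemma neg_eigP S : S^h = S -> neg_eig_spec S (neg_eig S).
Proof.
move=> hS; apply: xgetPex; have [U [l [UU SE]]] := spectral_herm hS.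
pose i0 : 'I_n := Ordinal n_gt0.
pose i := [arg min_(i < i0) l 0 i]%O.
have il j : l 0 i <= l 0 j by rewrite /i; case: arg_minP => // i' _; apply.
exists (- l 0 i); split.
  rewrite SE -(unitary_scalar (of_ (- l 0 i)) UU) -mulmxDl -mulmxDr.
  rewrite diag_mx_shift; apply: psd_conj; apply: psd_diag => j.
  by rewrite !mxE subr_ge0.
exists (row i U).
  apply/negP => /eqP r0; have := congr1 (row i) UU.
  rewrite row_mul r0 mul0mx => /rowP/(_ i); rewrite !mxE eqxx => /eqP.
  by rewrite eq_sym oner_eq0.
rewrite opprK SE !mulmxA -row_mul UU rowE mulmx1 rowE scalemxAl; congr (_ *m U).
apply/rowP => j; rewrite mul_mx_diag !mxE eqxx /=.
by case: eqP => [->|_]; rewrite ?mul1r ?mulr1 ?mul0r ?mulr0.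
Qed.

Lemma qform_eigen S (w : 'rV[K]_n) a b : w *m S = of_ a *: w ->
  qform (S + (of_ b)%:M) w = of_ ((a + b) * frob w).
Proof.
move=> wS; rewrite rmorphM -qform1 /qform mulmx1 mulmxDr wS mul_mx_scalar.
by rewrite -scalerDl -rmorphD -scalemxAl mxE.
Qed.

Lemma frob_gt0 m p (w : 'M[K]_(m, p)) : w != 0 -> 0 < frob w.
Proof.
rewrite lt_def frob_ge0 andbT; apply: contra => /eqP/frob_eq0 ->.
by [].
Qed.

(** The form is evaluated at an eigenvector for the least eigenvalue. *)
Lemma neg_eig_min S b : S^h = S -> psd (S + (of_ b)%:M) -> neg_eig S <= b.
Proof.
move=> /neg_eigP[_ [w w0 wS]] [_ /(_ w)]; rewrite (qform_eigen _ wS).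
by rewrite sc_of_ge0 pmulr_lge0 ?frob_gt0//; lra.
Qed.

Lemma neg_eig_eq S a : S^h = S -> neg_eig_spec S a -> neg_eig S = a.
Proof.
move=> hS [pa [w w0 wS]]; apply/eqP; rewrite eq_le neg_eig_min//=.
have [[_ /(_ w) pw] _] := neg_eigP hS; move: pw; rewrite (qform_eigen _ wS).
by rewrite sc_of_ge0 pmulr_lge0 ?frob_gt0//; lra.
Qed.

Lemma neg_eigZ S a : S^h = S -> 0 <= a -> neg_eig (of_ a *: S) = a * neg_eig S.
Proof.
move=> hS a0; have [p [w w0 wS]] := neg_eigP hS.
apply: neg_eig_eq; first by rewrite adjointZ hS.
split; first by rewrite rmorphM -scale_scalar_mx -scalerDr; exact: psdZ.
by exists w => //; rewrite -scalemxAr wS scalerA -rmorphM mulrN.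
Qed.

Lemma neg_eig_ge0 S : S^h = S -> \tr S = 0 -> 0 <= neg_eig S.
Proof.
move=> hS tS; have [p _] := neg_eigP hS.
have := psd_tr_ge0 p; rewrite mxtraceD tS add0r mxtrace_scalar.
rewrite -mulr_natl -[n%:R](rmorph_nat of_) sc_reZ sc_re_of pmulr_rge0//.
by rewrite ltr0n.
Qed.

(** The least eigenvalue is one of the diagonal entries in an eigenbasis, and the squares of all
    these entries add up to [frob S]. *)
Lemma neg_eig_frob S : S^h = S -> neg_eig S <= Num.sqrt (frob S).
Proof.
move=> hS; have [_ [w w0 wS]] := neg_eigP hS; set e := neg_eig S in wS *.
have [U [l [UU SE]]] := spectral_herm hS.
have [i yi0] : exists i, (w *m U^h) 0 i != 0.
  apply/existsP; apply: contraR w0; rewrite negb_exists => /forallP y0.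
  rewrite -[w]mulmx1 -(mulmx1C UU) mulmxA.
  suff -> : w *m U^h = 0 by rewrite mul0mx.
  by apply/rowP => i; rewrite [RHS]mxE; apply/eqP; have := y0 i; rewrite negbK.
have li : l 0 i = - e.
  have := congr1 (mulmx^~ U^h) wS.
  rewrite SE -scalemxAl !mulmxA -[_ *m U *m _]mulmxA UU mulmx1.
  move: (w *m U^h) yi0 => y yi0 /rowP/(_ i).
  by rewrite mul_mx_diag !mxE mulrC => /(mulIf yi0)/(@sc_of_inj _ K).
have fE : frob S = \sum_j l 0 j ^+ 2.
  apply: (@sc_of_inj _ K); rewrite -frobE hS {1}SE SE mxtrace_mulC !mulmxA.
  rewrite -[_ *m U *m _]mulmxA UU mulmx1 mxtrace_mulC !mulmxA UU mul1mx.
  rewrite mulmx_diag mxtrace_diag rmorph_sum; apply: eq_bigr => j _.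
  by rewrite !mxE rmorphXn expr2.
apply: le_trans (ler_norm _) _; rewrite -sqrtr_sqr ler_wsqrtr// fE.
rewrite (bigD1 i)//= li sqrrN lerDl; apply: sumr_ge0 => j _; exact: sqr_ge0.
Qed.

(** Weyl's inequality: shifting [T] and [S - T] by their own [neg_eig] makes both positive
    semidefinite, hence also their sum, which is a shift of [S]. *)
Lemma neg_eig_lipschitz S T : S^h = S -> T^h = T ->
  neg_eig S <= neg_eig T + Num.sqrt (frob (S - T)).
Proof.
move=> hS hT; have hST : (S - T)^h = S - T by rewrite adjointB hS hT.
apply: le_trans (_ : _ <= neg_eig T + neg_eig (S - T)) _; last first.
  by rewrite lerD2l neg_eig_frob.
apply: neg_eig_min => //; have [p _] := neg_eigP hT.
have [q _] := neg_eigP hST; have := psdD p q.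
by rewrite rmorphD raddfD /= addrACA addrA [T + _]addrC addrA subrK -addrA.
Qed.

Lemma neg_eig_continuous (X : topologicalType) (f : X -> 'M[K]_n) :
  continuous f -> (forall x, (f x)^h = f x) ->
  continuous (fun x => neg_eig (f x)).
Proof.
move=> cf hf x; apply/cvgrPdist_lt => e e0.
have cF : continuous (fun y => frob (f x - f y)).
  apply: frob_continuous; apply: mxadd_continuous; last exact: mxopp_continuous.
  exact: fct_cst_continuous.
have /cvgrPdist_lt/(_ _ (exprn_gt0 2 e0)) := cF x.
apply: filterS => y; rewrite subrr.
have -> : frob (0 : 'M[K]_n) = 0.
  by apply: (@sc_of_inj _ K); rewrite -frobE mul0mx linear0 rmorph0.
rewrite sub0r normrN ger0_norm ?frob_ge0// => h.
have he : Num.sqrt (frob (f x - f y)) < e.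
  by rewrite -(@ger0_norm _ e) ?ltW// -sqrtr_sqr ltr_sqrt// exprn_gt0.
have := neg_eig_lipschitz (hf x) (hf y).
have := neg_eig_lipschitz (hf y) (hf x).
have -> : frob (f y - f x) = frob (f x - f y).
  by apply: (@sc_of_inj _ K); rewrite -!frobE -opprB adjointN mulNmx mulmxN opprK.
by rewrite ltr_norml => h1 h2; apply/andP; split; lra.
Qed.

End Hermitian.

(** Here [neg_eig S] is taken on the whole space, not on the range of [P]. For a traceless [S]
    supported on that range this is the same: the least eigenvalue on the range is at most 0, so the
    zeros on the complement do not change it. *)
Definition lift_psd m (P : 'M[K]_m) (t : R) (S : 'M[K]_m) :=
  of_ (t + neg_eig S) *: P + S.

Section Compressed.
Variables (k m : nat) (V : 'M[K]_(k, m)).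
Hypothesis VV : V *m V^h = 1%:M.
Hypothesis k_gt0 : (0 < k)%N.
Let P := V^h *m V.

Let m_gt0 : (0 < m)%N.
Proof.
rewrite lt0n; apply/negP => /eqP m0; move: VV; move: V; rewrite m0 => V'.
rewrite [V' *m _](_ : _ = 0); last first.
  by rewrite (_ : V' = 0) ?mul0mx//; apply/matrixP => i [].
move=> /matrixP/(_ (Ordinal k_gt0) (Ordinal k_gt0)).
by rewrite !mxE eqxx => /eqP; rewrite eq_sym oner_eq0.
Qed.

Lemma frame_proj_herm : P^h = P. Proof. by rewrite adjointM adjointK. Qed.

Lemma frame_proj_idem : P *m P = P.
Proof. by rewrite /P mulmxA -(mulmxA _ V) VV mulmx1. Qed.

Lemma frame_proj_rank : \rank P = k.
Proof.
rewrite /P mxrank_gram; apply/eqP; rewrite -/(row_free V).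
by apply/row_freeP; exists V^h.
Qed.

Lemma frame_proj_tr : \tr P = k%:R.
Proof. by rewrite /P mxtrace_mulC VV mxtrace1. Qed.

Lemma frame_proj_psd : psd P. Proof. exact: gram_psd. Qed.

Variable S : 'M[K]_m.
Hypothesis hS : S^h = S.
Hypothesis SP : S *m P = S.
Hypothesis tS : \tr S = 0.

Let PS : P *m S = S.
Proof. by rewrite -[LHS]adjointK adjointM hS frame_proj_herm SP hS. Qed.

Lemma lift_psd_proj t : lift_psd P t S *m P = lift_psd P t S.
Proof. by rewrite mulmxDl -scalemxAl frame_proj_idem SP. Qed.

Lemma lift_psdE t : lift_psd P t S =
  of_ t *: P + P^h *m (S + (of_ (neg_eig S))%:M) *m P.
Proof.
rewrite frame_proj_herm mulmxDr mulmxDl PS SP mul_mx_scalar -scalemxAl.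
by rewrite frame_proj_idem /lift_psd rmorphD scalerDl -addrA [S + _]addrC.
Qed.

Lemma lift_psd_psd t : 0 <= t -> psd (lift_psd P t S).
Proof.
move=> t0; rewrite lift_psdE; apply: psdD; first exact: psdZ frame_proj_psd.
by apply: psd_conj; have [] := neg_eigP m_gt0 hS.
Qed.

Lemma lift_psd_rank_le t : (\rank (lift_psd P t S) <= k)%N.
Proof. by rewrite -lift_psd_proj -frame_proj_rank mxrankM_maxr. Qed.

(** The form of [lift_psd P t S] is at least [t] times that of [P], so its kernel lies in the kernel
    of [P]. *)
Lemma lift_psd_rank t : 0 < t -> \rank (lift_psd P t S) = k.
Proof.
move=> t0; apply/eqP; rewrite eqn_leq lift_psd_rank_le /=.
have : (kermx (lift_psd P t S) <= kermx P)%MS.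
  apply/rV_subP => v /sub_kermxP vH; apply/sub_kermxP.
  have q0 : qform (lift_psd P t S) v = 0 by rewrite /qform vH mul0mx mxE.
  move: q0; rewrite lift_psdE qformD qformZ.
  have [_ /(_ v)] := frame_proj_psd; rewrite sc_ge0 => /andP[/eqP qP qP0].
  have [_ /(_ v)] := psd_conj P (neg_eigP m_gt0 hS).1.
  rewrite sc_ge0 => /andP[/eqP qQ qQ0].
  rewrite qP qQ -rmorphM -rmorphD => /eqP; rewrite sc_of_eq0.
  rewrite paddr_eq0// ?mulr_ge0// ?ltW// mulf_eq0 gt_eqF//= => /andP[/eqP q _].
  by apply: psd_null frame_proj_psd _; rewrite qP q rmorph0.
move=> /mxrankS; rewrite !mxrank_ker frame_proj_rank.
have := rank_leq_row (lift_psd P t S).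
have := rank_leq_row P; rewrite frame_proj_rank; lia.
Qed.

(** If the least eigenvalue is 0, then [S] is positive semidefinite with trace 0, so everything
    vanishes, and [0 < k]. Otherwise an eigenvector for it is nonzero, lies in the range of [P], and
    is annihilated by the lift. *)
Lemma lift_psd0_rank : (\rank (lift_psd P 0 S) < k)%N.
Proof.
have [psdS [w w0 wS]] := neg_eigP m_gt0 hS.
have [e0|e0] := eqVneq (neg_eig S) 0.
  move: psdS; rewrite e0 rmorph0 raddf0 addr0 => /psd_tr_eq0.
  rewrite tS sc_re0 => /(_ erefl) S0.
  by rewrite /lift_psd e0 S0 !addr0 rmorph0 scale0r mxrank0.
have wP : w *m P = w.
  have : of_ (- neg_eig S) *: (w *m P) = of_ (- neg_eig S) *: w.
    by rewrite scalemxAl -wS -mulmxA SP.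
  move/(congr1 (fun v => (of_ (- neg_eig S))^-1 *: v)).
  by rewrite !scalerA mulVf ?scale1r// sc_of_eq0 oppr_eq0.
have wH : w *m lift_psd P 0 S = 0.
  rewrite /lift_psd mulmxDr -scalemxAr wP wS add0r -scalerDl -rmorphD subrr.
  by rewrite rmorph0 scale0r.
(* The lift factors through the [k] rows of [V *m lift_psd P 0 S], which are linearly dependent
   because [w *m V^h] annihilates them. *)
have HV : lift_psd P 0 S = V^h *m (V *m lift_psd P 0 S).
  have hH := psd_herm (lift_psd_psd (lexx 0)).
  rewrite mulmxA -/P -[RHS]adjointK adjointM hH frame_proj_herm lift_psd_proj.
  by rewrite hH.
rewrite HV; apply: leq_ltn_trans (mxrankM_maxr _ _) _.
rewrite ltn_neqAle rank_leq_row andbT; apply/negP => /row_freeP[Y VHY].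
have : w *m V^h *m (V *m lift_psd P 0 S) = 0.
  by rewrite -mulmxA -HV.
move=> /(congr1 (mulmx^~ Y)); rewrite mul0mx -(mulmxA (w *m V^h)) VHY mulmx1 => wV.
by move: w0; rewrite -wP /P mulmxA wV mul0mx eqxx.
Qed.

Lemma lift_psd_tr t : \tr (lift_psd P t S) = of_ ((t + neg_eig S) * k%:R).
Proof.
by rewrite mxtraceD mxtraceZ tS addr0 frame_proj_tr rmorphM rmorph_nat.
Qed.

(** The trace is [k] times the sum of the nonnegative numbers [t] and [neg_eig S]. *)
Lemma lift_psd_eq0 t : 0 <= t -> lift_psd P t S = 0 -> t = 0 /\ S = 0.
Proof.
move=> t0 H0; have := lift_psd_tr t; rewrite H0 linear0 => /esym/eqP.
have e0 := neg_eig_ge0 m_gt0 hS tS.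
rewrite sc_of_eq0 mulf_eq0 pnatr_eq0 (gtn_eqF k_gt0) orbF => /eqP te.
have t0' : t = 0 by lra.
have e0' : neg_eig S = 0 by lra.
by split => //; move: H0; rewrite /lift_psd te rmorph0 scale0r add0r.
Qed.

End Compressed.

(** [S] is the traceless part of [H] on the range of [V], and [a] is the mean eigenvalue there. As
    [S + a] is [H] plus a multiple of the complementary projection, [neg_eig S <= a]; equality would
    make the rank drop below [k]. *)
Lemma lift_psd_surj k m (V : 'M[K]_(k, m)) (H : 'M[K]_m) :
  V *m V^h = 1%:M -> (0 < k)%N -> psd H -> H *m (V^h *m V) = H ->
  \rank H = k ->
  exists (t : R) (S : 'M[K]_m), [/\ 0 < t, S^h = S, S *m (V^h *m V) = S,
    \tr S = 0 & H = lift_psd (V^h *m V) t S].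
Proof.
move=> VV k0 pH HP rH; set P := V^h *m V in HP *.
pose a := re (\tr H) / k%:R; pose S := H - of_ a *: P.
have kn0 : k%:R != 0 :> R by rewrite pnatr_eq0 -lt0n.
have hP : P^h = P := frame_proj_herm V.
have PP : P *m P = P := frame_proj_idem VV.
have hS : S^h = S by rewrite adjointB adjointZ (psd_herm pH) hP.
have SP : S *m P = S by rewrite mulmxBl -scalemxAl PP HP.
have tS : \tr S = 0.
  rewrite linearB /= mxtraceZ frame_proj_tr// (herm_trace_real (psd_herm pH)).
  by rewrite -(rmorph_nat of_) -rmorphM /a divfK// subrr.
have a0 : 0 <= a by rewrite divr_ge0// psd_tr_ge0.
have m0 : (0 < m)%N.
  by apply: leq_trans k0 _; rewrite -rH rank_leq_row.
have ea : neg_eig S <= a.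
  apply: neg_eig_min => //.
  have -> : S + (of_ a)%:M = H + of_ a *: ((1%:M - P)^h *m (1%:M - P)).
    rewrite adjointB adjoint1 hP mulmxBl mul1mx mulmxBr mulmx1 PP subrr subr0.
    by rewrite scalerBr scalemx1 /S addrA addrAC.
  by apply: psdD => //; apply: psdZ => //; exact: gram_psd.
have HE : H = lift_psd P (a - neg_eig S) S by rewrite /lift_psd subrK subrKC.
exists (a - neg_eig S), S; split => //.
rewrite lt_def subr_ge0 ea andbT; apply/eqP => e0.
have := lift_psd0_rank VV k0 hS SP tS.
by rewrite -e0 -HE rH ltnn.
Qed.

End LeastEigenvalue.

(** * The fibre as the range of a real idempotent matrix *)

Lemma idempotent_trace (F : fieldType) N (Q : 'M[F]_N) :
  Q *m Q = Q -> \tr Q = (\rank Q)%:R.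
Proof.
move=> QQ; have [L [S [QE SL]]] := idempotent_rank_factor QQ erefl.
by rewrite [in LHS]QE mxtrace_mulC SL mxtrace1.
Qed.

Section Realification.
Variables (R : realType) (K : scalars R).

Local Notation of_ := (@sc_of R K).
Local Notation re := (@sc_re R K).
Local Notation im := (@sc_im R K).

Section Maps.
Variables p q : nat.

(** In the real case the second half is 0 and [unrealify] ignores it, so the two maps are mutually
    inverse only in the complex case. *)
Definition realify (Q : 'M[K]_(p, q)) : 'rV[R]_(p * q + p * q) :=
  row_mx (mxvec (map_mx re Q)) (mxvec (map_mx im Q)).

Definition unrealify (x : 'rV[R]_(p * q + p * q)) : 'M[K]_(p, q) :=
  map_mx of_ (vec_mx (lsubmx x)) + sc_i K *: map_mx of_ (vec_mx (rsubmx x)).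

Lemma realifyK : cancel realify unrealify.
Proof.
move=> Q; rewrite /unrealify /realify row_mxKl row_mxKr !mxvecK.
by apply/matrixP => i j; rewrite !mxE [RHS]sc_rect.
Qed.

Lemma realifyD Q T : realify (Q + T) = realify Q + realify T.
Proof.
rewrite /realify add_row_mx -!raddfD /=; congr (row_mx (mxvec _) (mxvec _));
  by apply/matrixP => i j; rewrite !mxE (sc_reD, sc_imD).
Qed.

Lemma realifyZ a Q : realify (of_ a *: Q) = a *: realify Q.
Proof.
rewrite /realify scale_row_mx -!linearZ /=; congr (row_mx (mxvec _) (mxvec _));
  by apply/matrixP => i j; rewrite !mxE (sc_reZ, sc_imZ).
Qed.

Lemma unrealifyD x y : unrealify (x + y) = unrealify x + unrealify y.
Proof.
by apply/matrixP => i j; rewrite !mxE !rmorphD mulrDr addrACA.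
Qed.

Lemma unrealifyZ a x : unrealify (a *: x) = of_ a *: unrealify x.
Proof.
by apply/matrixP => i j; rewrite !mxE !rmorphM mulrDr mulrCA.
Qed.

Lemma realify_continuous (X : topologicalType) (f : X -> 'M[K]_(p, q)) :
  continuous f -> continuous (fun x => realify (f x)).
Proof.
move=> cf; apply: row_mx_continuous; apply: mx_continuous => i j;
  case/mxvec_indexP: j => a b; rewrite (ord1 i);
  under eq_fun do rewrite mxvecE mxE.
  exact: comp_continuous (entry_continuous cf) (@sc_re_continuous R K).
exact: comp_continuous (entry_continuous cf) (@sc_im_continuous R K).
Qed.

Lemma unrealify_continuous (X : topologicalType)
    (f : X -> 'rV[R]_(p * q + p * q)) :
  continuous f -> continuous (fun x => unrealify (f x)).
Proof.
move=> cf; apply: mx_continuous => i j; under eq_fun do rewrite !mxE.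
apply: fct_add_continuous; last first.
  apply: fct_mul_continuous; first exact: fct_cst_continuous.
  by apply: of_continuous; exact: entry_continuous.
by apply: of_continuous; exact: entry_continuous.
Qed.

Lemma unrealify_delta_l i j :
  unrealify (delta_mx 0 (lshift _ (mxvec_index i j))) = delta_mx i j.
Proof.
rewrite /unrealify.
have -> : rsubmx (delta_mx 0 (lshift (p * q) (mxvec_index i j)) :
    'rV[R]_(p * q + p * q)) = 0.
  by apply/rowP => l; rewrite !mxE eq_rlshift andbF.
have -> : lsubmx (delta_mx 0 (lshift (p * q) (mxvec_index i j)) :
    'rV[R]_(p * q + p * q)) = delta_mx 0 (mxvec_index i j).
  by apply/rowP => l; rewrite !mxE (inj_eq (@lshift_inj _ _)).
by rewrite linear0 map_mx0 scaler0 addr0 vec_mx_delta map_delta_mx.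
Qed.

Lemma unrealify_delta_r i j :
  unrealify (delta_mx 0 (rshift _ (mxvec_index i j))) = sc_i K *: delta_mx i j.
Proof.
rewrite /unrealify.
have -> : lsubmx (delta_mx 0 (rshift (p * q) (mxvec_index i j)) :
    'rV[R]_(p * q + p * q)) = 0.
  by apply/rowP => l; rewrite !mxE eq_lrshift andbF.
have -> : rsubmx (delta_mx 0 (rshift (p * q) (mxvec_index i j)) :
    'rV[R]_(p * q + p * q)) = delta_mx 0 (mxvec_index i j).
  by apply/rowP => l; rewrite !mxE (inj_eq (@rshift_inj _ _)).
by rewrite linear0 map_mx0 add0r vec_mx_delta map_delta_mx.
Qed.

Definition real_mx (f : 'M[K]_(p, q) -> 'M[K]_(p, q)) :
    'M[R]_(p * q + p * q) :=
  \matrix_i realify (f (unrealify (delta_mx 0 i))).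

Section RealLinear.
Variable f : 'M[K]_(p, q) -> 'M[K]_(p, q).
Hypothesis fD : forall Q T, f (Q + T) = f Q + f T.
Hypothesis fZ : forall a Q, f (of_ a *: Q) = of_ a *: f Q.

Lemma mul_real_mx x : x *m real_mx f = realify (f (unrealify x)).
Proof.
pose g (y : 'rV[R]_(p * q + p * q)) := realify (f (unrealify y)).
have gZ a y : g (a *: y) = a *: g y by rewrite /g unrealifyZ fZ realifyZ.
have g0 : g 0 = 0 by have := gZ 0 0; rewrite !scale0r.
have gD y z : g (y + z) = g y + g z by rewrite /g unrealifyD fD realifyD.
rewrite mulmx_sum_row -/(g x) {2}(row_sum_delta x).
rewrite (big_morph g gD g0); apply: eq_bigr => i _.
by rewrite rowK gZ.
Qed.

Lemma real_mx_idem : (forall Q, f (f Q) = f Q) ->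
  real_mx f *m real_mx f = real_mx f.
Proof.
move=> ff; apply/row_matrixP => i.
by rewrite row_mul mul_real_mx rowK realifyK ff.
Qed.

Lemma real_mx_tr : \tr (real_mx f) =
  \sum_i \sum_j (re (f (delta_mx i j) i j) + im (f (sc_i K *: delta_mx i j) i j)).
Proof.
rewrite /mxtrace big_split_ord /=.
have E (h : 'I_(p * q) -> R) : \sum_l h l = \sum_i \sum_j h (mxvec_index i j).
  rewrite pair_bigA /= (reindex _ (curry_mxvec_bij p q)) /=.
  by apply: eq_bigr => -[i j] _.
rewrite !E -big_split; apply: eq_bigr => i _ /=.
rewrite -big_split; apply: eq_bigr => j _ /=; congr (_ + _).
  by rewrite mxE /realify row_mxEl mxvecE mxE unrealify_delta_l.
by rewrite mxE /realify row_mxEr mxvecE mxE unrealify_delta_r.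
Qed.

End RealLinear.
End Maps.

Section Fiber.
Variables (k m : nat).
Hypothesis k_gt0 : (0 < k)%N.

Let half : K := of_ (2^-1).

(* Pairs [(u, S)] of a row vector and a square matrix are stored as
   [col_mx u S]. For an orthogonal projection [P] of rank [k], [fiber_proj P]
   is a real-linear projection onto the pairs with [u] in the range of [P] and
   [S] self-adjoint, traceless and supported on the range of [P]. *)
Definition fiber_proj (P : 'M[K]_m) (Q : 'M[K]_(1 + m, m)) : 'M[K]_(1 + m, m) :=
  col_mx (usubmx Q *m P)
    (half *: (P *m (dsubmx Q + (dsubmx Q)^h) *m P)
     - of_ (re (\tr (P *m dsubmx Q)) / k%:R) *: P).

Definition in_fiber (P : 'M[K]_m) (u : 'rV[K]_m) (S : 'M[K]_m) :=
  [/\ u *m P = u, S^h = S, S *m P = S & \tr S = 0].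

Lemma fiber_projD P Q T : fiber_proj P (Q + T) = fiber_proj P Q + fiber_proj P T.
Proof.
rewrite /fiber_proj add_col_mx; congr col_mx; first by rewrite linearD mulmxDl.
have -> : dsubmx (Q + T) = dsubmx Q + dsubmx T by rewrite linearD.
move: (dsubmx Q) (dsubmx T) => a b.
rewrite adjointD addrACA (mulmxDr P (a + _)) mulmxDl scalerDr.
rewrite (mulmxDr P a b) mxtraceD sc_reD mulrDl rmorphD scalerDl opprD.
by rewrite addrACA.
Qed.

Lemma fiber_projZ P a Q : fiber_proj P (of_ a *: Q) = of_ a *: fiber_proj P Q.
Proof.
rewrite /fiber_proj scale_col_mx; congr col_mx.
  by rewrite linearZ -scalemxAl.
have -> : dsubmx (of_ a *: Q) = of_ a *: dsubmx Q by rewrite linearZ.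
rewrite adjointZ -scalerDr -!scalemxAr -scalemxAl mxtraceZ sc_reZ.
rewrite scalerBr !scalerA -mulrA rmorphM; congr (_ *: _ - _).
by rewrite mulrC.
Qed.

Variable P : 'M[K]_m.
Hypothesis hP : P^h = P.
Hypothesis PP : P *m P = P.
Hypothesis tP : \tr P = k%:R.

Lemma fiber_proj_in Q :
  in_fiber P (usubmx (fiber_proj P Q)) (dsubmx (fiber_proj P Q)).
Proof.
rewrite /fiber_proj col_mxKu col_mxKd; set S := dsubmx Q; split.
- by rewrite -mulmxA PP.
- rewrite adjointB !adjointZ !adjointM adjointD adjointK hP mulmxA.
  by rewrite [S^h + S]addrC.
- by rewrite mulmxBl -!scalemxAl -(mulmxA _ P P) PP.
(* Both terms have trace [re (\tr (P *m S))], the second because [\tr P = k]. *)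
rewrite linearB /= !mxtraceZ tP -mulmxA mxtrace_mulC -mulmxA PP.
rewrite mulmxDl mxtraceD [\tr (S *m P)]mxtrace_mulC.
have -> : \tr (S^h *m P) = sc_conj K (\tr (P *m S)).
  by rewrite -tr_adjoint adjointM hP.
rewrite sc_add_conj -(rmorph_nat of_) -!rmorphM -rmorphB.
rewrite divfK ?pnatr_eq0 -?lt0n//.
by rewrite -[X in _ * X]mulr_natl mulrA mulVf ?mul1r ?subrr ?rmorph0// pnatr_eq0.
Qed.

Lemma fiber_proj_id u S : in_fiber P u S ->
  fiber_proj P (col_mx u S) = col_mx u S.
Proof.
move=> [uP hS SP tS]; rewrite /fiber_proj col_mxKu col_mxKd uP hS.
have PS : P *m S = S by rewrite -[LHS]adjointK adjointM hS hP SP hS.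
rewrite PS tS sc_re0 mul0r rmorph0 scale0r subr0; congr col_mx.
rewrite mulmxDr PS mulmxDl SP -mulr2n -scaler_nat scalerA.
by rewrite -(rmorph_nat of_) -rmorphM mulVf ?pnatr_eq0// rmorph1 scale1r.
Qed.

Lemma fiber_proj_idem Q : fiber_proj P (fiber_proj P Q) = fiber_proj P Q.
Proof. by rewrite -{1}[fiber_proj P Q]vsubmxK fiber_proj_id ?vsubmxK//; exact: fiber_proj_in. Qed.

Definition fiber_mx := real_mx (fiber_proj P).

Lemma fiber_mx_idem : fiber_mx *m fiber_mx = fiber_mx.
Proof.
apply: real_mx_idem; [exact: fiber_projD|exact: fiber_projZ|].
exact: fiber_proj_idem.
Qed.

Lemma fiber_mx_in x : x *m fiber_mx = x ->
  in_fiber P (usubmx (unrealify x)) (dsubmx (unrealify x)).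
Proof.
rewrite (mul_real_mx (fiber_projD P) (@fiber_projZ P)) => xE.
rewrite -xE realifyK; exact: fiber_proj_in.
Qed.

Lemma fiber_mx_realify u S : in_fiber P u S ->
  realify (col_mx u S) *m fiber_mx = realify (col_mx u S).
Proof.
move=> uS; rewrite (mul_real_mx (fiber_projD P) (@fiber_projZ P)) realifyK.
by rewrite fiber_proj_id.
Qed.

(** In the real case [realify] is not onto, but the vectors fixed by [fiber_mx] lie in its range. *)
Lemma fiber_mx_unrealifyK x : x *m fiber_mx = x -> realify (unrealify x) = x.
Proof.
rewrite (mul_real_mx (fiber_projD P) (@fiber_projZ P)) => xE.
by rewrite -xE realifyK.
Qed.

Local Notation d := (im (sc_i K)).

Lemma sc_im_conj (x : K) : im (sc_conj K x) = - im x.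
Proof.
have := congr1 im (sc_add_conj x).
by rewrite sc_imD sc_im_of => /eqP; rewrite addrC addr_eq0 => /eqP.
Qed.

Lemma sc_conj_i : sc_conj K (sc_i K) = - sc_i K.
Proof.
have := sc_add_conj (sc_i K); rewrite -{3}[sc_i K]mulr1 sc_re_i sc_im1 oppr0.
by rewrite mul0rn rmorph0 => /eqP; rewrite addrC addr_eq0 => /eqP.
Qed.

(** In the complex case the factor [1 - d] is 0; in the real case conjugation is the identity. This
    lets one trace computation serve both fields. *)
Lemma sc_re_sqr (x : K) : (1 - d) * re (x * x) = (1 - d) * sqn x.
Proof.
have [->|[_ cj]] := sc_cases K; first by rewrite subrr !mul0r.
by rewrite -{2}[x]cj sc_mul_conj sc_re_of.
Qed.

Lemma mul_delta_mul a b i j : (P *m delta_mx a b *m P) i j = P i a * P b j.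
Proof.
rewrite -(mul_delta_mx (0 : 'I_1)) mulmxA -mulmxA -rowE -colE.
by rewrite mxE big_ord1 !mxE.
Qed.

Lemma tr_mul_delta a b : \tr (P *m delta_mx a b) = P b a.
Proof.
rewrite -(mul_delta_mx (0 : 'I_1)) mulmxA mxtrace_mulC mulmxA -rowE -colE.
by rewrite /mxtrace big_ord1 !mxE.
Qed.

(** The rank of an idempotent is its trace. The terms count the vectors [u], then the self-adjoint
    matrices of size [k] (real dimension [k (k + 1) / 2] for [d = 0] and [k ^ 2] for [d = 1]), less
    1 for the trace condition. *)
Lemma fiber_mx_tr : \tr fiber_mx =
  (1 + d) * k%:R + (1 + d) / 2 * k%:R ^+ 2 + (1 - d) / 2 * k%:R - 1.
Proof.
have kn0 : k%:R != 0 :> R by rewrite pnatr_eq0 -lt0n.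
have usub_delta j : usubmx (delta_mx (lshift m 0) j : 'M[K]_(1 + m, m)) =
    delta_mx 0 j.
  by apply/matrixP => a b; rewrite !mxE (inj_eq (@lshift_inj _ _)).
have dsub_delta a b : dsubmx (delta_mx (rshift 1 a) b : 'M[K]_(1 + m, m)) =
    delta_mx a b.
  by apply/matrixP => i j; rewrite !mxE (inj_eq (@rshift_inj _ _)).
have delta_adj a b : (delta_mx a b : 'M[K]_m)^h = delta_mx b a.
  by rewrite /adjoint map_delta_mx trmx_delta.
have Pc a b : P b a = sc_conj K (P a b) by rewrite -{1}hP !mxE.
have U1 j : fiber_proj P (delta_mx (lshift m 0) j) (lshift m 0) j = P j j.
  by rewrite /fiber_proj col_mxEu usub_delta -rowE mxE.
have U2 j : fiber_proj P (sc_i K *: delta_mx (lshift m 0) j) (lshift m 0) j =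
    sc_i K * P j j.
  rewrite /fiber_proj col_mxEu linearZ /= usub_delta -scalemxAl -rowE.
  by rewrite mxE [in LHS]mxE.
have S1 a b : fiber_proj P (delta_mx (rshift 1 a) b) (rshift 1 a) b =
    half * (P a a * P b b + P a b * P a b) - of_ (re (P b a) / k%:R) * P a b.
  rewrite /fiber_proj col_mxEd dsub_delta delta_adj mulmxDr mulmxDl.
  rewrite mxE [X in X + _]mxE [X in _ * X]mxE !mul_delta_mul.
  by rewrite mxE [X in - X]mxE tr_mul_delta.
have S2 a b : fiber_proj P (sc_i K *: delta_mx (rshift 1 a) b) (rshift 1 a) b =
    half * (sc_i K * (P a a * P b b) - sc_i K * (P a b * P a b))
    - of_ (re (sc_i K * P b a) / k%:R) * P a b.
  rewrite /fiber_proj col_mxEd linearZ /= dsub_delta.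
  have -> : (sc_i K *: delta_mx a b : 'M[K]_m)^h = - (sc_i K *: delta_mx b a).
    by apply/matrixP => i j; rewrite -(delta_adj a b) !mxE rmorphM /= sc_conj_i mulNr.
  have E (M1 M2 M3 : 'M[K]_m) c1 c2 c3 :
      (c1 *: (c2 *: M1 - c2 *: M2) - c3 *: M3) a b =
      c1 * (c2 * M1 a b - c2 * M2 a b) - c3 * M3 a b by rewrite !mxE.
  rewrite mulmxBr mulmxBl -!scalemxAr -!scalemxAl mxtraceZ tr_mul_delta.
  by rewrite E !mul_delta_mul.
rewrite /fiber_mx real_mx_tr big_split_ord /= big_ord1.
have -> : \sum_j (re (fiber_proj P (delta_mx (lshift m 0) j) (lshift m 0) j) +
    im (fiber_proj P (sc_i K *: delta_mx (lshift m 0) j) (lshift m 0) j)) =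
    (1 + d) * k%:R.
  under eq_bigr do rewrite U1 U2 sc_im_i -[X in X + _]mul1r -mulrDl.
  rewrite -mulr_sumr -sc_re_sum -/(\tr P) tP.
  by rewrite -(rmorph_nat of_) sc_re_of.
(* Summed over [a] and [b], the products of diagonal entries give the square of [\tr P], and
   [sqn (P a b)] gives [frob P = k]; the last term thus contributes the [- 1]. *)
have term a b : re (fiber_proj P (delta_mx (rshift 1 a) b) (rshift 1 a) b) +
    im (fiber_proj P (sc_i K *: delta_mx (rshift 1 a) b) (rshift 1 a) b) =
    (1 + d) / 2 * re (P a a * P b b) + (1 - d) / 2 * sqn (P a b)
      - k%:R^-1 * sqn (P a b).
  rewrite S1 S2 sc_reD sc_imD sc_reN sc_imN !sc_reZ !sc_imZ sc_reD sc_imD.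
  rewrite sc_imN !sc_im_i sc_re_i (Pc a b) sc_re_conj sc_im_conj.
  rewrite [(1 - d) / 2]mulrC -[2^-1 * _ * sqn _]mulrA -sc_re_sqr /sqn.
  by rewrite opprK; field.
under eq_bigr => a _ do (under eq_bigr => b _ do rewrite term;
  rewrite sumrB big_split -!mulr_sumr).
rewrite sumrB big_split -!mulr_sumr /= -/(frob P).
have -> : frob P = k%:R.
  by apply: (@sc_of_inj _ K); rewrite -frobE hP PP tP rmorph_nat.
have -> : \sum_a \sum_b re (P a a * P b b) = k%:R ^+ 2.
  under eq_bigr do rewrite -sc_re_sum.
  rewrite -sc_re_sum -big_distrlr /= -/(\tr P) tP.
  by rewrite -(rmorph_nat of_) -rmorphM sc_re_of.
by rewrite mulVf// addrA addrA.
Qed.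

Lemma fiber_mx_rank r :
  (r%:R : R) =
    (1 + d) * k%:R + (1 + d) / 2 * k%:R ^+ 2 + (1 - d) / 2 * k%:R - 1 ->
  \rank fiber_mx = r.
Proof.
rewrite -fiber_mx_tr (idempotent_trace fiber_mx_idem) => /eqP.
by rewrite eqr_nat => /eqP.
Qed.

End Fiber.

Lemma fiber_mx_continuous k m (X : topologicalType) (P : X -> 'M[K]_m) :
  continuous P -> continuous (fun x => fiber_mx k (P x)).
Proof.
move=> cP; apply: mx_continuous => i j; under eq_fun do rewrite mxE.
apply: entry_continuous; apply: realify_continuous.
set Q := unrealify _; rewrite /fiber_proj.
apply: mx_continuous => a b; case: (split_ordP a) => c ->.
  under eq_fun do rewrite col_mxEu; apply: entry_continuous.
  by apply: mxmul_continuous => //; exact: fct_cst_continuous.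
under eq_fun do rewrite col_mxEd; apply: entry_continuous.
apply: mxadd_continuous.
  apply: mxscale_continuous; first exact: fct_cst_continuous.
  apply: mxmul_continuous => //; apply: mxmul_continuous => //.
  exact: fct_cst_continuous.
apply: mxopp_continuous; apply: mxscale_continuous => //.
apply: of_continuous; apply: fct_mul_continuous; last exact: fct_cst_continuous.
apply: re_continuous; apply: mxtrace_continuous.
by apply: mxmul_continuous => //; exact: fct_cst_continuous.
Qed.

End Realification.

(** * Splitting an operator at its (k+1)-st eigenvalue *)

Section SpectralSplitting.
Variables (R : realType) (K : scalars R).

Local Notation of_ := (@sc_of R K).
Local Notation re := (@sc_re R K).

Lemma sorted_spectral n (A : 'M[K]_n) : A^h = A ->
  exists (U : 'M[K]_n) (l : 'rV[R]_n),
    [/\ U *m U^h = 1%:M, A = U^h *m diag_mx (map_mx of_ l) *m U &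
      forall i j : 'I_n, (i <= j)%N -> l 0 i <= l 0 j].
Proof.
move=> /spectral_herm[U [l [UU AE]]].
pose t := [tuple l 0 i | i < n]; pose s := sort <=%O t.
have /tuple_permP[p sE] : perm_eq s t by rewrite perm_sort.
have sp (i : 'I_n) : nth 0 s i = tnth t (p i).
  by rewrite sE -tnth_nth tnth_mktuple.
exists (row_perm p U), (col_perm p l); split.
- apply/row_matrixP => i; apply/rowP => j.
  have /matrixP/(_ (p i) (p j)) := UU; rewrite !mxE => UUij.
  rewrite (eq_bigr (fun a => U (p i) a * U^h a (p j))).
    by rewrite UUij (inj_eq perm_inj).
  by move=> a _; rewrite !mxE.
- rewrite AE; apply/matrixP => i j; rewrite !mul_mx_diag !mxE.
  rewrite (reindex_inj (@perm_inj _ p)) /=; apply: eq_bigr => a _.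
  by rewrite !mxE.
- move=> i j ij; rewrite !mxE.
  have := sort_le_sorted t; rewrite -/s => /(sorted_leq_nth le_trans le_refl 0).
  have st : size s = n by rewrite size_sort size_tuple.
  move=> /(_ i j); rewrite !inE st !ltn_ord => /(_ isT isT ij).
  by rewrite !sp !tnth_mktuple.
Qed.

Lemma char_poly_spectral n (U : 'M[K]_n) (l : 'rV[R]_n) : U *m U^h = 1%:M ->
  char_poly (U^h *m diag_mx (map_mx of_ l) *m U) =
  \prod_(a <- [seq of_ (l 0 i) | i <- enum 'I_n]) ('X - a%:P).
Proof.
move=> UU; set D := diag_mx _.
have -> : char_poly (U^h *m D *m U) = char_poly D.
  rewrite /char_poly /char_poly_mx !map_mxM /=.
  set W := map_mx polyC U^h; set V := map_mx polyC U.
  have WV : W *m V = 1%:M by rewrite -map_mxM (mulmx1C UU) map_mx1.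
  have VW : V *m W = 1%:M by exact: mulmx1C.
  have -> : 'X%:M - W *m map_mx polyC D *m V =
      W *m ('X%:M - map_mx polyC D) *m V.
    by rewrite mulmxBr mulmxBl scalar_mxC -(mulmxA _ W V) WV mulmx1.
  by rewrite !det_mulmx mulrAC -det_mulmx WV det1 mul1r.
rewrite char_poly_trig ?diag_mx_is_trig// big_map big_enum /=.
by apply: eq_bigr => i _; rewrite !mxE eqxx mulr1n.
Qed.

(** A sorted list of roots is determined by the polynomial, so the list selected by
    [ordered_eigenvalues] is the sorted diagonal. *)
Lemma lambda_spectral n (A U : 'M[K]_n) (l : 'rV[R]_n) (i : 'I_n) :
  U *m U^h = 1%:M -> A = U^h *m diag_mx (map_mx of_ l) *m U ->
  (forall i j : 'I_n, (i <= j)%N -> l 0 i <= l 0 j) ->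
  lambda i.+1 A = of_ (l 0 i).
Proof.
move=> UU AE ls; pose s := [seq of_ (l 0 i) | i <- enum 'I_n].
have ss : sorted <=%R s.
  rewrite sorted_map; apply/(sortedP i) => j; rewrite size_enum_ord => jn.
  rewrite /= sc_of_le; apply: ls; rewrite !nth_enum_ord//.
  exact: ltn_trans jn.
have sA : char_poly A = \prod_(a <- s) ('X - a%:P).
  by rewrite AE char_poly_spectral.
have -> : lambda i.+1 A = (ordered_eigenvalues A)`_i by [].
have -> : ordered_eigenvalues A = s.
  have [ss' sA'] := xgetPex [::] (ex_intro (fun t => sorted <=%R t /\
      char_poly A = \prod_(a <- t) ('X - a%:P)) s (conj ss sA)).
  by apply: le_sorted_eq => //; apply: prod_XsubC_eq; rewrite -sA' sA.
by rewrite (nth_map i) ?size_enum_ord// nth_ord_enum.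
Qed.

Section SplitPairs.
Variables (n k : nat).
Hypothesis kn : (k < n)%N.

(* [A - B] for such a pair is an operator whose [k.+1]-st eigenvalue is 0,
   split into its positive and negative parts. *)
Definition split_pair (B A : 'M[K]_n) :=
  [/\ psd B, psd A, B *m A = 0, (\rank B <= k)%N & (\rank A <= n - k.+1)%N].

Lemma split_pair0 : split_pair 0 0.
Proof. by split; rewrite ?mulmx0 ?mxrank0//; exact: psd0. Qed.

Lemma split_pairZ a B A : 0 <= a -> split_pair B A ->
  split_pair (of_ a *: B) (of_ a *: A).
Proof.
move=> a0 [pB pA BA rB rA]; split; try exact: psdZ.
- by rewrite -scalemxAl -scalemxAr BA !scaler0.
- exact: leq_trans (mxrankS (scalemx_sub _ (submx_refl B))) rB.
- exact: leq_trans (mxrankS (scalemx_sub _ (submx_refl A))) rA.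
Qed.

(** The kernels of [A] and [B'] have dimensions at least [k.+1] and [n - k], so they share a nonzero
    [v]. At [v] the equation says that minus the form of [B] is the form of [A'] plus [b] times the
    squared norm, which forbids [b > 0]. *)
Lemma split_pair_ge0 B A B' A' b : split_pair B A -> split_pair B' A' ->
  A - B = A' - B' + (of_ b)%:M -> b <= 0.
Proof.
move=> [pB pA _ _ rA] [pB' pA' _ rB' _] E; rewrite leNgt; apply/negP => b0.
have : (kermx A :&: kermx B')%MS != 0.
  rewrite -mxrank_eq0; apply/eqP => r0.
  have := mxrank_sum_cap (kermx A) (kermx B'); rewrite r0 !mxrank_ker addn0.
  have := rank_leq_col (kermx A + kermx B')%MS; lia.
move=> /rowV0Pn[v]; rewrite sub_capmx => /andP[/sub_kermxP vA /sub_kermxP vB'] v0.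
have := congr1 (fun X => qform X v) E; rewrite !qformD.
have -> : qform A v = 0 by rewrite /qform vA mul0mx mxE.
have -> : qform (- B') v = 0 by rewrite /qform mulmxN vB' oppr0 mul0mx mxE.
have -> : qform (- B) v = - qform B v by rewrite /qform mulmxN mulNmx mxE.
have -> : qform (of_ b)%:M v = of_ b * qform 1%:M v.
  by rewrite -qformZ scalemx1.
rewrite add0r addr0 qform1 -rmorphM => h.
have [_ /(_ v)] := pA'; have [_ /(_ v)] := pB.
rewrite !sc_ge0 => /andP[/eqP qB qB0] /andP[/eqP qA' qA'0].
move: h; rewrite qB qA' -rmorphN -rmorphD => /(@sc_of_inj _ K).
have := mulr_gt0 b0 (frob_gt0 v0); lra.
Qed.

(** By symmetry [b = 0], so [A - A' = B - B']. The trace of their product is a squared norm, but by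
    the two orthogonality relations it is also minus the sum of the traces of [A B'] and [A' B],
    hence nonpositive. *)
Lemma split_pair_unique B A B' A' b : split_pair B A -> split_pair B' A' ->
  A - B = A' - B' + (of_ b)%:M -> [/\ b = 0, B = B' & A = A'].
Proof.
move=> s s' E; have b1 := split_pair_ge0 s s' E.
have b2 : - b <= 0.
  apply: split_pair_ge0 s' s _; rewrite E rmorphN raddfN /=.
  by rewrite addrK.
have b0 : b = 0 by lra.
have {}E : A - A' = B - B'.
  move: E; rewrite b0 rmorph0 raddf0 addr0 => E.
  have -> : A = A' - B' + B by rewrite -E subrK.
  by rewrite addrAC [A' - B' - A']addrAC subrr add0r addrC.
have [pB pA BA _ _] := s; have [pB' pA' BA' _ _] := s'.
have hD : (B - B')^h = B - B' by rewrite adjointB (psd_herm pB) (psd_herm pB').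
have : re (\tr ((A - A') *m (B - B'))) <= 0.
  have AB : A *m B = 0.
    by rewrite -[LHS]adjointK adjointM (psd_herm pA) (psd_herm pB) BA adjoint0.
  have AB' : A' *m B' = 0.
    by rewrite -[LHS]adjointK adjointM (psd_herm pA') (psd_herm pB') BA' adjoint0.
  rewrite mulmxBl !mulmxBr AB AB' sub0r subr0 -opprD linearN /= sc_reN oppr_le0.
  rewrite mxtraceD sc_reD.
  have := psd_trM_ge0 pA pB'; have := psd_trM_ge0 pA' pB.
  rewrite !sc_ge0 => /andP[_ h1] /andP[_ h2]; lra.
rewrite {1}E -{2}hD frobE sc_re_of => f0.
have /frob_eq0 D0 : frob (B - B') = 0.
  by apply/eqP; rewrite eq_le f0 frob_ge0.
split => //; first by apply/eqP; rewrite -subr_eq0 D0.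
by apply/eqP; rewrite -subr_eq0 E D0.
Qed.

Let k1 : 'I_n := Ordinal kn.
Let i0 : 'I_n := Ordinal (leq_ltn_trans (leq0n k) kn).

(** The positive and negative parts of [A] minus its [k.+1]-st eigenvalue [lk], which has index [k]
    on the sorted diagonal counted from 0. The negative part vanishes exactly when no eigenvalue is
    below [lk]. *)
Lemma split_pair_spectral A : A^h = A -> exists B A' l,
  [/\ split_pair B A', A = A' - B + (of_ l)%:M &
      B = 0 <-> lambda 1 A = lambda k.+1 A].
Proof.
move=> /sorted_spectral[U [l [UU AE ls]]].
pose lk := l 0 k1.
pose b : 'rV[R]_n := \row_i Num.max 0 (lk - l 0 i).
pose a : 'rV[R]_n := \row_i Num.max 0 (l 0 i - lk).
pose D (x : 'rV[R]_n) := U^h *m diag_mx (map_mx of_ x) *m U.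
have pD (x : 'rV[R]_n) : (forall i, 0 <= x 0 i) -> psd (D x).
  by move=> x0; apply: psd_conj; exact: psd_diag.
have b0 i : 0 <= b 0 i by rewrite mxE le_max lexx.
have a0 i : 0 <= a 0 i by rewrite mxE le_max lexx.
exists (D b), (D a), lk; split.
- split; [exact: pD|exact: pD| | |].
  + rewrite /D !mulmxA -[_ *m U *m U^h]mulmxA UU mulmx1.
    rewrite -[_ *m diag_mx _ *m diag_mx _]mulmxA mulmx_diag.
    rewrite (_ : diag_mx _ = 0) ?mulmx0 ?mul0mx//.
    apply/matrixP => i j; rewrite !mxE -rmorphM.
    rewrite (_ : _ * _ = 0) ?rmorph0 ?mul0rn//.
    case: (lerP (l 0 i) lk) => h.
      by rewrite [X in _ * X]max_l ?mulr0// subr_le0.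
    by rewrite [X in X * _]max_l ?mul0r// subr_le0 ltW.
  (* Sortedness makes the entries of [b] vanish from index [k] on. *)
  + have -> : D b = U^h *m pid_mx k *m (diag_mx (map_mx of_ b) *m U).
      rewrite /D !mulmxA; congr (_ *m U); rewrite -mulmxA; congr (_ *m _).
      apply/matrixP => i j; rewrite mul_mx_diag !mxE.
      rewrite -[(i == j :> nat)]/(i == j); case: eqP => [<-|_]; last first.
        by rewrite mul0r.
      case: (ltnP i k) => ik; first by rewrite mul1r.
      by rewrite mul0r max_l ?rmorph0// subr_le0; exact: ls.
    apply: leq_trans (mxrankM_maxl _ _) _; apply: leq_trans (mxrankM_maxr _ _) _.
    by rewrite rank_pid_mx// ltnW.
  (* The entries of [a] vanish up to and including index [k], which leaves [n - k.+1] of them. *)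
  + have -> : D a = U^h *m copid_mx k.+1 *m (diag_mx (map_mx of_ a) *m U).
      rewrite /D !mulmxA; congr (_ *m U); rewrite -mulmxA; congr (_ *m _).
      apply/matrixP => i j; rewrite mul_mx_diag !mxE.
      rewrite -[(i == j :> nat)]/(i == j); case: eqP => [<-|_]; last first.
        by rewrite subr0 mul0r.
      case: (ltnP i k.+1) => ik; last by rewrite subr0 mul1r.
      by rewrite subrr mul0r max_l ?rmorph0// subr_le0; exact: ls.
    apply: leq_trans (mxrankM_maxl _ _) _; apply: leq_trans (mxrankM_maxr _ _) _.
    by rewrite rank_copid_mx.
- rewrite AE -(unitary_scalar (of_ lk) UU) -mulmxBl -mulmxBr -mulmxDl.
  rewrite -mulmxDr; congr (_ *m _ *m _).
  apply/matrixP => i j; rewrite !mxE -mulrnBl -rmorphB -mulrnDl -rmorphD.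
  congr (of_ _ *+ _); rewrite /Num.max; case: ifPn; case: ifPn; lra.
rewrite (lambda_spectral i0 UU AE ls) (lambda_spectral k1 UU AE ls).
split.
  move=> /(congr1 (fun X => U *m X *m U^h)).
  rewrite /D mulmx0 mul0mx !mulmxA UU mul1mx -mulmxA UU mulmx1.
  move=> /matrixP/(_ i0 i0); rewrite !mxE eqxx mulr1n => /eqP.
  rewrite sc_of_eq0 => /eqP h; congr (of_ _).
  have := ls i0 k1 isT; rewrite -/lk => h'; apply/eqP; rewrite eq_le h' /=.
  by rewrite -subr_le0 -h le_max lexx orbT.
move=> /(@sc_of_inj _ K) l0; rewrite /D (_ : diag_mx _ = 0) ?mulmx0 ?mul0mx//.
apply/matrixP => i j; rewrite !mxE max_l ?rmorph0 ?mul0rn//.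
by rewrite subr_le0 /lk -l0; exact: ls.
Qed.

End SplitPairs.

End SpectralSplitting.

(** * The operator sphere as the base of a cone of split pairs *)

Section OperatorSphere.
Variables (R : realType) (K : scalars R) (n k : nat).
Hypothesis kn : (k < n)%N.

Local Notation of_ := (@sc_of R K).
Local Notation re := (@sc_re R K).
Local Notation cj := (@sc_conj R K).
Local Notation NS := (@nonscalar_selfadjoint K cj n).
Local Notation SS := (operator_sphere cj n).

Let n_gt0 : (0 < n)%N. Proof. exact: leq_ltn_trans kn. Qed.

Lemma hermitianP (A : 'M[K]_n) :
  (A \is hermitianmx n false cj) = (A^h == A).
Proof.
by rewrite is_hermitianmxE expr0 scale1r eq_sym /adjoint map_trmx.
Qed.

Lemma NS_herm (A : set_type NS) : (set_val A)^h = set_val A.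
Proof. by have [hA _] := set_val_in A; apply/eqP; rewrite -hermitianP. Qed.

Lemma sphere_eqP (A B : set_type NS) : \pi_SS A = \pi_SS B <->
  exists a b : R, 0 < a /\ set_val B = of_ a *: set_val A + (of_ b)%:M.
Proof.
split.
  move=> /(@eqmodP _ (@affine_equiv K cj n)) /asboolP[a [b [a0 br BE]]].
  have aE := sc_ge0_of (ltW a0); exists (re a), (re b).
  by rewrite -(@sc_of_gt0 _ K) -aE -sc_real_of.
move=> [a [b [a0 BE]]]; apply/(@eqmodP _ (@affine_equiv K cj n)).
by apply/asboolP; exists (of_ a), (of_ b); rewrite sc_of_gt0 sc_of_real.
Qed.

Definition traceless (A : 'M[K]_n) : 'M[K]_n := A - (\tr A / n%:R)%:M.

Lemma traceless_affine a b (A : 'M[K]_n) :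
  traceless (of_ a *: A + (of_ b)%:M) = of_ a *: traceless A.
Proof.
rewrite /traceless mxtraceD mxtraceZ mxtrace_scalar scalerBr scale_scalar_mx.
rewrite -[of_ b *+ n]mulr_natr mulrDl mulfK ?pnatr_eq0 -?lt0n//.
by rewrite raddfD /= opprD addrACA subrr addr0 mulrA.
Qed.

Lemma traceless_neq0 (A : set_type NS) : 0 < frob (traceless (set_val A)).
Proof.
apply: frob_gt0; have [_] := set_val_in A; apply: contra => /eqP.
by move=> /eqP; rewrite subr_eq0 => /eqP ->; exact: scalar_mx_is_scalar.
Qed.

(** The representative of trace 0 and Frobenius norm 1. *)
Definition sphere_repr (A : 'M[K]_n) : 'M[K]_n :=
  of_ (Num.sqrt (frob (traceless A)))^-1 *: traceless A.

Lemma frobZ a m p (A : 'M[K]_(m, p)) : frob (of_ a *: A) = a ^+ 2 * frob A.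
Proof.
apply: (@sc_of_inj _ K).
rewrite -frobE adjointZ -scalemxAl -scalemxAr scalerA mxtraceZ frobE.
by rewrite expr2 !rmorphM.
Qed.

Lemma sphere_repr_affine a b (A : 'M[K]_n) : 0 < a ->
  sphere_repr (of_ a *: A + (of_ b)%:M) = sphere_repr A.
Proof.
move=> a0; rewrite /sphere_repr traceless_affine frobZ scalerA -rmorphM.
rewrite sqrtrM ?sqr_ge0// sqrtr_sqr gtr0_norm// invfM mulrAC mulVf ?gt_eqF//.
by rewrite mul1r.
Qed.

(** The normalized representative is a continuous invariant that separates the classes. *)
Lemma sphere_hausdorff : hausdorff_space SS.
Proof.
pose f (y : SS) := sphere_repr (set_val (repr y)).
have fpi A : f (\pi_SS A) = sphere_repr (set_val A).
  have /sphere_eqP[a [b [a0 AE]]] : \pi_SS (repr (\pi_SS A)) = \pi_SS A.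
    by rewrite reprK.
  by rewrite AE sphere_repr_affine.
apply: (@injective_hausdorff _ _ f); last exact: norm_hausdorff.
  apply/quotient_continuous; rewrite (_ : _ \o _ =
    fun A : set_type NS => sphere_repr (set_val A)); last first.
    by apply/funext => A /=; rewrite fpi.
  have cA := @set_val_continuous _ NS.
  have cT : continuous (fun A : set_type NS => traceless (set_val A)).
    apply: mxadd_continuous => //; apply: mxopp_continuous.
    apply: scalar_mx_continuous; apply: fct_mul_continuous.
      exact: mxtrace_continuous.
    exact: fct_cst_continuous.
  apply: mxscale_continuous => //; apply: of_continuous.
  apply: fct_inv_continuous => [A|].
    by rewrite gt_eqF// sqrtr_gt0 traceless_neq0.
  apply: (comp_continuous (frob_continuous cT)); exact: sqrt_continuous.
move=> y z; rewrite -{2}[y]reprK -{2}[z]reprK /f => yz; apply/sphere_eqP.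
move: (repr y) (repr z) yz => A B; rewrite /sphere_repr.
set a := Num.sqrt _; set b := Num.sqrt _ => AB.
have a0 : 0 < a by rewrite sqrtr_gt0 traceless_neq0.
have b0 : 0 < b by rewrite sqrtr_gt0 traceless_neq0.
have BA : traceless (set_val B) = of_ (b / a) *: traceless (set_val A).
  rewrite rmorphM -scalerA AB scalerA -rmorphM mulfV ?gt_eqF// rmorph1.
  by rewrite scale1r.
(* The shift that makes the traces agree. *)
exists (b / a), (re (\tr (set_val B)) / n%:R
  - b / a * (re (\tr (set_val A)) / n%:R)).
split; first by rewrite divr_gt0.
have tE (C : set_type NS) : of_ (re (\tr (set_val C)) / n%:R) =
    \tr (set_val C) / n%:R.
  rewrite rmorphM -herm_trace_real ?NS_herm// sc_ofV.
  by rewrite (rmorph_nat of_).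
rewrite rmorphB [of_ (b / a * _)]rmorphM !tE raddfB /=.
have := BA; rewrite /traceless scalerBr scale_scalar_mx => E.
by rewrite -[LHS](subrK (\tr (set_val B) / n%:R)%:M) E addrA addrAC.
Qed.

Definition cone : set ('M[K]_n * 'M[K]_n) :=
  [set c | split_pair k c.1 c.2 /\ 0 < re (\tr (c.1 + c.2))].

(** A compact base of [cone]: it meets every ray exactly once, and [sphere_of] identifies it with
    the operator sphere. *)
Definition cone_slice : set ('M[K]_n * 'M[K]_n) :=
  [set c | split_pair k c.1 c.2 /\ re (\tr (c.1 + c.2)) = 1].

(** If the difference were scalar, uniqueness of the splitting would equate the pair with [(0, 0)],
    against the positive trace. *)
Lemma cone_nonscalar (c : set_type cone) :
  ((set_val c).2 - (set_val c).1) \in NS.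
Proof.
have [s t0] := set_val_in c; move: s t0; case: (set_val c) => B A /= s t0.
have [pB pA _ _ _] := s.
have hAB : (A - B)^h = A - B by rewrite adjointB (psd_herm pB) (psd_herm pA).
rewrite inE; split; first by rewrite hermitianP hAB.
apply/negP => /is_scalar_mxP[x AB].
have xE : x = of_ (re x).
  apply: sc_conj_fixed; have := hAB; rewrite AB => /matrixP.
  move=> /(_ (Ordinal n_gt0) (Ordinal n_gt0)).
  by rewrite !mxE eqxx !mulr1n.
have E : A - B = 0 - 0 + (of_ (re x))%:M by rewrite AB -xE subr0 add0r.
have [_ B0 A0] := split_pair_unique kn s (split_pair0 K n k) E.
by move: t0; rewrite A0 B0 addr0 linear0 sc_re0 ltxx.
Qed.

Definition cone_op (c : set_type cone) : set_type NS :=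
  exist _ ((set_val c).2 - (set_val c).1) (cone_nonscalar c).

Lemma cone_opE c : set_val (cone_op c) = (set_val c).2 - (set_val c).1.
Proof. by []. Qed.

Definition sphere_of (c : set_type cone) : SS := \pi_SS (cone_op c).

Lemma sphere_of_continuous (X : topologicalType) (f : X -> set_type cone) :
  continuous (fun x => set_val (f x)) -> continuous (fun x => sphere_of (f x)).
Proof.
move=> cf; apply: (@comp_continuous _ _ _ (fun x => cone_op (f x)) (fun A => \pi_SS A)).
  apply: set_type_continuous; apply: mxadd_continuous.
    exact: (comp_continuous cf (@snd_continuous _ _)).
  apply: mxopp_continuous; exact: (comp_continuous cf (@fst_continuous _ _)).
exact: (@pi_continuous _ {eq_quot (@affine_equiv K cj n)}).
Qed.

Lemma sphere_of_eqP (c d : set_type cone) : sphere_of c = sphere_of d <->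
  exists2 a : R, 0 < a &
    (set_val d).1 = of_ a *: (set_val c).1 /\
    (set_val d).2 = of_ a *: (set_val c).2.
Proof.
split.
  move=> /sphere_eqP[a [b [a0]]]; rewrite !cone_opE => E; exists a => //.
  have [sc _] := set_val_in c; have [sd _] := set_val_in d.
  have E' : (set_val d).2 - (set_val d).1 =
      of_ a *: (set_val c).2 - of_ a *: (set_val c).1 + (of_ b)%:M.
    by rewrite -scalerBr -E.
  by have [_ -> ->] := split_pair_unique kn sd (split_pairZ (ltW a0) sc) E'.
move=> [a a0 [E1 E2]]; apply/sphere_eqP; exists a, 0; split => //.
by rewrite !cone_opE E1 E2 scalerBr rmorph0 raddf0 addr0.
Qed.

(** The chosen representative of the class has its own spectral splitting; uniqueness identifies its
    negative part with a positive multiple of the first component of [c]. *)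
Lemma sphere_of_M (c : set_type cone) :
  (@M_space K cj n k) (sphere_of c) <-> (set_val c).1 <> 0.
Proof.
have [sc _] := set_val_in c.
rewrite /M_space /=; set A := set_val (repr (sphere_of c)).
have /sphere_eqP[a [b [a0]]] : \pi_SS (cone_op c) =
    \pi_SS (repr (sphere_of c)) by rewrite reprK.
rewrite -/A cone_opE => AE.
have hA : A^h = A by exact: NS_herm.
have [B' [A' [l [s' AE' BE']]]] := split_pair_spectral kn hA.
have E : of_ a *: (set_val c).2 - of_ a *: (set_val c).1 =
    A' - B' + (of_ (l - b))%:M.
  have -> : (of_ (l - b))%:M = (of_ l)%:M - (of_ b)%:M :> 'M[K]_n.
    by rewrite rmorphB raddfB.
  rewrite -scalerBr addrA -AE'.
  by apply/eqP; rewrite eq_sym subr_eq; apply/eqP.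
have [_ EB _] := split_pair_unique kn (split_pairZ (ltW a0) sc) s' E.
split.
  move=> /eqP l1 c0; apply: l1; apply/BE'.
  by rewrite -EB c0 scaler0.
move=> c0; apply/eqP => /BE'; rewrite -EB => /eqP; rewrite scaler_eq0.
by rewrite sc_of_eq0 gt_eqF//= => /eqP.
Qed.

Lemma cone_slice_sub c : cone_slice c -> cone c.
Proof. by move=> [s t]; split => //; rewrite t ltr01. Qed.

Lemma sphere_of_surj y : exists c : set_type cone,
  cone_slice (set_val c) /\ sphere_of c = y.
Proof.
have hA := NS_herm (repr y).
have [B [A [l [s AE _]]]] := split_pair_spectral kn hA.
have [pB pA _ _ _] := s.
have t0 : 0 < re (\tr (B + A)).
  rewrite lt_def psd_tr_ge0 ?andbT; last exact: psdD.
  apply/eqP => t0; have := psd_tr_ge0 pA; have := psd_tr_ge0 pB.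
  move: t0; rewrite mxtraceD sc_reD => t0 h1 h2.
  have B0 : B = 0 by apply: psd_tr_eq0 => //; lra.
  have A0 : A = 0 by apply: psd_tr_eq0 => //; lra.
  have [_ /negP] := set_val_in (repr y); apply.
  by rewrite AE A0 B0 subr0 add0r scalar_mx_is_scalar.
set t := re _ in t0.
have sl : cone_slice (of_ t^-1 *: B, of_ t^-1 *: A).
  split => /=; first by apply: split_pairZ => //; rewrite invr_ge0 ltW.
  by rewrite -scalerDr mxtraceZ sc_reZ mulVf// gt_eqF.
exists (exist _ (of_ t^-1 *: B, of_ t^-1 *: A) (mem_set (cone_slice_sub sl))).
split => //.
rewrite -[y]reprK; apply/sphere_eqP; exists t, l; split => //.
rewrite cone_opE /= AE scalerBr !scalerA -rmorphM mulfV ?gt_eqF// rmorph1.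
by rewrite !scale1r.
Qed.

Lemma cone_slice_compact : compact cone_slice.
Proof.
pose bounded := [set B : 'M[K]_n | psd B /\ re (\tr B) <= 1].
have cf := @fst_continuous 'M[K]_n 'M[K]_n.
have cs := @snd_continuous 'M[K]_n 'M[K]_n.
have ci : continuous (fun B : 'M[K]_n => B) by move=> x; exact: cvg_id.
have cb : compact bounded.
  (* Since [\tr (Y^h *m Y)] is [frob Y], the Gram map carries a Frobenius ball onto this set, so no
     entry of a positive semidefinite matrix has to be bounded by its trace. *)
  have -> : bounded =
      (fun Y : 'M[K]_n => Y^h *m Y) @` [set Y : 'M[K]_n | frob Y <= 1].
    apply/seteqP; split => [B [/psd_factor[Y ->]]|_ [Y Y1 <-]] /=.
      by rewrite mxtrace_mulC frobE sc_re_of => Y1; exists Y.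
    split; first exact: gram_psd.
    by rewrite mxtrace_mulC frobE sc_re_of.
  apply: continuous_compact.
    apply: continuous_subspaceT; apply: mxmul_continuous => //.
    exact: adjoint_continuous.
  apply: (@compact_frob _ _ _ _ _ 1) => //; apply: closed_fct_le.
    exact: frob_continuous.
  exact: fct_cst_continuous.
have : compact (bounded `*` bounded) by exact: compact_setX.
move=> /subclosed_compact; apply; last first.
  move=> [B A] [[/= pB pA _ _ _]]; rewrite mxtraceD sc_reD => t.
  have := psd_tr_ge0 pA; have := psd_tr_ge0 pB => h1 h2.
  by split; split => //=; lra.
rewrite (_ : cone_slice = [set c | psd c.1] `&` ([set c | psd c.2] `&`
  ([set c | c.1 *m c.2 = 0] `&` ([set c | (\rank c.1 <= k)%N] `&`
  ([set c | (\rank c.2 <= n - k.+1)%N] `&` [set c | re (\tr (c.1 + c.2)) = 1]))))).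
  apply: closedI; first exact: closed_psd.
  apply: closedI; first exact: closed_psd.
  apply: closedI.
    apply: closed_fct_eq; first exact: norm_hausdorff.
    exact: mxmul_continuous.
  apply: closedI; first exact: closed_rank.
  apply: closedI; first exact: closed_rank.
  apply: closed_fct_eq; first exact: norm_hausdorff.
  apply: re_continuous; apply: mxtrace_continuous; exact: mxadd_continuous.
by apply/seteqP; split => -[B A] /= [[]] //; intuition.
Qed.

Definition sphere_split (y : SS) : set_type cone := projT1 (cid (sphere_of_surj y)).

Lemma sphere_split_slice y : cone_slice (set_val (sphere_split y)).
Proof. by rewrite /sphere_split; case: cid => c []. Qed.

Lemma sphere_splitK y : sphere_of (sphere_split y) = y.
Proof. by rewrite /sphere_split; case: cid => c []. Qed.

(** The splitting inverts a continuous bijection from the compact slice to the Hausdorff sphere. *)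
Lemma sphere_split_continuous : continuous (fun y => set_val (sphere_split y)).
Proof.
have h (c : set_type cone_slice) := cone_slice_sub (set_val_in c).
pose p (c : set_type cone_slice) : SS :=
  sphere_of (exist _ (set_val c) (mem_set (h c))).
have pK c : set_val (sphere_split (p c)) = set_val c.
  have /sphere_of_eqP[a a0 /= [E1 E2]] := sphere_splitK (p c).
  have [_] := sphere_split_slice (p c); have [_] := set_val_in c.
  rewrite E1 E2 -scalerDr mxtraceZ sc_reZ => + t1; rewrite t1 mulr1 => a1.
  by apply/esym; rewrite [LHS]surjective_pairing E1 E2 a1 rmorph1 !scale1r -surjective_pairing.
have : {within range p, continuous (fun y => set_val (sphere_split y))}.
  apply: compact_factor_continuous.
  - exact: compact_set_type cone_slice_compact.
  - exact: sphere_hausdorff.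
  - by apply: sphere_of_continuous; exact: set_val_continuous.
  - rewrite (_ : _ \o _ = set_val); first exact: set_val_continuous.
    by apply/funext => c /=; rewrite pK.
suff -> : range p = setT by move=> ?; exact/continuous_subspace_setT.
apply/seteqP; split => // y _; have [c [sc <-]] := sphere_of_surj y.
exists (exist _ (set_val c) (mem_set sc)) => //; apply/sphere_of_eqP; exists 1 => //=.
by rewrite rmorph1 !scale1r.
Qed.

End OperatorSphere.

(** * Disc bundle coordinates on matrices of rank k *)

Section GramLift.
Variables (R : realType) (K : scalars R) (m k : nat).
Hypothesis k_gt0 : (0 < k)%N.

Local Notation of_ := (@sc_of R K).
Local Notation re := (@sc_re R K).

Definition corner : 'M[K]_(1 + m) := block_mx 1%:M 0 0 0.

Lemma cornerE : corner = (row_mx 1%:M 0 : 'M[K]_(1, 1 + m))^h *m row_mx 1%:M 0.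
Proof.
rewrite adjoint_row_mx adjoint0 adjoint1 mul_col_row.
by rewrite !mulmx0 !mul0mx mulmx1.
Qed.

Lemma corner_psd : psd corner. Proof. by rewrite cornerE; exact: gram_psd. Qed.

Lemma corner_tr : \tr corner = 1.
Proof. by rewrite /corner mxtrace_block linear0 addr0 mxtrace1. Qed.

Lemma drsub_corner : drsubmx corner = 0.
Proof. exact: block_mxKdr. Qed.

Lemma drsub_rank (B : 'M[K]_(1 + m)) : (\rank (drsubmx B) <= \rank B)%N.
Proof.
have -> : drsubmx B = row_mx 0 1%:M *m B *m col_mx 0 1%:M.
  rewrite -[in RHS](submxK B) mul_row_block mul_row_col.
  by rewrite !mul0mx !mul1mx mulmx0 mulmx1 !add0r.
by apply: leq_trans (mxrankM_maxl _ _) _; exact: mxrankM_maxr.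
Qed.

(** Write [B] as the Gram matrix of [row_mx y Z]. The rows of [B] and of the corner lie in the span
    of the first basis vector and the rows of [row_mx 0 Z], and [Z] has the rank of the lower right
    block. *)
Lemma add_corner_rank (B : 'M[K]_(1 + m)) (a c : K) :
  psd B -> (\rank (drsubmx B) < k)%N -> (\rank (a *: B + c *: corner)%R <= k)%N.
Proof.
move=> /psd_factor[Y BE]; rewrite -[Y]hsubmxK in BE.
set y := lsubmx Y in BE; set Z := rsubmx Y in BE.
have dB : drsubmx B = Z^h *m Z.
  by rewrite BE adjoint_row_mx mul_col_row block_mxKdr.
rewrite dB mxrank_gram => rZ.
have rY : (row_mx y Z <= col_mx (row_mx 1%:M 0) (row_mx 0 Z))%MS.
  have -> : row_mx y Z = y *m row_mx 1%:M 0 + row_mx 0 Z.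
    by rewrite mul_mx_row mulmx1 mulmx0 add_row_mx addr0 add0r.
  by rewrite -addsmxE addmx_sub_adds// submxMl.
have : ((a *: B + c *: corner)%R <= col_mx (row_mx 1%:M 0) (row_mx 0 Z))%MS.
  apply: addmx_sub; apply: scalemx_sub.
    by rewrite BE; apply: submx_trans rY; exact: submxMl.
  by rewrite cornerE -addsmxE (submx_trans (submxMl _ _))// addsmxSl.
move=> /mxrankS /leq_trans; apply; rewrite -addsmxE.
apply: leq_trans (mxrank_adds_leqif _ _) _.
apply: leq_trans (_ : _ <= 1 + \rank Z)%N _; last by [].
apply: leq_add; first exact: rank_leq_row.
have -> : row_mx (0 : 'M[K]_(1 + m, 1)) Z = Z *m row_mx (0 : 'M[K]_(m, 1)) 1%:M.
  by rewrite mul_mx_row mulmx0 mulmx1.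
exact: mxrankM_maxl.
Qed.

Definition gram_lift (P : 'M[K]_m) (t : R) (u : 'rV[K]_m) (S : 'M[K]_m) :
    'M[K]_(1 + m) :=
  let Z := row_mx u^h (lift_psd P t S) in Z^h *m Z.

Lemma gram_lift_psd P t u S : psd (gram_lift P t u S).
Proof. exact: gram_psd. Qed.

Lemma gram_lift_tr P t u S :
  re (\tr (gram_lift P t u S)) = frob u + frob (lift_psd P t S).
Proof.
rewrite /gram_lift mxtrace_mulC frobE sc_re_of.
apply: (@sc_of_inj _ K); rewrite rmorphD -(frob_adjoint u) -!frobE.
by rewrite adjoint_row_mx mul_row_col mxtraceD.
Qed.

Lemma gram_lift_drsub P t u S : drsubmx (gram_lift P t u S) =
  (lift_psd P t S)^h *m lift_psd P t S.
Proof. by rewrite /gram_lift adjoint_row_mx mul_col_row block_mxKdr. Qed.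

Lemma gram_lift_dlsub P t u S : dlsubmx (gram_lift P t u S) =
  (lift_psd P t S)^h *m u^h.
Proof. by rewrite /gram_lift adjoint_row_mx mul_col_row block_mxKdl. Qed.

Section Frame.
Variable V : 'M[K]_(k, m).
Hypothesis VV : V *m V^h = 1%:M.
Let P := V^h *m V.

Lemma frame_gt0 : (0 < m)%N.
Proof.
apply: leq_trans k_gt0 _; rewrite -(frame_proj_rank VV).
exact: rank_leq_row.
Qed.

Section Fibre.
Variables (u : 'rV[K]_m) (S : 'M[K]_m).
Hypothesis uS : in_fiber P u S.

Lemma gram_lift_rank t : (\rank (gram_lift P t u S) <= k)%N.
Proof.
have [uP hS SP tS] := uS.
have PS : P *m S = S.
  by rewrite -[LHS]adjointK adjointM hS frame_proj_herm SP hS.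
rewrite /gram_lift mxrank_gram.
have -> : row_mx u^h (lift_psd P t S) = P *m row_mx u^h (lift_psd P t S).
  rewrite mul_mx_row; congr row_mx.
    by rewrite -{1}uP adjointM frame_proj_herm.
  by rewrite mulmxDr -scalemxAr (frame_proj_idem VV) PS.
by apply: leq_trans (mxrankM_maxl _ _) _; rewrite frame_proj_rank.
Qed.

Lemma gram_lift_drsub_rank t : 0 < t ->
  \rank (drsubmx (gram_lift P t u S)) = k.
Proof.
have [uP hS SP tS] := uS.
by move=> t0; rewrite gram_lift_drsub mxrank_gram (lift_psd_rank VV).
Qed.

Lemma gram_lift_drsub_rank0 : (\rank (drsubmx (gram_lift P 0 u S)) < k)%N.
Proof.
have [uP hS SP tS] := uS.
by rewrite gram_lift_drsub mxrank_gram (lift_psd0_rank VV).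
Qed.

Lemma gram_lift_tr_gt0 t : 0 <= t -> [|| t != 0, u != 0 | S != 0] ->
  0 < re (\tr (gram_lift P t u S)).
Proof.
have [uP hS SP tS] := uS.
move=> t0 nz; rewrite lt_def gram_lift_tr addr_ge0 ?frob_ge0// andbT.
apply: contraL nz; rewrite paddr_eq0 ?frob_ge0// => /andP[/eqP fu /eqP fH].
have [-> ->] := lift_psd_eq0 VV k_gt0 hS tS t0 (frob_eq0 fH).
by rewrite (frob_eq0 fu) !eqxx.
Qed.

(** [neg_eig], and with it [lift_psd], is positively homogeneous of degree 1, and a Gram matrix is
    quadratic. *)
Lemma gram_liftZ t a : 0 <= a ->
  gram_lift P (a * t) (of_ a *: u) (of_ a *: S) =
  of_ (a ^+ 2) *: gram_lift P t u S.
Proof.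
have [uP hS SP tS] := uS.
move=> a0; rewrite /gram_lift.
have -> : lift_psd P (a * t) (of_ a *: S) = of_ a *: lift_psd P t S.
  rewrite /lift_psd neg_eigZ ?frame_gt0// -mulrDr rmorphM -scalerA.
  by rewrite scalerDr.
rewrite adjointZ -scale_row_mx adjointZ -scalemxAl -scalemxAr scalerA.
by rewrite expr2 rmorphM.
Qed.

End Fibre.

(** Factor [B] through [k] rows as the Gram matrix of [row_mx y Z], and decompose [Z = M *m W] by
    polar decomposition. Multiplying by [W^h] on the left keeps the Gram matrix and turns [Z] into
    the positive semidefinite [W^h *m M *m W]. *)
Lemma gram_lift_surj (B : 'M[K]_(1 + m)) : psd B -> \rank B = k ->
  \rank (drsubmx B) = k ->
  exists (W : 'M[K]_(k, m)) t u S, [/\ W *m W^h = 1%:M, 0 < t,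
    in_fiber (W^h *m W) u S & B = gram_lift (W^h *m W) t u S].
Proof.
move=> pB rB rD.
have [Y BE] : exists Y : 'M[K]_(k, 1 + m), B = Y^h *m Y.
  have [Y YE] := psd_factor_rank pB.
  by move: Y YE; rewrite rB => Y ->; exists Y.
set y := lsubmx Y; set Z := rsubmx Y.
have YE : Y = row_mx y Z by rewrite hsubmxK.
have fZ : row_free Z.
  apply/eqP; rewrite -[RHS]rD BE YE adjoint_row_mx mul_col_row block_mxKdr.
  by rewrite mxrank_gram.
have [M [W [pM uM WW ZE]]] := row_free_polar fZ.
pose H := W^h *m M *m W.
have pH : psd H by exact: psd_conj.
have rH : \rank H = k.
  have ME : M = W *m H *m W^h.
    by rewrite /H !mulmxA WW mul1mx -mulmxA WW mulmx1.
  have /eqP rM : \rank M == k by rewrite -/(row_free M) row_free_unit.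
  rewrite -[RHS]rM; apply/eqP; rewrite eqn_leq; apply/andP; split.
    by apply: leq_trans (mxrankM_maxl _ _) _; exact: mxrankM_maxr.
  rewrite [in X in (X <= _)%N]ME.
  by apply: leq_trans (mxrankM_maxl _ _) _; exact: mxrankM_maxr.
have HP : H *m (W^h *m W) = H by rewrite /H !mulmxA -(mulmxA _ W) WW mulmx1.
have [t [S [t0 hS SP tS HE]]] := lift_psd_surj WW k_gt0 pH HP rH.
exists W, t, (y^h *m W), S; split => //.
  by split => //; rewrite mulmxA -(mulmxA _ W) WW mulmx1.
rewrite /gram_lift -HE adjointM adjointK BE YE ZE.
have -> : row_mx (W^h *m y) H = W^h *m row_mx y (M *m W).
  by rewrite mul_mx_row mulmxA.
by rewrite adjointM adjointK mulmxA -(mulmxA _ W) WW mulmx1.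
Qed.

End Frame.

(** The lower right block is the square of the lift [H] and determines [H]. The range of [H] gives
    the projection, the lower left block [H *m u^h] gives [u] within that range, and the trace of
    [H] separates the scalar part from [S]. *)
Lemma gram_lift_inj (V V' : 'M[K]_(k, m)) t t' u u' S S' :
  V *m V^h = 1%:M -> V' *m V'^h = 1%:M -> 0 < t -> 0 < t' ->
  in_fiber (V^h *m V) u S -> in_fiber (V'^h *m V') u' S' ->
  gram_lift (V^h *m V) t u S = gram_lift (V'^h *m V') t' u' S' ->
  [/\ V^h *m V = V'^h *m V', t = t', u = u' & S = S'].
Proof.
move=> VV VV' t0 t0' [uP hS SP tS] [uP' hS' SP' tS'] E.
set P := V^h *m V in uP SP E *; set P' := V'^h *m V' in uP' SP' E *.
have pH := lift_psd_psd VV k_gt0 hS SP (ltW t0).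
have pH' := lift_psd_psd VV' k_gt0 hS' SP' (ltW t0').
have rH := lift_psd_rank VV k_gt0 hS SP t0.
have rH' := lift_psd_rank VV' k_gt0 hS' SP' t0'.
have HP := lift_psd_proj VV SP t; have HP' := lift_psd_proj VV' SP' t'.
have tH := lift_psd_tr VV tS t; have tH' := lift_psd_tr VV' tS' t'.
rewrite -/P in pH rH HP tH; rewrite -/P' in pH' rH' HP' tH'.
have := congr1 drsubmx E; have := congr1 dlsubmx E.
rewrite !gram_lift_dlsub !gram_lift_drsub (psd_herm pH) (psd_herm pH').
move=> Eu EH; have HH := psd_sqrt_unique pH pH' EH.
have eqHP (Q H : 'M[K]_m) : Q^h = Q -> \rank Q = k -> H *m Q = H ->
    \rank H = k -> (H == Q)%MS.
  move=> _ rQ HQ rHk; have HsQ : (H <= Q)%MS by rewrite -HQ submxMl.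
  by rewrite -(geq_leqif (mxrank_leqif_eq HsQ)) rQ rHk.
have PP : P = P'.
  apply: proj_unique; rewrite ?frame_proj_herm ?(frame_proj_idem VV)
    ?(frame_proj_idem VV')//.
  have /eqmxP e1 := eqHP _ _ (frame_proj_herm V) (frame_proj_rank VV) HP rH.
  have /eqmxP e2 := eqHP _ _ (frame_proj_herm V') (frame_proj_rank VV') HP' rH'.
  apply/eqmxP; apply: eqmx_trans (eqmx_sym e1) _; rewrite HH; exact: e2.
have uu : u = u'.
  have w0 : (u - u') *m lift_psd P t S = 0.
    rewrite mulmxBl; apply/eqP; rewrite subr_eq0; apply/eqP.
    rewrite -[LHS]adjointK (adjointM u) (psd_herm pH) Eu adjointM adjointK.
    by rewrite (psd_herm pH') HH.
  have : (u - u' <= lift_psd P t S)%MS.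
    have /andP[_] := eqHP _ _ (frame_proj_herm V) (frame_proj_rank VV) HP rH.
    apply: submx_trans; rewrite -/P -uP -uP' -PP -mulmxBl; exact: submxMl.
  move=> /submxP[z zE]; apply/eqP; rewrite -subr_eq0; apply/eqP.
  apply: mulmx_adjoint_eq0; rewrite {2}zE adjointM (psd_herm pH) mulmxA w0.
  by rewrite mul0mx.
have te : t + neg_eig S = t' + neg_eig S'.
  have := tH; rewrite HH tH' => /(@sc_of_inj _ K)/esym/(mulIf _) -> //.
  by rewrite pnatr_eq0 -lt0n.
have SS : S = S'.
  have := HH; rewrite /lift_psd te PP; exact: addrI.
by split => //; move: te; rewrite SS; exact: addIr.
Qed.

Lemma gram_lift_continuous (X : topologicalType) (P : X -> 'M[K]_m)
    (t : X -> R) (u : X -> 'rV[K]_m) (S : X -> 'M[K]_m) :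
  (0 < m)%N -> continuous P -> continuous t -> continuous u -> continuous S ->
  (forall x, (S x)^h = S x) ->
  continuous (fun x => gram_lift (P x) (t x) (u x) (S x)).
Proof.
move=> m0 cP ct cu cS hS.
have cZ : continuous (fun x => row_mx (u x)^h (lift_psd (P x) (t x) (S x))).
  apply: row_mx_continuous; first exact: adjoint_continuous.
  apply: mxadd_continuous => //; apply: mxscale_continuous => //.
  apply: of_continuous; apply: fct_add_continuous => //.
  exact: neg_eig_continuous.
by apply: mxmul_continuous => //; exact: adjoint_continuous.
Qed.

End GramLift.

Lemma fct_max_continuous (R : realType) (X : topologicalType) (f g : X -> R) :
  continuous f -> continuous g -> continuous (fun x => Num.max (f x) (g x)).
Proof. by move=> cf cg x; apply: continuous_max; [exact: cf|exact: cg]. Qed.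

(** * The bundle over the Grassmannian *)

Section ThomBundle.
Variables (R : realType) (K : scalars R) (m k r : nat).
Hypothesis k_gt0 : (0 < k)%N.
Hypothesis km : (k <= m)%N.

Local Notation of_ := (@sc_of R K).
Local Notation re := (@sc_re R K).
Local Notation d := (@sc_im R K (sc_i K)).
Local Notation Gr := (grassmannian K k m).
Local Notation unreal := (@unrealify R K (1 + m) m).
Local Notation N := ((1 + m) * m + (1 + m) * m)%N.

(* The first summand is the real dimension of the space of the vectors [u], the
   rest that of the space of the traceless self-adjoint [S]. *)
Hypothesis r_rank : (r%:R : R) =
  (1 + d) * k%:R + (1 + d) / 2 * k%:R ^+ 2 + (1 - d) / 2 * k%:R - 1.

Definition bun_mx (W : Gr) : 'M[R]_N := fiber_mx k (gr_proj W).

Lemma gr_proj_tr (W : Gr) : \tr (gr_proj W) = k%:R.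
Proof. by have [V VV ->] := gr_frame W; exact: frame_proj_tr. Qed.

Lemma bun_mx_continuous : continuous bun_mx.
Proof. by apply: fiber_mx_continuous; exact: gr_proj_continuous. Qed.

Lemma bun_mx_idem W : bun_mx W *m bun_mx W = bun_mx W.
Proof.
by apply: fiber_mx_idem; rewrite ?gr_proj_herm ?gr_proj_idem ?gr_proj_tr.
Qed.

Lemma bun_mx_rank W : \rank (bun_mx W) = r.
Proof.
by apply: fiber_mx_rank; rewrite ?gr_proj_herm ?gr_proj_idem ?gr_proj_tr.
Qed.

Definition thom_bundle : vector_bundle R Gr r :=
  projection_bundle bun_mx_continuous bun_mx_idem bun_mx_rank.

Definition thom_metric : bundle_metric thom_bundle :=
  projection_metric bun_mx_continuous bun_mx_idem bun_mx_rank.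

Local Notation E := (set_type (projection_total bun_mx)).
Implicit Types e : E.

Definition bnorm e : R := Num.sqrt (pb_dot e e).

Lemma pb_dot_ge0 e : 0 <= pb_dot e e.
Proof.
by rewrite /pb_dot mxE; apply: sumr_ge0 => i _; rewrite mxE -expr2 sqr_ge0.
Qed.

Lemma bnorm_ge0 e : 0 <= bnorm e. Proof. exact: sqrtr_ge0. Qed.

Lemma bnorm_sqr e : bnorm e ^+ 2 = pb_dot e e.
Proof. by rewrite sqr_sqrtr ?pb_dot_ge0. Qed.

Lemma bnorm_le1 e : (pb_dot e e <= 1) = (bnorm e <= 1).
Proof. by rewrite -bnorm_sqr -[1 in LHS](expr1n _ 2) ler_pXn2r ?nnegrE ?bnorm_ge0. Qed.

Lemma bnorm_eq1 e : (pb_dot e e = 1) <-> (bnorm e = 1).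
Proof.
rewrite -bnorm_sqr; split => [/eqP|->]; last by rewrite expr1n.
by rewrite sqrp_eq1 ?bnorm_ge0// => /eqP.
Qed.

Lemma bnorm_eq0 e : bnorm e = 0 -> pb_vec e = 0.
Proof.
move=> e0; apply/eqP; apply/negPn/negP => /rV_dot_gt0.
by rewrite -/(pb_dot e e) -bnorm_sqr e0 expr0n /= ltxx.
Qed.

Lemma bnorm_continuous (X : topologicalType) (f : X -> E) :
  continuous f -> continuous (fun x => bnorm (f x)).
Proof.
move=> cf; have cv := comp_continuous cf (@pb_vec_continuous _ _ _ bun_mx).
have cd : continuous (fun x => pb_dot (f x) (f x)).
  apply: entry_continuous; apply: mxmul_continuous => //.
  exact: trmx_continuous.
exact: comp_continuous cd (@sqrt_continuous R).
Qed.

Definition bscale (a : R) e : E := pb_scale bun_mx_idem a e.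

Lemma bnormZ a e : bnorm (bscale a e) = `|a| * bnorm e.
Proof.
rewrite /bnorm /pb_dot pb_vec_scale -scalemxAl.
have -> : (a *: pb_vec e)^T = a *: (pb_vec e)^T by rewrite linearZ.
rewrite -scalemxAr scalerA mxE -expr2.
by rewrite sqrtrM ?sqr_ge0// sqrtr_sqr.
Qed.

Lemma bscale1 e : bscale 1 e = e.
Proof. by apply: pb_eq => //; rewrite pb_vec_scale scale1r. Qed.

Definition bu e : 'rV[K]_m := usubmx (unreal (pb_vec e)).
Definition bS e : 'M[K]_m := dsubmx (unreal (pb_vec e)).

Lemma b_in_fiber e : in_fiber (gr_proj (pb_proj e)) (bu e) (bS e).
Proof.
by apply: (@fiber_mx_in _ _ k); rewrite ?gr_proj_herm ?gr_proj_idem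
  ?gr_proj_tr//; exact: pb_vecP.
Qed.

Lemma b_eq e e' : pb_proj e = pb_proj e' -> bu e = bu e' -> bS e = bS e' ->
  e = e'.
Proof.
move=> pe ue Se; apply: pb_eq => //.
have rK (f : E) : realify (unreal (pb_vec f)) = pb_vec f.
  exact: (fiber_mx_unrealifyK
    (pb_vecP f : _ *m fiber_mx k (gr_proj (pb_proj f)) = _)).
rewrite -(rK e) -(rK e') -[unreal (pb_vec e)]vsubmxK.
by rewrite -[unreal (pb_vec e')]vsubmxK -/(bu e) -/(bS e) ue Se.
Qed.

Lemma b_mk (W : Gr) u S : in_fiber (gr_proj W) u S ->
  exists e, [/\ pb_proj e = W, bu e = u & bS e = S].
Proof.
move=> uS; exists (pb_mk bun_mx_idem W (realify (col_mx u S))).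
rewrite /bu /bS pb_vec_mk ?realifyK ?col_mxKu ?col_mxKd//.
by apply: fiber_mx_realify => //; rewrite ?gr_proj_herm.
Qed.

Lemma buZ a e : bu (bscale a e) = of_ a *: bu e.
Proof. by rewrite /bu pb_vec_scale unrealifyZ linearZ. Qed.

Lemma bSZ a e : bS (bscale a e) = of_ a *: bS e.
Proof. by rewrite /bS pb_vec_scale unrealifyZ linearZ. Qed.

Lemma b_neq0 e : bnorm e != 0 -> (bu e != 0) || (bS e != 0).
Proof.
apply: contraR; rewrite negb_or !negbK => /andP[/eqP ue /eqP Se].
have -> : e = bscale 0 e.
  by apply: b_eq; rewrite ?buZ ?bSZ ?rmorph0 ?scale0r.
by rewrite bnormZ normr0 mul0r.
Qed.

Definition blift e (t : R) := gram_lift (gr_proj (pb_proj e)) t (bu e) (bS e).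

Lemma blift_psd e t : psd (blift e t). Proof. exact: gram_lift_psd. Qed.

Lemma blift_rank e t : (\rank (blift e t) <= k)%N.
Proof.
have := b_in_fiber e; rewrite /blift; have [V VV ->] := gr_frame (pb_proj e).
by move=> uS; exact: (gram_lift_rank VV uS).
Qed.

Lemma blift_drsub_rank e t : 0 < t -> \rank (drsubmx (blift e t)) = k.
Proof.
have := b_in_fiber e; rewrite /blift; have [V VV ->] := gr_frame (pb_proj e).
by move=> uS t0; exact: (gram_lift_drsub_rank k_gt0 VV uS t0).
Qed.

Lemma blift_drsub_rank0 e : (\rank (drsubmx (blift e 0)) < k)%N.
Proof.
have := b_in_fiber e; rewrite /blift; have [V VV ->] := gr_frame (pb_proj e).
by move=> uS; exact: (gram_lift_drsub_rank0 k_gt0 VV uS).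
Qed.

Lemma blift_tr_gt0 e t : 0 <= t -> (t != 0) || (bnorm e != 0) ->
  0 < re (\tr (blift e t)).
Proof.
move=> t0 nz; have := b_in_fiber e; rewrite /blift.
have [V VV ->] := gr_frame (pb_proj e) => uS.
apply: (gram_lift_tr_gt0 k_gt0 VV uS t0).
by case/orP: nz => [->//|/b_neq0 ->]; rewrite orbT.
Qed.

Lemma bliftZ a e t : 0 <= a ->
  blift (bscale a e) (a * t) = of_ (a ^+ 2) *: blift e t.
Proof.
move=> a0; rewrite /blift buZ bSZ /bscale pb_proj_mk.
have := b_in_fiber e; have [V VV ->] := gr_frame (pb_proj e) => uS.
exact: (gram_liftZ k_gt0 VV uS).
Qed.

Lemma blift_inj e e' t t' : 0 < t -> 0 < t' -> blift e t = blift e' t' ->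
  e = e' /\ t = t'.
Proof.
move=> t0 t0'; have := b_in_fiber e; have := b_in_fiber e'; rewrite /blift.
have [V VV PV] := gr_frame (pb_proj e).
have [V' VV' PV'] := gr_frame (pb_proj e').
rewrite PV PV' => uS' uS /(gram_lift_inj k_gt0 VV VV' t0 t0' uS uS').
move=> [PP tt uu SS]; split => //; apply: b_eq => //.
by apply: gr_proj_inj; rewrite PV PV'.
Qed.

Lemma blift_continuous (X : topologicalType) (f : X -> E) (t : X -> R) :
  continuous f -> continuous t -> continuous (fun x => blift (f x) (t x)).
Proof.
move=> cf ct; have cv := comp_continuous cf (@pb_vec_continuous _ _ _ bun_mx).
have cp := comp_continuous cf (@pb_proj_continuous _ _ _ bun_mx).
have cq := unrealify_continuous cv.
apply: gram_lift_continuous => //.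
- exact: leq_trans km.
- exact: comp_continuous cp (@gr_proj_continuous _ _ _ _).
- apply: mx_continuous => i j; rewrite /bu; under eq_fun do rewrite mxE.
  exact: entry_continuous.
- apply: mx_continuous => i j; rewrite /bS; under eq_fun do rewrite mxE.
  exact: entry_continuous.
- by move=> x; have [] := b_in_fiber (f x).
Qed.

Definition low_rank : set 'M[K]_(1 + m) :=
  [set B | [/\ psd B, (\rank B <= k)%N & re (\tr B) = 1]].

Definition low_corner : set 'M[K]_(1 + m) :=
  [set B | low_rank B /\ (\rank (drsubmx B) < k)%N].

Definition polar_tr e := re (\tr (blift e (1 - bnorm e))).

(* Maps the open disc bundle bijectively onto the complement of [low_corner] in
   [low_rank], and the sphere bundle into [low_corner]. *)
Definition polar e : 'M[K]_(1 + m) :=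
  of_ (polar_tr e)^-1 *: blift e (1 - bnorm e).

Lemma polar_tr_gt0 e : bnorm e <= 1 -> 0 < polar_tr e.
Proof.
move=> e1; apply: blift_tr_gt0; first by rewrite subr_ge0.
by have [->|] := eqVneq (bnorm e) 0; rewrite ?subr0 ?oner_eq0 ?orbT.
Qed.

Lemma rank_of_scale p q a (B : 'M[K]_(p, q)) : a != 0 ->
  \rank (of_ a *: B) = \rank B.
Proof. by move=> a0; rewrite mxrank_scale_nz// sc_of_eq0. Qed.

Lemma drsubZ a (B : 'M[K]_(1 + m)) : drsubmx (a *: B) = a *: drsubmx B.
Proof. by apply/matrixP => i j; rewrite !mxE. Qed.

Lemma drsubD (A B : 'M[K]_(1 + m)) : drsubmx (A + B) = drsubmx A + drsubmx B.
Proof. by apply/matrixP => i j; rewrite !mxE. Qed.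

Lemma polar_low e : bnorm e <= 1 -> low_rank (polar e).
Proof.
move=> e1; have t0 := polar_tr_gt0 e1; split.
- by apply: psdZ; [rewrite invr_ge0 ltW|exact: blift_psd].
- by rewrite rank_of_scale ?blift_rank// invr_eq0 gt_eqF.
- by rewrite mxtraceZ sc_reZ mulVf// gt_eqF.
Qed.

Lemma polar_corner e : bnorm e <= 1 -> low_corner (polar e) <-> bnorm e = 1.
Proof.
move=> e1; have t0 := polar_tr_gt0 e1; split => [[_]|e1'].
  rewrite drsubZ rank_of_scale ?invr_eq0 ?gt_eqF// => h.
  apply/eqP; rewrite eq_le e1 leNgt; apply/negP => e1'.
  by move: h; rewrite blift_drsub_rank ?ltnn// subr_gt0.
split; first exact: polar_low.
rewrite drsubZ rank_of_scale ?invr_eq0 ?gt_eqF// e1' subrr.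
exact: blift_drsub_rank0.
Qed.

(** Dividing by [t + bnorm e] moves the pair of [e] and [t] to the slice where the norm and the
    parameter add up to 1; homogeneity does the rest. *)
Lemma polar_blift e t : 0 < t -> exists2 a, 0 < a &
  [/\ bnorm (bscale a e) < 1, re (\tr (blift e t)) > 0 &
   polar (bscale a e) = of_ (re (\tr (blift e t)))^-1 *: blift e t].
Proof.
move=> t0; have s0 : 0 < t + bnorm e by rewrite ltr_pwDl ?bnorm_ge0.
have b0 : re (\tr (blift e t)) > 0.
  by apply: blift_tr_gt0; [exact: ltW|rewrite gt_eqF].
exists (t + bnorm e)^-1; first by rewrite invr_gt0.
have nE : bnorm (bscale (t + bnorm e)^-1 e) = (t + bnorm e)^-1 * bnorm e.
  by rewrite bnormZ gtr0_norm ?invr_gt0.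
split => //.
  by rewrite nE mulrC ltr_pdivrMr// mul1r ltrDr.
have tE : 1 - bnorm (bscale (t + bnorm e)^-1 e) = (t + bnorm e)^-1 * t.
  by rewrite nE; field; rewrite gt_eqF.
rewrite /polar /polar_tr tE bliftZ ?invr_ge0 ?ltW// mxtraceZ sc_reZ scalerA.
rewrite -rmorphM invfM mulrAC mulVf ?mul1r//.
by rewrite expf_neq0// invr_eq0 gt_eqF.
Qed.

Lemma polar_inj e e' : bnorm e < 1 -> bnorm e' < 1 -> polar e = polar e' ->
  e = e'.
Proof.
move=> e1 e1' pp.
have a0 := polar_tr_gt0 (ltW e1); have a0' := polar_tr_gt0 (ltW e1').
(* [blift] is homogeneous of degree 2, so the square root of the ratio of the two normalizing traces
   is the scale relating the two points. *)
pose c := Num.sqrt (polar_tr e / polar_tr e').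
have c0 : 0 < c by rewrite sqrtr_gt0 divr_gt0.
have E : blift e (1 - bnorm e) = blift (bscale c e') (c * (1 - bnorm e')).
  rewrite bliftZ ?ltW// sqr_sqrtr ?divr_ge0 ?ltW// rmorphM -scalerA -/(polar e').
  by rewrite -pp /polar scalerA -rmorphM mulfV ?gt_eqF// rmorph1 scale1r.
have s0 : 0 < 1 - bnorm e by rewrite subr_gt0.
have s0' : 0 < c * (1 - bnorm e') by rewrite mulr_gt0// subr_gt0.
have [ee' tt] := blift_inj s0 s0' E.
have nE : bnorm e = c * bnorm e' by rewrite ee' bnormZ gtr0_norm.
(* Adding [bnorm e = c * bnorm e'] to the equation [tt] gives [1 = c]. *)
have c1 : c = 1 by lra.
by rewrite ee' c1 bscale1.
Qed.

(** Outside [low_corner] both [B] and its lower right block have rank exactly [k], so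
    [gram_lift_surj] applies. *)
Lemma polar_surj B : low_rank B -> ~ low_corner B ->
  exists2 e, bnorm e < 1 & polar e = B.
Proof.
move=> lB nB; have [pB rB tB] := lB.
have rD : \rank (drsubmx B) = k.
  apply/eqP; rewrite eqn_leq (leq_trans (drsub_rank B))//= leqNgt.
  by apply/negP => h; apply: nB.
have rB' : \rank B = k.
  by apply/eqP; rewrite eqn_leq rB -{1}rD drsub_rank.
have [V [t [u [S [VV t0 uS BE]]]]] := gram_lift_surj k_gt0 pB rB' rD.
have [W PW] := gr_of_frame VV.
have [|e [eW eu eS]] := @b_mk W u S; first by rewrite PW.
have bE : blift e t = B by rewrite /blift eW eu eS PW.
have [a a0 [n1 _ pE]] := polar_blift e t0.
by exists (bscale a e) => //; rewrite pE bE tB invr1 rmorph1 scale1r.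
Qed.

(* The homotopy moves [polar e] radially and, once the boundary of the disc is
   reached, straight towards [corner]. *)
Definition push e (t : R) : 'M[K]_(1 + m) :=
  of_ ((1 - t * bnorm e) / polar_tr e) *:
    blift e (Num.max 0 (1 - (1 + t) * bnorm e)) +
  of_ (Num.max 0 ((1 + t) * bnorm e - 1)) *: corner K m.

Lemma push0 e : bnorm e <= 1 -> push e 0 = polar e.
Proof.
move=> e1; rewrite /push addr0 !mul1r mul0r subr0 mul1r.
rewrite [Num.max 0 (1 - _)]max_r ?subr_ge0//.
by rewrite max_l ?subr_le0// rmorph0 scale0r addr0.
Qed.

(** Over the sphere bundle [push] depends on [polar e] alone, and so agrees with the segment
    homotopy on [low_corner]; this is what lets the two be glued. *)
Lemma push_sphere e t : bnorm e = 1 -> 0 <= t ->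
  push e t = of_ (1 - t) *: polar e + of_ t *: corner K m.
Proof.
move=> e1 t0; rewrite /push /polar e1 !mulr1 subrr scalerA -rmorphM.
rewrite max_l; last by lra.
by rewrite max_r; [congr (_ + of_ _ *: _); lra|lra].
Qed.

Lemma push_psd e t : bnorm e <= 1 -> 0 <= t <= 1 -> psd (push e t).
Proof.
move=> e1 /andP[t0 t1]; have n0 := bnorm_ge0 e; apply: psdD; apply: psdZ.
- by apply: divr_ge0; [rewrite subr_ge0; nra|exact/ltW/polar_tr_gt0].
- exact: blift_psd.
- by rewrite le_max lexx.
- exact: corner_psd.
Qed.

(** The two maxima are never both positive: either no corner is added, or the lift is taken at
    parameter 0, where its lower right block has rank below [k]. *)
Lemma push_rank e t : bnorm e <= 1 -> 0 <= t <= 1 -> (\rank (push e t) <= k)%N.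
Proof.
move=> e1 /andP[t0 t1]; rewrite /push.
case: (lerP 0 (1 - (1 + t) * bnorm e)) => h.
  rewrite [Num.max 0 (_ - 1)]max_l ?rmorph0 ?scale0r ?addr0; last by lra.
  exact: leq_trans (mxrankS (scalemx_sub _ (submx_refl _))) (blift_rank _ _).
apply: add_corner_rank; first exact: blift_psd.
exact: blift_drsub_rank0.
Qed.

Lemma push_tr e t : bnorm e <= 1 -> 0 <= t <= 1 -> 0 < re (\tr (push e t)).
Proof.
move=> e1 /andP[t0 t1]; have n0 := bnorm_ge0 e; have a0 := polar_tr_gt0 e1.
rewrite /push mxtraceD !mxtraceZ corner_tr mulr1 sc_reD sc_re_of sc_reZ.
have ptr : 0 <= re (\tr (blift e (Num.max 0 (1 - (1 + t) * bnorm e)))).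
  by apply: psd_tr_ge0; exact: blift_psd.
have c0 : 0 <= (1 - t * bnorm e) / polar_tr e.
  by apply: divr_ge0; [rewrite subr_ge0; nra|exact: ltW].
have := mulr_ge0 c0 ptr.
case: (lerP ((1 + t) * bnorm e - 1) 0) => h; last by move=> ?; rewrite ltr_wpDl.
rewrite addr0 => _; apply: mulr_gt0; first by rewrite divr_gt0// subr_gt0; nra.
apply: blift_tr_gt0; first by rewrite le_max lexx.
have [n00|] := eqVneq (bnorm e) 0; last by rewrite orbT.
by rewrite n00 mulr0 subr0 max_r ?ler01// oner_eq0.
Qed.

Lemma push1_far e : 1 <= 2 * bnorm e -> bnorm e <= 1 ->
  (\rank (drsubmx (push e 1)) < k)%N.
Proof.
move=> h e1; rewrite /push drsubD !drsubZ drsub_corner scaler0 addr0.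
rewrite max_l; last by lra.
apply: leq_ltn_trans (mxrankS (scalemx_sub _ (submx_refl _))) _.
exact: blift_drsub_rank0.
Qed.

(** The norm [bnorm e] and the parameter [1 - 2 * bnorm e] add up to [1 - bnorm e], so this is the
    factor that returns to the slice on which [polar] is defined. *)
Lemma push1_near e : 2 * bnorm e < 1 -> exists2 a, 0 < a &
  of_ a *: push e 1 = polar (bscale (1 - bnorm e)^-1 e).
Proof.
move=> h; have n0 := bnorm_ge0 e.
have e1 : bnorm e <= 1 by lra.
have a0 := polar_tr_gt0 e1.
have c0 : 0 < (1 - bnorm e) / polar_tr e by rewrite divr_gt0//; lra.
have d0 : 0 < 1 - bnorm e by lra.
have -> : push e 1 = of_ ((1 - bnorm e) / polar_tr e) *:
    blift e (1 - 2 * bnorm e).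
  rewrite /push mul1r -[1 + 1]/(2%:R : R) max_r ?subr_ge0; last by lra.
  by rewrite max_l ?rmorph0 ?scale0r ?addr0//; lra.
have nE : bnorm (bscale (1 - bnorm e)^-1 e) = (1 - bnorm e)^-1 * bnorm e.
  by rewrite bnormZ gtr0_norm ?invr_gt0.
have tE : 1 - bnorm (bscale (1 - bnorm e)^-1 e) =
    (1 - bnorm e)^-1 * (1 - 2 * bnorm e).
  by rewrite nE; field; rewrite gt_eqF.
have ne1 : bnorm (bscale (1 - bnorm e)^-1 e) <= 1.
  by rewrite nE mulrC ler_pdivrMr// mul1r; lra.
have b0 := polar_tr_gt0 ne1.
rewrite /polar tE bliftZ ?invr_ge0 ?ltW//.
exists ((polar_tr (bscale (1 - bnorm e)^-1 e))^-1 * ((1 - bnorm e)^-1 ^+ 2) /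
  ((1 - bnorm e) / polar_tr e)).
  by rewrite divr_gt0// mulr_gt0 ?invr_gt0// exprn_gt0// invr_gt0.
by rewrite !scalerA -!rmorphM divfK// gt_eqF.
Qed.

Lemma polar_continuous (X : topologicalType) (f : X -> E) :
  continuous f -> (forall x, bnorm (f x) <= 1) ->
  continuous (fun x => polar (f x)).
Proof.
move=> cf f1; have cn := bnorm_continuous cf.
have cb : continuous (fun x => blift (f x) (1 - bnorm (f x))).
  apply: blift_continuous => //; apply: fct_add_continuous.
    exact: fct_cst_continuous.
  exact: fct_opp_continuous.
apply: mxscale_continuous => //; apply: of_continuous.
apply: fct_inv_continuous => [x|]; first by rewrite gt_eqF ?polar_tr_gt0.
by apply: re_continuous; exact: mxtrace_continuous.
Qed.

Lemma push_continuous (X : topologicalType) (f : X -> E) (t : X -> R) :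
  continuous f -> continuous t -> (forall x, bnorm (f x) <= 1) ->
  continuous (fun x => push (f x) (t x)).
Proof.
move=> cf ct f1; have cn := bnorm_continuous cf.
have c1 : continuous (fun _ : X => 1 : R) by exact: fct_cst_continuous.
have ctn : continuous (fun x => (1 + t x) * bnorm (f x)).
  by apply: fct_mul_continuous => //; exact: fct_add_continuous.
have cb : continuous (fun x => blift (f x) (1 - bnorm (f x))).
  apply: blift_continuous => //; apply: fct_add_continuous => //.
  exact: fct_opp_continuous.
apply: mxadd_continuous; apply: mxscale_continuous.
- apply: of_continuous; apply: fct_mul_continuous.
    apply: fct_add_continuous => //; apply: fct_opp_continuous.
    exact: fct_mul_continuous.
  apply: fct_inv_continuous => [x|]; first by rewrite gt_eqF ?polar_tr_gt0.
  by apply: re_continuous; exact: mxtrace_continuous.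
- apply: blift_continuous => //; apply: fct_max_continuous; first exact: fct_cst_continuous.
  by apply: fct_add_continuous => //; exact: fct_opp_continuous.
- apply: of_continuous; apply: fct_max_continuous; first exact: fct_cst_continuous.
  by apply: fct_add_continuous => //; apply: fct_opp_continuous.
- exact: fct_cst_continuous.
Qed.

End ThomBundle.

(** * The homotopy equivalence *)

Lemma hausdorff_prod (X Y : topologicalType) :
  hausdorff_space X -> hausdorff_space Y -> hausdorff_space (X * Y)%type.
Proof.
move=> hX hY [x y] [x' y'] xy.
have nb (z : X) (w : Y) A B : nbhs z A -> nbhs w B -> nbhs (z, w) (A `*` B).
  by move=> zA wB; exists (A, B).
congr pair.
  apply: hX => A B xA xB.
  have [[a b] [[Aa _] [Ba _]]] :=
    xy _ _ (nb _ _ _ setT xA filterT) (nb _ _ _ setT xB filterT).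
  by exists a.
apply: hY => A B yA yB.
have [[a b] [[_ Ab] [_ Bb]]] :=
  xy _ _ (nb _ _ setT _ filterT yA) (nb _ _ setT _ filterT yB).
by exists b.
Qed.

Section ThomEquivalence.
Variables (R : realType) (K : scalars R) (m k r : nat).
Hypothesis k_gt0 : (0 < k)%N.
Hypothesis km : (k <= m)%N.

Local Notation of_ := (@sc_of R K).
Local Notation re := (@sc_re R K).
Local Notation dim_i := (@sc_im R K (sc_i K)).
Local Notation Gr := (grassmannian K k m).
Local Notation N := ((1 + m) * m + (1 + m) * m)%N.

Hypothesis r_rank : (r%:R : R) =
  (1 + dim_i) * k%:R + (1 + dim_i) / 2 * k%:R ^+ 2 + (1 - dim_i) / 2 * k%:R - 1.

Local Notation E := (set_type (projection_total (@bun_mx R K m k))).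
Local Notation met := (thom_metric m k_gt0 r_rank).
Local Notation D := (set_type (disc_bundle met)).
Local Notation T := (thom_space met).
Implicit Types (d : D) (e : E).

Definition ev d : E := set_val d.

Lemma ev_le1 d : bnorm (ev d) <= 1.
Proof. by rewrite -bnorm_le1; exact: (set_val_in d). Qed.

Lemma ev_inj d d' : ev d = ev d' -> d = d'.
Proof. exact: val_inj. Qed.

Lemma ev_continuous (X : topologicalType) (f : X -> D) :
  continuous f -> continuous (fun x => ev (f x)).
Proof. by move=> cf; exact: comp_continuous cf (@set_val_continuous _ _). Qed.

Lemma disc_mk_subproof e : bnorm e <= 1 -> e \in disc_bundle met.
Proof. by move=> e1; rewrite inE /disc_bundle /= -/(pb_dot e e) bnorm_le1. Qed.

Definition disc_mk e (e1 : bnorm e <= 1) : D := exist _ e (disc_mk_subproof e1).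

Lemma ev_mk e (e1 : bnorm e <= 1) : ev (disc_mk e1) = e.
Proof. by []. Qed.

(** A row of an orthonormal frame serves as a nonzero [u]. The point marks the collapsed class in
    the Thom space. *)
Lemma sphere_point : exists d, bnorm (ev d) = 1.
Proof.
pose V : 'M[K]_(k, m) := pid_mx k.
have VV : V *m V^h = 1%:M.
  rewrite /V /adjoint map_pid_mx tr_pid_mx mul_pid_mx minnn.
  by rewrite (minn_idPr km) pid_mx_1.
have [W WE] := gr_of_frame VV.
pose i0 : 'I_k := Ordinal k_gt0.
have [|e [_ eu _]] := @b_mk R K m k k_gt0 W (row i0 V) 0.
  split; rewrite ?adjoint0 ?mul0mx ?linear0//.
  by rewrite WE -row_mul mulmxA VV mul1mx.
have e0 : bnorm e != 0.
  apply/eqP => /bnorm_eq0 v0.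
  have u0 : row i0 V = 0.
    have ee : e = bscale k_gt0 0 e.
      by apply: pb_eq => //; rewrite pb_vec_scale v0 scaler0.
    by rewrite -eu ee buZ rmorph0 scale0r.
  have := congr1 (row i0) VV; rewrite row_mul u0 mul0mx => /rowP/(_ i0).
  by rewrite !mxE eqxx => /eqP; rewrite eq_sym oner_eq0.
have e1 : bnorm (bscale k_gt0 (bnorm e)^-1 e) = 1.
  by rewrite bnormZ ger0_norm ?invr_ge0 ?bnorm_ge0// mulVf.
have e1' : bnorm (bscale k_gt0 (bnorm e)^-1 e) <= 1 by rewrite e1.
by exists (disc_mk e1').
Qed.

Definition pole : D := projT1 (cid sphere_point).

Lemma bnorm_pole : bnorm (ev pole) = 1.
Proof. by rewrite /pole; case: cid. Qed.

Lemma thom_eqP d d' : \pi_T d = \pi_T d' <->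
  d = d' \/ (bnorm (ev d) = 1 /\ bnorm (ev d') = 1).
Proof.
have sE (c : D) : (c \in (@sphere_bundle _ _ _ _ met)) <-> bnorm (ev c) = 1.
  by rewrite inE -bnorm_eq1.
split.
  move=> /(@eqmodP _ (collapse_rel (@sphere_bundle _ _ _ _ met))) /predU1P[->|]; first by left.
  by move=> /andP[/sE ? /sE ?]; right.
move=> h; apply/(@eqmodP _ (collapse_rel (@sphere_bundle _ _ _ _ met))).
apply/predU1P; case: h => [->|[h h']]; first by left.
by right; apply/andP; split; apply/sE.
Qed.

Lemma thom_pi_continuous : continuous (fun d => \pi_T d).
Proof. exact: (@pi_continuous _ {eq_quot (collapse_rel (@sphere_bundle _ _ _ _ met))}). Qed.

Lemma thom_ind (Q : T -> Prop) : (forall d, Q (\pi_T d)) -> forall y, Q y.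
Proof. by move=> h y; rewrite -[y]reprK. Qed.

(** Dividing by the maximum of 1 and the norm retracts the bundle onto the disc bundle, which is
    therefore the image of the Grassmannian times a box. *)
Lemma disc_compact : compact [set: D].
Proof.
pose box := [set v : 'rV[R]_N | forall i, v ord0 i \in `[(-1 : R), 1]].
have cbox : compact box.
  apply: (@rV_compact R _ (fun=> `[(-1 : R), 1]%classic)) => i.
  exact: segment_compact.
pose mk (wx : Gr * 'rV[R]_N) : E := pb_mk (bun_mx_idem k_gt0) wx.1 wx.2.
have n1 e : bnorm (bscale k_gt0 (Num.max 1 (bnorm e))^-1 e) <= 1.
  have m0 : 0 < Num.max 1 (bnorm e) by rewrite lt_max ltr01.
  rewrite bnormZ gtr0_norm ?invr_gt0// mulrC ler_pdivrMr// mul1r.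
  by rewrite le_max lexx orbT.
pose h wx : D := disc_mk (n1 (mk wx)).
have -> : [set: D] = h @` ([set: Gr] `*` box).
  apply/seteqP; split => // d _.
  exists (pb_proj (ev d), pb_vec (ev d)).
    split => //= i; rewrite in_itv /=.
    have h2 : (pb_vec (ev d) 0 i) ^+ 2 <= 1.
      apply: le_trans (_ : pb_dot (ev d) (ev d) <= 1); last by rewrite bnorm_le1 ev_le1.
      rewrite /pb_dot mxE (bigD1 i)//= mxE -expr2 lerDl; apply: sumr_ge0 => j _.
      by rewrite mxE -expr2 sqr_ge0.
    by apply/andP; split; nra.
  apply: ev_inj; rewrite ev_mk /mk /= pb_mkK max_l ?ev_le1// invr1.
  exact: bscale1.
apply: continuous_compact; last first.
  by apply: compact_setX => //; exact: gr_compact.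
apply: continuous_subspaceT; apply: set_type_continuous.
have cmk : continuous mk.
  apply: pb_mk_continuous; first exact: bun_mx_continuous.
    exact: fst_continuous.
  exact: snd_continuous.
have cn := bnorm_continuous cmk.
apply: pb_mk_continuous; first exact: bun_mx_continuous.
  exact: comp_continuous cmk (@pb_proj_continuous _ _ _ _).
apply: mxscale_continuous; last exact: comp_continuous cmk (@pb_vec_continuous _ _ _ _).
apply: fct_inv_continuous => [x|]; first by rewrite gt_eqF// lt_max ltr01.
by apply: fct_max_continuous; first exact: fct_cst_continuous.
Qed.

(** Both components of [J] vanish on the sphere bundle, so [J] descends. Elsewhere the trace of the
    first one recovers the factor [1 - bnorm], which can then be divided out. *)
Lemma thom_hausdorff : hausdorff_space T.
Proof.
pose J d : 'M[K]_m * 'rV[R]_N := (of_ (1 - bnorm (ev d)) *: gr_proj (pb_proj (ev d)),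
  (1 - bnorm (ev d)) *: pb_vec (ev d)).
pose f (y : T) := J (repr y).
have fpi d : f (\pi_T d) = J d.
  rewrite /f; have := reprK (\pi_T d); move: (repr _) => d'.
  move=> /thom_eqP[->//|[h1 h2]].
  by rewrite /J h1 h2 subrr rmorph0 !scale0r.
apply: (@injective_hausdorff _ _ f); last first.
  by apply: hausdorff_prod; exact: norm_hausdorff.
  apply: thom_ind => d; apply: thom_ind => d'; rewrite !fpi /J => -[PP xx].
  have kn0 : k%:R != 0 :> R by rewrite pnatr_eq0 -lt0n.
  have nn : 1 - bnorm (ev d) = 1 - bnorm (ev d').
    have := congr1 (fun P => re (\tr P)) PP.
    by rewrite /= !mxtraceZ !gr_proj_tr -(rmorph_nat of_) !sc_reZ !sc_re_of => /(mulIf kn0).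
  apply/thom_eqP; have [n0|n0] := eqVneq (1 - bnorm (ev d)) 0.
    by right; split; lra.
  left; apply: ev_inj; apply: pb_eq.
    apply: gr_proj_inj; move: PP; rewrite -nn; apply: scalerI.
    by rewrite sc_of_eq0.
  by move: xx; rewrite -nn; exact: scalerI.
apply/quotient_continuous; rewrite (_ : _ \o _ = J); last first.
  by apply/funext => d /=; rewrite fpi.
have ce := ev_continuous (fun x => @cvg_id _ (nbhs x)).
have cn : continuous (fun d => 1 - bnorm (ev d)).
  apply: fct_add_continuous; first exact: fct_cst_continuous.
  by apply: fct_opp_continuous; exact: bnorm_continuous.
apply: pair_continuous; apply: mxscale_continuous => //.
- exact: of_continuous.
- have cp := comp_continuous ce (@pb_proj_continuous _ _ _ _).
  exact: comp_continuous cp (@gr_proj_continuous _ _ _ _).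
- exact: comp_continuous ce (@pb_vec_continuous _ _ _ _).
Qed.

Local Notation cj := (@sc_conj R K).
Local Notation Ms := (set_type (@M_space K cj (1 + m) k)).
Local Notation Mx := 'M[K]_(1 + m).

Let kn : (k < 1 + m)%N. Proof. by rewrite ltnS. Qed.

Definition collapse_pt (B : Mx) : T :=
  if pselect (exists d, bnorm (ev d) < 1 /\ polar (ev d) = B) is left h
  then \pi_T (projT1 (cid h)) else \pi_T pole.

(** Matrices without disc coordinates are moved along the segment to [corner], which is the right
    homotopy on [low_corner]. *)
Definition push_low (Bt : Mx * R) : Mx :=
  if pselect (exists d, bnorm (ev d) < 1 /\ polar (ev d) = Bt.1) is left h
  then push (ev (projT1 (cid h))) Bt.2
  else of_ (1 - Bt.2) *: Bt.1 + of_ Bt.2 *: corner K m.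

Lemma polar_corner_lt d : low_corner k (polar (ev d)) -> ~ bnorm (ev d) < 1.
Proof.
by move=> /(polar_corner k_gt0 (ev_le1 d)) ->; rewrite ltxx.
Qed.

Lemma bnorm_ge1 d : ~ bnorm (ev d) < 1 -> bnorm (ev d) = 1.
Proof. by move=> /negP; rewrite -leNgt => h; apply/eqP; rewrite eq_le ev_le1. Qed.

Lemma collapse_corner B : low_corner k B -> collapse_pt B = \pi_T pole.
Proof.
move=> cB; rewrite /collapse_pt; case: pselect => // -[d [d1 dB]].
by exfalso; apply: polar_corner_lt d1; rewrite dB.
Qed.

Lemma collapse_polar d : collapse_pt (polar (ev d)) = \pi_T d.
Proof.
have [d1|/negP/bnorm_ge1 d1] := boolP (bnorm (ev d) < 1); last first.
  rewrite collapse_corner; last exact/(polar_corner k_gt0 (ev_le1 d)).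
  by apply/thom_eqP; right; rewrite bnorm_pole.
rewrite /collapse_pt; case: pselect => [h|[]]; last by exists d.
case: cid => d' /= [d1' pp]; congr (\pi_T _); apply: ev_inj.
exact: polar_inj pp.
Qed.

Lemma push_low_corner B t : low_corner k B ->
  push_low (B, t) = of_ (1 - t) *: B + of_ t *: corner K m.
Proof.
move=> cB; rewrite /push_low; case: pselect => // -[d [d1 dB]].
by exfalso; apply: polar_corner_lt d1; rewrite dB.
Qed.

Lemma push_low_polar d t : 0 <= t -> push_low (polar (ev d), t) = push (ev d) t.
Proof.
move=> t0; have [d1|/negP/bnorm_ge1 d1] := boolP (bnorm (ev d) < 1); last first.
  rewrite push_low_corner; last exact/(polar_corner k_gt0 (ev_le1 d)).
  by rewrite push_sphere.
rewrite /push_low; case: pselect => [h|[]]; last by exists d.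
by case: cid => d' /= [d1' pp]; rewrite (polar_inj k_gt0 d1' d1 pp).
Qed.

Lemma low_rank_cases B : low_rank k B ->
  (exists d, polar (ev d) = B) \/ low_corner k B.
Proof.
move=> lB; have [|nB] := pselect (low_corner k B); [by right|left].
have [e e1 eB] := polar_surj k_gt0 lB nB.
by exists (disc_mk (ltW e1)).
Qed.

Lemma ev_id_continuous : continuous ev.
Proof. exact: (ev_continuous (fun x => @cvg_id _ (nbhs x))). Qed.

Lemma polar_ev_continuous : continuous (fun d => polar (ev d)).
Proof.
by apply: polar_continuous => //; [exact: ev_id_continuous|exact: ev_le1].
Qed.

Lemma range_polar_closed : closed (range (fun d => polar (ev d))).
Proof.
apply: compact_closed; first exact: norm_hausdorff.
apply: continuous_compact; last exact: disc_compact.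
by apply: continuous_subspaceT; exact: polar_ev_continuous.
Qed.

Lemma low_corner_closed : closed (@low_corner R K m k).
Proof.
have ci : continuous (fun B : Mx => B) by move=> x; exact: cvg_id.
have cd : continuous (fun B : Mx => drsubmx B).
  apply: mx_continuous => i j; under eq_fun do rewrite !mxE.
  exact: entry_continuous.
(* The strict bound becomes a bound by [k.-1] because [0 < k]. *)
rewrite (_ : low_corner _ = [set B | psd B] `&` ([set B | (\rank B <= k)%N] `&`
  ([set B | re (\tr B) = 1] `&` [set B | (\rank (drsubmx B) <= k.-1)%N]))).
  apply: closedI; first exact: closed_psd.
  apply: closedI; first exact: closed_rank.
  apply: closedI; last exact: closed_rank.
  apply: closed_fct_eq; first exact: norm_hausdorff.
  by apply: re_continuous; exact: mxtrace_continuous.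
apply/seteqP; split => B /=.
  by move=> [[pB rB tB] h]; split => //; split => //; split => //; lia.
by move=> [pB [rB [tB h]]]; split; [split|lia].
Qed.

(** Glued from two closed pieces: on the compact image of the disc bundle the map is induced by the
    projection to the Thom space, and on [low_corner] it is constant. *)
Lemma collapse_continuous : {within low_rank k, continuous collapse_pt}.
Proof.
apply: (@continuous_subspaceW _ _ _
  (range (fun d => polar (ev d)) `|` low_corner k)).
  by move=> B /low_rank_cases[[d <-]|]; [left; exists d|right].
apply: withinU_continuous.
- exact: range_polar_closed.
- exact: low_corner_closed.
- apply: compact_factor_continuous.
  + exact: disc_compact.
  + exact: norm_hausdorff.
  + exact: polar_ev_continuous.
  + rewrite (_ : _ \o _ = fun d => \pi_T d); first exact: thom_pi_continuous.
    by apply/funext => d /=; rewrite collapse_polar.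
apply: (@subspace_eq_continuous _ _ _ (fun=> \pi_T pole)).
  by move=> B /set_mem cB; rewrite /= /from_subspace collapse_corner.
by move=> x; exact: cvg_cst.
Qed.

Local Notation I := (set_type `[(0 : R), 1]%classic).

Lemma I_compact : compact [set: I].
Proof. by apply: compact_set_type; exact: segment_compact. Qed.

Lemma DI_compact : compact [set: D * I].
Proof.
by rewrite -setXTT; apply: compact_setX; [exact: disc_compact|exact: I_compact].
Qed.

Lemma I_bounds (s : I) : 0 <= set_val s <= 1.
Proof. by have := set_val_in s; rewrite /= in_itv. Qed.

(** The same gluing with a time factor; the disc bundle times the interval is still compact, so the
    factorization argument applies directly. *)
Lemma push_low_continuous :
  {within low_rank k `*` `[0, 1]%classic, continuous push_low}.
Proof.
pose p (x : D * I) : Mx * R := (polar (ev x.1), set_val x.2).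
pose C := [set Bt : Mx * R | low_corner k Bt.1 /\ 0 <= Bt.2 <= 1].
have cf := @fst_continuous Mx R; have cs := @snd_continuous Mx R.
have cDI : continuous (fun x : D * I => ev x.1).
  exact: comp_continuous (@fst_continuous _ _) ev_id_continuous.
have cI : continuous (fun x : D * I => set_val x.2 : R).
  exact: comp_continuous (@snd_continuous _ _) (@set_val_continuous _ _).
have cp : continuous p.
  apply: pair_continuous => //; apply: polar_continuous => //.
  by move=> x; exact: ev_le1.
have hMR : hausdorff_space (Mx * R)%type.
  by apply: hausdorff_prod; exact: norm_hausdorff.
apply: (@continuous_subspaceW _ _ _ (range p `|` C)).
  move=> [B t] [/= lB]; rewrite in_itv /= => t01.
  have [[d <-]|cB] := low_rank_cases lB; last by right.
  have tI : t \in `[(0 : R), 1]%classic by rewrite inE /= in_itv.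
  by left; exists (d, exist _ t tI).
apply: withinU_continuous.
- apply: compact_closed => //; apply: continuous_compact; last exact: DI_compact.
  exact: continuous_subspaceT.
- rewrite (_ : C = fst @^-1` low_corner k `&`
      ([set Bt | 0 <= Bt.2] `&` [set Bt | Bt.2 <= 1])).
    apply: closedI.
      by apply: closed_comp => [x _|]; [exact: cf|exact: low_corner_closed].
    by apply: closedI; apply: closed_fct_le => //; exact: fct_cst_continuous.
  apply/seteqP; split => Bt /=; first by move=> [? /andP[]].
  by move=> [? [? ?]]; split => //; apply/andP.
- apply: compact_factor_continuous => //; first exact: DI_compact.
  rewrite (_ : _ \o _ = fun x : D * I => push (ev x.1) (set_val x.2)).
    by apply: push_continuous => // x; exact: ev_le1.
  apply/funext => x /=; rewrite push_low_polar//.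
  by have /andP[] := I_bounds x.2.
apply: (@subspace_eq_continuous _ _ _
    (fun Bt : Mx * R => of_ (1 - Bt.2) *: Bt.1 + of_ Bt.2 *: corner K m)).
  by move=> [B t] /set_mem[cB _]; rewrite /= /from_subspace push_low_corner.
apply: continuous_subspaceT; apply: mxadd_continuous; apply: mxscale_continuous.
- apply: of_continuous; apply: fct_add_continuous; first exact: fct_cst_continuous.
  exact: fct_opp_continuous.
- exact: cf.
- exact: of_continuous.
- exact: fct_cst_continuous.
Qed.

Lemma push_low0 B : low_rank k B -> push_low (B, 0) = B.
Proof.
move=> /low_rank_cases[[d <-]|cB]; first by rewrite push_low_polar// push0// ev_le1.
by rewrite push_low_corner// subr0 rmorph1 rmorph0 scale1r scale0r addr0.
Qed.

Lemma push_low_psd B t : low_rank k B -> 0 <= t <= 1 ->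
  [/\ psd (push_low (B, t)), (\rank (push_low (B, t)) <= k)%N &
      0 < re (\tr (push_low (B, t)))].
Proof.
move=> lB t01; have /andP[t0 t1] := t01.
have [[d <-]|cB] := low_rank_cases lB.
  rewrite push_low_polar//.
  by split; [exact: push_psd (ev_le1 d) t01|exact: push_rank (ev_le1 d) t01
    |exact: push_tr (ev_le1 d) t01].
have [[pB rB tB] dB] := cB; rewrite push_low_corner//; split.
- by apply: psdD; apply: psdZ => //; rewrite ?subr_ge0//; exact: corner_psd.
- exact: add_corner_rank.
- rewrite mxtraceD !mxtraceZ corner_tr mulr1 sc_reD sc_reZ sc_re_of tB.
  by rewrite mulr1 subrK.
Qed.

(** At time 1 the whole sphere bundle has arrived at [corner], so the map does not depend on the
    representative. *)
Definition thom_push (y : T) : Mx := push (ev (repr y)) 1.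

Lemma push_corner d : bnorm (ev d) = 1 -> push (ev d) 1 = corner K m.
Proof.
move=> d1; rewrite (push_sphere d1 ler01) subrr rmorph0 rmorph1.
by rewrite scale0r add0r scale1r.
Qed.

Lemma thom_push_pi d : thom_push (\pi_T d) = push (ev d) 1.
Proof.
rewrite /thom_push; have := reprK (\pi_T d); move: (repr _) => d'.
move=> /thom_eqP[->//|[h1 h2]].
by rewrite (push_corner h1) (push_corner h2).
Qed.

Lemma thom_push_collapse B : low_rank k B ->
  thom_push (collapse_pt B) = push_low (B, 1).
Proof.
move=> /low_rank_cases[[d <-]|cB].
  by rewrite collapse_polar thom_push_pi push_low_polar.
rewrite collapse_corner// thom_push_pi push_low_corner//.
rewrite (push_corner bnorm_pole) subrr rmorph0 rmorph1.
by rewrite scale0r add0r scale1r.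
Qed.

Lemma thom_push_continuous : continuous thom_push.
Proof.
apply/quotient_continuous; rewrite (_ : _ \o _ = fun d => push (ev d) 1).
  apply: push_continuous => //; [exact: ev_id_continuous| |exact: ev_le1].
  exact: fct_cst_continuous.
by apply/funext => d /=; rewrite thom_push_pi.
Qed.

Lemma thom_push_psd y : [/\ psd (thom_push y), (\rank (thom_push y) <= k)%N &
  0 < re (\tr (thom_push y))].
Proof.
have h01 : 0 <= (1 : R) <= 1 by rewrite ler01 lexx.
by split; [exact: push_psd (ev_le1 _) h01|exact: push_rank (ev_le1 _) h01
  |exact: push_tr (ev_le1 _) h01].
Qed.

Local Notation cone := (@cone R K (1 + m) k).

Lemma cone_psd (B A : Mx) : split_pair k B A -> 0 < re (\tr B) ->
  cone (B, A).
Proof.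
move=> s tB; split => //=; rewrite mxtraceD sc_reD.
by have [_ pA _ _ _] := s; have := psd_tr_ge0 pA; lra.
Qed.

Lemma split_pair_low (B : Mx) : psd B -> (\rank B <= k)%N -> split_pair k B 0.
Proof. by move=> pB rB; split; rewrite ?mulmx0 ?mxrank0//; exact: psd0. Qed.

Lemma tr_neq0 (B : Mx) : 0 < re (\tr B) -> B <> 0.
Proof. by move=> + B0; rewrite B0 linear0 sc_re0 ltxx. Qed.

Definition M_mk (B A : Mx) (s : split_pair k B A) (tB : 0 < re (\tr B)) : Ms :=
  let c : set_type cone := exist _ (B, A) (mem_set (cone_psd s tB)) in
  exist _ (sphere_of kn c) (mem_set ((sphere_of_M kn c).2 (tr_neq0 tB))).

Lemma M_mk_continuous (X : topologicalType) (B A : X -> Mx)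
    (s : forall x, split_pair k (B x) (A x)) (tB : forall x, 0 < re (\tr (B x))) :
  continuous B -> continuous A -> continuous (fun x => M_mk (s x) (tB x)).
Proof.
move=> cB cA; apply: set_type_continuous; apply: sphere_of_continuous.
exact: pair_continuous.
Qed.

Lemma M_mk_eq B A s tB B' A' s' tB' : B = B' -> A = A' ->
  @M_mk B A s tB = @M_mk B' A' s' tB'.
Proof.
move=> BB AA; apply: val_inj; apply/sphere_of_eqP; exists 1 => //=.
by rewrite BB AA rmorph1 !scale1r.
Qed.

Definition M_split (y : Ms) : Mx * Mx := set_val (sphere_split kn (set_val y)).
Definition M_tr (y : Ms) : R := re (\tr (M_split y).1).
(** Normalization by the trace is possible because membership in [M_space] means that the negative
    part is nonzero. *)
Definition M_neg (y : Ms) : Mx := of_ (M_tr y)^-1 *: (M_split y).1.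
Definition M_pos (y : Ms) : Mx := of_ (M_tr y)^-1 *: (M_split y).2.

Lemma M_split_pair y : split_pair k (M_split y).1 (M_split y).2.
Proof. by have [] := set_val_in (sphere_split kn (set_val y)). Qed.

Lemma M_tr_gt0 y : 0 < M_tr y.
Proof.
have [pB _ _ _ _] := M_split_pair y.
rewrite lt_def psd_tr_ge0// andbT; apply/eqP => /(psd_tr_eq0 pB).
by apply/(sphere_of_M kn); rewrite sphere_splitK; exact: (set_val_in y).
Qed.

Lemma M_norm_pair y : split_pair k (M_neg y) (M_pos y).
Proof.
by apply: split_pairZ (M_split_pair y); rewrite invr_ge0 ltW ?M_tr_gt0.
Qed.

Lemma M_neg_tr y : re (\tr (M_neg y)) = 1.
Proof. by rewrite mxtraceZ sc_reZ mulVf// gt_eqF ?M_tr_gt0. Qed.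

Lemma M_neg_low y : low_rank k (M_neg y).
Proof.
have [pB _ _ rB _] := M_norm_pair y.
by split => //; exact: M_neg_tr.
Qed.

Lemma M_split_continuous : continuous M_split.
Proof.
exact: comp_continuous (@set_val_continuous _ _)
  (@sphere_split_continuous R K (1 + m) k kn).
Qed.

Lemma M_tr_inv_continuous : continuous (fun y => of_ (M_tr y)^-1).
Proof.
apply: of_continuous; apply: fct_inv_continuous => [y|].
  by rewrite gt_eqF ?M_tr_gt0.
apply: re_continuous; apply: mxtrace_continuous.
exact: comp_continuous M_split_continuous (@fst_continuous _ _).
Qed.

Lemma M_neg_continuous : continuous M_neg.
Proof.
apply: mxscale_continuous; first exact: M_tr_inv_continuous.
exact: comp_continuous M_split_continuous (@fst_continuous _ _).
Qed.

Lemma M_pos_continuous : continuous M_pos.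
Proof.
apply: mxscale_continuous; first exact: M_tr_inv_continuous.
exact: comp_continuous M_split_continuous (@snd_continuous _ _).
Qed.

Lemma M_mkK y B A s tB : B = M_neg y -> A = M_pos y -> @M_mk B A s tB = y.
Proof.
move=> BE AE; apply: val_inj => /=; rewrite -[RHS](sphere_splitK kn).
apply/sphere_of_eqP; exists (M_tr y); first exact: M_tr_gt0.
rewrite /= BE AE /M_neg /M_pos !scalerA -!rmorphM mulfV ?gt_eqF ?M_tr_gt0//.
by rewrite rmorph1 !scale1r.
Qed.

Lemma M_neg_mk B A s tB : M_neg (@M_mk B A s tB) = of_ (re (\tr B))^-1 *: B.
Proof.
set y := M_mk s tB; pose c : set_type cone := exist _ (B, A) (mem_set (cone_psd s tB)).
have /sphere_of_eqP[a a0 [/= E1 _]] :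
    sphere_of kn c = sphere_of kn (sphere_split kn (set_val y)).
  by rewrite sphere_splitK.
rewrite /M_neg /M_tr /M_split E1 mxtraceZ sc_reZ scalerA -rmorphM.
by rewrite invfM mulrAC mulVf ?mul1r// gt_eqF.
Qed.

Definition M_to_thom (y : Ms) : T := collapse_pt (M_neg y).

Lemma thom_split y : split_pair k (thom_push y) 0.
Proof. by have [pB rB _] := thom_push_psd y; exact: split_pair_low. Qed.

Lemma thom_push_tr y : 0 < re (\tr (thom_push y)).
Proof. by have [] := thom_push_psd y. Qed.

Definition thom_to_M (y : T) : Ms := M_mk (thom_split y) (thom_push_tr y).

Lemma M_to_thom_continuous : continuous M_to_thom.
Proof.
exact: within_comp_continuous collapse_continuous M_neg_continuous M_neg_low.
Qed.

Lemma thom_to_M_continuous : continuous thom_to_M.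
Proof.
apply: M_mk_continuous; first exact: thom_push_continuous.
exact: fct_cst_continuous.
Qed.

(* For t = 1 and |e| < 1/2 this is the radial rescaling undone by [push e 1], and
   for t = 0 the identity. *)
Definition stretch e (t : R) : E :=
  bscale k_gt0 (Num.max (1 - t * bnorm e) (bnorm e))^-1 e.

Lemma stretch_den_gt0 e t : 0 < Num.max (1 - t * bnorm e) (bnorm e).
Proof.
rewrite lt_max; have := bnorm_ge0 e; rewrite le_eqVlt => /predU1P[<-|->].
  by rewrite mulr0 subr0 ltr01.
by rewrite orbT.
Qed.

Lemma bnorm_stretch e t : bnorm (stretch e t) =
  (Num.max (1 - t * bnorm e) (bnorm e))^-1 * bnorm e.
Proof. by rewrite bnormZ gtr0_norm// invr_gt0 stretch_den_gt0. Qed.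

Lemma stretch_le1 e t : bnorm (stretch e t) <= 1.
Proof.
rewrite bnorm_stretch mulrC ler_pdivrMr ?stretch_den_gt0// mul1r.
by rewrite le_max lexx orbT.
Qed.

Lemma stretch0 e : bnorm e <= 1 -> stretch e 0 = e.
Proof. by move=> e1; rewrite /stretch mul0r subr0 max_l// invr1 bscale1. Qed.

Lemma stretch_eq1 e t : 0 <= t -> 0 < bnorm e -> 1 <= (1 + t) * bnorm e ->
  bnorm (stretch e t) = 1.
Proof.
move=> t0 e0 h; rewrite bnorm_stretch max_r; last by lra.
by rewrite mulVf// gt_eqF.
Qed.

Lemma stretch_continuous (X : topologicalType) (f : X -> E) (t : X -> R) :
  continuous f -> continuous t -> continuous (fun x => stretch (f x) (t x)).
Proof.
move=> cf ct; have cn := bnorm_continuous cf.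
apply: pb_mk_continuous; first exact: bun_mx_continuous.
  exact: comp_continuous cf (@pb_proj_continuous _ _ _ _).
apply: mxscale_continuous; last exact: comp_continuous cf (@pb_vec_continuous _ _ _ _).
apply: fct_inv_continuous => [x|]; first by rewrite gt_eqF// stretch_den_gt0.
apply: fct_max_continuous => //; apply: fct_add_continuous.
  exact: fct_cst_continuous.
by apply: fct_opp_continuous; exact: fct_mul_continuous.
Qed.

Definition thom_homotopy (yt : T * R) : T :=
  \pi_T (disc_mk (stretch_le1 (ev (repr yt.1)) (1 - yt.2))).

Lemma thom_homotopy_pi d t : t <= 1 ->
  thom_homotopy (\pi_T d, t) = \pi_T (disc_mk (stretch_le1 (ev d) (1 - t))).
Proof.
move=> t1; rewrite /thom_homotopy /=; have := reprK (\pi_T d); move: (repr _) => d'.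
have s0 : 0 <= 1 - t by rewrite subr_ge0.
have far e : bnorm e = 1 -> bnorm (stretch e (1 - t)) = 1.
  by move=> e1; apply: stretch_eq1 => //; rewrite e1 ?ltr01// mulr1 lerDl.
move=> /thom_eqP[->//|[h1 h2]].
by apply/thom_eqP; right; rewrite !ev_mk !far.
Qed.

(** Continuity is checked upstairs, on the compact product of the disc bundle and the interval, and
    descends because the target of the projection is Hausdorff. *)
Lemma thom_homotopy_continuous :
  {within setT `*` `[0, 1]%classic, continuous thom_homotopy}.
Proof.
pose p (x : D * I) : T * R := (\pi_T x.1, set_val x.2).
have cd : continuous (fun x : D * I => x.1) := @fst_continuous _ _.
have cI : continuous (fun x : D * I => set_val x.2 : R).
  exact: comp_continuous (@snd_continuous _ _) (@set_val_continuous _ _).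
have cp : continuous p.
  by apply: pair_continuous => //; exact: comp_continuous cd thom_pi_continuous.
apply: (@continuous_subspaceW _ _ _ (range p)).
  move=> [y t] [_ /= t01]; have tI : t \in `[(0 : R), 1]%classic by rewrite inE.
  by exists (repr y, exist _ t tI) => //; rewrite /p /= reprK.
apply: compact_factor_continuous => //; first exact: DI_compact.
  by apply: hausdorff_prod; [exact: thom_hausdorff|exact: norm_hausdorff].
rewrite (_ : _ \o _ = fun x : D * I =>
    \pi_T (disc_mk (stretch_le1 (ev x.1) (1 - set_val x.2)))); last first.
  apply/funext => x; rewrite /comp /p thom_homotopy_pi//.
  by have /andP[] := I_bounds x.2.
apply: comp_continuous (thom_pi_continuous); apply: set_type_continuous.
apply: stretch_continuous; first exact: ev_continuous cd.
apply: fct_add_continuous; first exact: fct_cst_continuous.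
exact: fct_opp_continuous.
Qed.

Lemma thom_homotopy1 y : thom_homotopy (y, 1) = y.
Proof.
move: y; apply: thom_ind => d; rewrite thom_homotopy_pi//; congr (\pi_T _).
by apply: ev_inj; rewrite ev_mk subrr stretch0// ev_le1.
Qed.

Lemma thom_homotopy0 y : thom_homotopy (y, 0) = M_to_thom (thom_to_M y).
Proof.
move: y; apply: thom_ind => d; rewrite thom_homotopy_pi ?ler01// subr0.
rewrite /M_to_thom M_neg_mk thom_push_pi; set B := push (ev d) 1.
have d1 := ev_le1 d.
have h01 : 0 <= (1 : R) <= 1 by rewrite ler01 lexx.
have tB : 0 < re (\tr B) := push_tr k_gt0 d1 h01.
have pB : psd B := push_psd k_gt0 d1 h01.
have rB : (\rank B <= k)%N := push_rank k_gt0 d1 h01.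
(* From radius one half on, both sides are the collapsed point; below it, [push1_near] identifies
   them. *)
have [h|h] := ltP (2 * bnorm (ev d)) 1; last first.
  rewrite collapse_corner; last first.
    split; last first.
      rewrite drsubZ rank_of_scale ?invr_eq0 ?gt_eqF//.
      exact: (push1_far k_gt0 h d1).
    split.
    - by apply: psdZ => //; rewrite invr_ge0 ltW.
    - by rewrite rank_of_scale// invr_eq0 gt_eqF.
    - by rewrite mxtraceZ sc_reZ mulVf// gt_eqF.
  apply/thom_eqP; right; rewrite bnorm_pole ev_mk; split => //.
  by apply: stretch_eq1 => //; lra.
have [a a0 aE] := push1_near k_gt0 h.
have n0 := bnorm_ge0 (ev d).
have sE : stretch (ev d) 1 = bscale k_gt0 (1 - bnorm (ev d))^-1 (ev d).
  by rewrite /stretch mul1r max_l//; lra.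
rewrite -sE in aE.
(* The unknown factor [a] is pinned down by the trace, since values of [polar] on the disc have
   trace 1. *)
have atr : a * re (\tr B) = 1.
  have [_ _] := polar_low k_gt0 (stretch_le1 (ev d) 1).
  by rewrite -aE mxtraceZ sc_reZ.
have -> : (re (\tr B))^-1 = a.
  by apply: (mulIf (lt0r_neq0 tB)); rewrite atr mulVf// gt_eqF.
rewrite aE; symmetry.
exact: (collapse_polar (disc_mk (stretch_le1 (ev d) 1))).
Qed.

(* The homotopy first scales the positive part to 0, and only then pushes the
   negative part, since pushing breaks the orthogonality of the two. *)
Definition cut_low (t : R) : R := Num.max 0 (Num.min 1 (1 - 2 * t)).
Definition cut_high (t : R) : R := Num.max 0 (2 * t - 1).

Lemma cut_low_in t : 0 <= cut_low t <= 1.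
Proof.
rewrite /cut_low; apply/andP; split; first by rewrite le_max lexx.
by rewrite ge_max ler01 ge_min lexx.
Qed.

Lemma cut_high_ge0 t : 0 <= cut_high t.
Proof. by rewrite /cut_high le_max lexx. Qed.

Lemma cut_high_low t : cut_high t = 0 \/ cut_low t = 0.
Proof.
have [h|h] := lerP (2 * t - 1) 0; [left|right]; first exact: max_l.
by rewrite /cut_low max_l// ge_min; apply/orP; right; lra.
Qed.

Lemma M_homotopy_split (yt : Ms * R) : split_pair k
  (push_low (M_neg yt.1, cut_low yt.2)) (of_ (cut_high yt.2) *: M_pos yt.1).
Proof.
have [pB rB _] := push_low_psd (M_neg_low yt.1) (cut_low_in yt.2).
have [_ pA BA _ rA] := M_norm_pair yt.1.
split => //.
- by apply: psdZ => //; exact: cut_high_ge0.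
- rewrite -scalemxAr; case: (cut_high_low yt.2) => ->.
    by rewrite rmorph0 scale0r.
  by rewrite push_low0 ?BA ?scaler0//; exact: M_neg_low.
- exact: leq_trans (mxrankS (scalemx_sub _ (submx_refl _))) rA.
Qed.

Lemma M_homotopy_tr (yt : Ms * R) :
  0 < re (\tr (push_low (M_neg yt.1, cut_low yt.2))).
Proof. by have [] := push_low_psd (M_neg_low yt.1) (cut_low_in yt.2). Qed.

Definition M_homotopy (yt : Ms * R) : Ms :=
  M_mk (M_homotopy_split yt) (M_homotopy_tr yt).

(** [cut_low] keeps the time argument of [push_low] in the unit interval, so the homotopy is
    continuous for all real times. *)
Lemma M_homotopy_continuous : continuous M_homotopy.
Proof.
have cy : continuous (fun yt : Ms * R => yt.1) := @fst_continuous _ _.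
have ct : continuous (fun yt : Ms * R => yt.2) := @snd_continuous _ _.
have c1 : continuous (fun _ : Ms * R => 1 : R) by exact: fct_cst_continuous.
have c0 : continuous (fun _ : Ms * R => 0 : R) by exact: fct_cst_continuous.
have c2 : continuous (fun yt : Ms * R => 2 * yt.2).
  by apply: fct_mul_continuous => //; exact: fct_cst_continuous.
apply: M_mk_continuous.
  apply: (@within_comp_continuous _ _ _ _ push_low
      (fun yt : Ms * R => (M_neg yt.1, cut_low yt.2))).
  - exact: push_low_continuous.
  - apply: pair_continuous; first exact: comp_continuous cy M_neg_continuous.
    apply: fct_max_continuous => //.
    have cm : continuous (fun yt : Ms * R => 1 - 2 * yt.2).
      by apply: fct_add_continuous => //; exact: fct_opp_continuous.
    by move=> yt; exact: continuous_min (c1 yt) (cm yt).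
  - move=> yt; split; first exact: M_neg_low.
    by rewrite /= in_itv /= cut_low_in.
apply: mxscale_continuous; last exact: comp_continuous cy M_pos_continuous.
apply: of_continuous; apply: fct_max_continuous => //.
by apply: fct_add_continuous => //; exact: fct_opp_continuous.
Qed.

Lemma M_homotopy0 y : M_homotopy (y, 0) = thom_to_M (M_to_thom y).
Proof.
apply: M_mk_eq.
  rewrite /M_to_thom (thom_push_collapse (M_neg_low y)); congr (push_low (_, _)).
  by rewrite /cut_low /= mulr0 subr0 minxx max_r.
by rewrite /cut_high /= mulr0 sub0r max_l ?rmorph0 ?scale0r// lerN10.
Qed.

Lemma M_homotopy1 y : M_homotopy (y, 1) = y.
Proof.
have low1 : cut_low 1 = 0.
  by rewrite /cut_low max_l// ge_min; apply/orP; right; lra.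
have high1 : cut_high 1 = 1 by rewrite /cut_high max_r; lra.
apply: M_mkK => /=; last by rewrite high1 rmorph1 scale1r.
by rewrite low1 push_low0//; exact: M_neg_low.
Qed.

Lemma M_space_thom_space : homotopy_equivalent R Ms T.
Proof.
exists M_to_thom, thom_to_M; split.
- exact: M_to_thom_continuous.
- exact: thom_to_M_continuous.
- exists M_homotopy; split; [|exact: M_homotopy0|exact: M_homotopy1].
  by apply: continuous_subspaceT; exact: M_homotopy_continuous.
- exists thom_homotopy; split; [|exact: thom_homotopy0|exact: thom_homotopy1].
  exact: thom_homotopy_continuous.
Qed.

End ThomEquivalence.

(** * The two instances *)

Section RealSpectral.
Variable R : realType.

(** The complexification is Hermitian, so its eigenvalues are real, and they are roots of the same
    characteristic polynomial. *)
Lemma symmetric_eigenvalue n (A : 'M[R]_n.+1) : A^T = A ->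
  exists a, eigenvalue A a.
Proof.
move=> sA; pose A' : 'M[R[i]]_n.+1 := map_mx (real_complex R) A.
have hA' : A' \is hermsymmx.
  apply/is_hermitianmxP; rewrite expr0 scale1r /A' -{1}sA.
  apply/matrixP => i j; rewrite !mxE.
  by rewrite -[LHS]conjCK; congr (_^*); apply/CrealP; rewrite complex_real.
have /orthomx_spectralP A'E := hermitian_normalmx hA'.
have /mxOverP/(_ 0 0) := hermitian_spectral_diag_real hA'.
set s := spectral_diag A' in A'E *; set P := spectralmx A' in A'E.
have uP : P \in unitmx := spectral_unit A'.
move=> /complex_realP[a sa]; exists a.
have : eigenvalue A' (real_complex R a).
  apply/eigenvalueP; exists (row 0 P).
    rewrite rowE A'E !mulmxA -(mulmxA _ P) mulmxV// mulmx1 scalemxAl -sa.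
    congr (_ *m P); apply/rowP => i; rewrite mul_mx_diag !mxE eqxx /=.
    by case: eqP => [->|_]; rewrite ?mul1r ?mulr1 ?mul0r ?mulr0.
  apply: contraTN uP => /eqP r0; rewrite -row_free_unit; apply/row_freePn.
  by exists 0; rewrite r0 sub0mx.
by rewrite !eigenvalue_root_char /A' -map_char_poly fmorph_root.
Qed.

(** The Householder reflection along [e - v] exchanges the unit vectors [e] and [v]. *)
Lemma orthogonal_with_row n (v : 'rV[R]_(1 + n)) : v *m v^T = 1%:M ->
  exists2 Q : 'M[R]_(1 + n), Q *m Q^T = 1%:M & delta_mx 0 0 *m Q = v.
Proof.
move=> vv; pose e : 'rV[R]_(1 + n) := delta_mx 0 0; pose w := e - v.
have [w0|w0] := eqVneq w 0.
  exists 1%:M; first by rewrite trmx1 mulmx1.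
  by rewrite mulmx1; apply/eqP; rewrite -subr_eq0; apply/eqP.
pose d := (w *m w^T) 0 0; pose c := 2 / d.
have dE : w *m w^T = d%:M by rewrite [LHS]mx11_scalar.
(* Since [e] and [v] have norm 1, both sides equal 1 minus their inner product. *)
have ew : e *m w^T = (d / 2)%:M.
  rewrite [LHS]mx11_scalar; congr (_%:M); rewrite /d /w.
  rewrite linearB /= !mulmxBl !mulmxBr vv.
  have -> : v *m e^T = e *m v^T.
    have tr11 (M : 'M[R]_1) : M^T = M by rewrite [M]mx11_scalar tr_scalar_mx.
    by rewrite -[LHS]tr11 trmx_mul trmxK.
  have -> : e *m e^T = 1%:M.
    by rewrite trmx_delta mul_delta_mx; apply/matrixP => i j; rewrite !mxE !ord1.
  by rewrite !mxE /=; field.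
have d0 : d != 0.
  by rewrite gt_eqF//; exact: rV_dot_gt0.
exists (1%:M - c *: (w^T *m w)); last first.
  rewrite mulmxBr mulmx1 -scalemxAr mulmxA ew mul_scalar_mx scalerA.
  by rewrite /c (_ : 2 / d * (d / 2) = 1) ?scale1r /w ?opprB 1?addrC ?subrK//; field.
have -> : (1%:M - c *: (w^T *m w))^T = 1%:M - c *: (w^T *m w).
  by rewrite linearB /= trmx1; congr (_ - _); rewrite linearZ /= trmx_mul trmxK.
rewrite mulmxBr mulmx1 mulmxBl mul1mx -scalemxAr -!scalemxAl.
rewrite -(mulmxA _ w) (mulmxA w) dE mul_scalar_mx -scalemxAr !scalerA.
have -> : c * c * d = c + c by rewrite /c; field.
by rewrite scalerDl opprB addrK subrK.
Qed.

(** Deflation: an orthogonal matrix whose first row is a unit eigenvector brings [A] to block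
    diagonal form, and the induction hypothesis treats the lower block. *)
Lemma symmetric_spectral n (A : 'M[R]_n) : A^T = A ->
  exists (U : 'M[R]_n) (l : 'rV[R]_n),
    U *m U^T = 1%:M /\ A = U^T *m diag_mx l *m U.
Proof.
elim: n A => [|n IHn] A sA.
  by exists 1%:M, 0; split; apply/matrixP => -[].
have [a /eigenvalueP[v0 v0E v00]] := symmetric_eigenvalue sA.
have d0 : 0 < (v0 *m v0^T) 0 0 by exact: rV_dot_gt0.
pose v := (Num.sqrt ((v0 *m v0^T) 0 0))^-1 *: v0.
have vE : v *m A = a *: v by rewrite -scalemxAl v0E !scalerA mulrC.
have vv : v *m v^T = 1%:M.
  rewrite /v; set s := Num.sqrt _.
  have -> : (s^-1 *: v0)^T = s^-1 *: v0^T by rewrite linearZ.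
  rewrite -scalemxAl -scalemxAr scalerA [v0 *m _]mx11_scalar.
  rewrite /s -invfM -expr2 sqr_sqrtr ?ltW// scale_scalar_mx mulVf//.
  exact: lt0r_neq0.
have [Q QQ eQ] := @orthogonal_with_row n v vv.
pose B : 'M[R]_(1 + n) := Q *m A *m Q^T.
have QQ' : Q^T *m Q = 1%:M by exact: mulmx1C.
have sB : B^T = B by rewrite /B !trmx_mul trmxK sA mulmxA.
have eB : delta_mx 0 0 *m B = a *: delta_mx 0 0 :> 'rV_(1 + n).
  by rewrite /B !mulmxA eQ vE -scalemxAl -eQ -mulmxA QQ mulmx1.
have AE : A = Q^T *m B *m Q.
  by rewrite /B !mulmxA QQ' mul1mx -mulmxA QQ' mulmx1.
clearbody B.
have BE : B = block_mx a%:M 0 0 (drsubmx B).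
  have r0 j : B 0 j = a * (0 == j)%:R.
    have := congr1 (fun X : 'rV_(1 + n) => X 0 j) eB.
    by rewrite -rowE !mxE eqxx eq_sym.
  have l0 : lshift n (0 : 'I_1) = 0 :> 'I_(1 + n) by exact: val_inj.
  rewrite -[LHS]submxK; congr block_mx; apply/matrixP => i j.
  - rewrite !mxE !ord1 l0.
    by rewrite r0 eqxx mulr1 mulr1n.
  - by rewrite !mxE ord1 l0 r0 mulr0.
  - rewrite -sB !mxE ord1 l0 r0 mulr0//.
have [|U' [l' [UU' B'E]]] := IHn (drsubmx B).
  by rewrite trmx_drsub sB.
pose U : 'M[R]_(1 + n) := block_mx 1%:M 0 0 U'.
have UU : U *m U^T = 1%:M.
  rewrite /U tr_block_mx mulmx_block !trmx0 !mulmx0 !mul0mx trmx1 UU' mulmx1.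
  by rewrite !addr0 add0r -scalar_mx_block.
have BU : B = U^T *m diag_mx (row_mx a%:M l') *m U.
  rewrite BE B'E /U tr_block_mx !trmx0 trmx1 diag_mx_row !mulmx_block.
  rewrite !mulmx0 !mul0mx !mulmx1 !mul1mx !addr0 !add0r.
  congr block_mx; rewrite ?mul0mx //.
  by apply/matrixP => i j; rewrite !mxE !ord1 !mulr1n.
exists (U *m Q), (row_mx a%:M l'); split.
  by rewrite trmx_mul mulmxA -(mulmxA U) QQ mulmx1.
by rewrite AE BU trmx_mul !mulmxA.
Qed.

End RealSpectral.

Section Instances.
Variable R : realType.

Program Definition real_scalars : scalars R :=
  @Scalars R R idfun idfun id (fun=> 0) 0 _ _ _ _ _ _ _ _ _ _ _ _ _ _ _ _
    _ _ _ _ _.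
Next Obligation. by []. Qed.
Next Obligation. by []. Qed.
Next Obligation. by move=> x /=; rewrite expr0n addr0 expr2. Qed.
Next Obligation. by move=> x /=; rewrite mulr2n. Qed.
Next Obligation. by []. Qed.
Next Obligation. by []. Qed.
Next Obligation. by move=> x; rewrite mul0r addr0. Qed.
Next Obligation. by []. Qed.
Next Obligation. by move=> x y; rewrite addr0. Qed.
Next Obligation. by []. Qed.
Next Obligation. by move=> a x; rewrite mulr0. Qed.
Next Obligation. by []. Qed.
Next Obligation. by []. Qed.
Next Obligation. by move=> x; rewrite mul0r oppr0. Qed.
Next Obligation. by move=> x; rewrite mul0r. Qed.
Next Obligation. by right. Qed.
Next Obligation. by move=> x; exact: cvg_id. Qed.
Next Obligation. by move=> x; exact: cvg_id. Qed.
Next Obligation. by move=> x; exact: cvg_id. Qed.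
Next Obligation. by move=> x; exact: cvg_cst. Qed.
Next Obligation.
move=> n A /=; rewrite map_mx_id// => sA.
have [U [l [UU AE]]] := symmetric_spectral sA.
by exists U, l; rewrite !map_mx_id.
Qed.

Local Notation C := (Num.NumField.sort (complex R : numFieldType)).
Local Notation Cre := (@complex.Re R : C -> R).
Local Notation Cim := (@complex.Im R : C -> R).

Lemma ball_complex (x y : C) (e : C) : 0 < e -> 
  ball x e y -> `|Cre x - Cre y| < Cre e /\ `|Cim x - Cim y| < Cre e.
Proof.
case: x y e => [a b] [c d] [e e'] /=.
rewrite ltcE /= => /andP[/eqP e'0 e0]; rewrite /ball /= /ball_ ltcE /=.
move=> /andP[_ h]; split; apply: le_lt_trans h; rewrite -sqrtr_sqr;
  rewrite ler_wsqrtr// ?lerDl ?lerDr sqr_ge0//.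
Qed.

Lemma complex_Re_continuous : continuous Cre.
Proof.
move=> x A /nbhs_ballP[e /= e0 eA]; apply/nbhs_ballP.
have e0' : 0 < real_complex R e by rewrite ltcR.
exists (real_complex R e) => //= y xy; apply: eA.
by have [] := ball_complex e0' xy.
Qed.

Lemma complex_Im_continuous : continuous Cim.
Proof.
move=> x A /nbhs_ballP[e /= e0 eA]; apply/nbhs_ballP.
have e0' : 0 < real_complex R e by rewrite ltcR.
exists (real_complex R e) => //= y xy; apply: eA.
by have [] := ball_complex e0' xy.
Qed.

Lemma real_complex_continuous : continuous (real_complex R : R -> C).
Proof.
move=> x A /nbhs_ballP[[e e'] /=]; rewrite ltcE /= => /andP[/eqP -> e0] eA.
apply/nbhs_ballP; exists e => //= y; rewrite /ball /= => xy; apply: eA.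
by rewrite /ball /= -rmorphB /= normc_def /= expr0n /= addr0 sqrtr_sqr ltcR.
Qed.

Lemma conj_complex_continuous : continuous (@Num.conj R[i] : C -> C).
Proof.
move=> x A /nbhs_ballP[e /= e0 eA]; apply/nbhs_ballP; exists e => //= y xy.
by apply: eA; rewrite /ball /= -rmorphB norm_conjC.
Qed.

Program Definition complex_scalars : scalars R :=
  @Scalars R (R[i] : numFieldType) (@Num.conj R[i]) (real_complex R) Cre Cim 'i%C
    _ _ _ _ _ _ _ _ _ _ _ _ _ _ _ _ conj_complex_continuous
    real_complex_continuous complex_Re_continuous complex_Im_continuous _.
Next Obligation. exact: conjCK. Qed.
Next Obligation. by move=> a; exact: (conjc_real a). Qed.
Next Obligation.
move=> [a b]; rewrite -[X in _ * X]/(a -i* b)%C /=; simpc.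
by congr (_ +i* _)%C; ring.
Qed.
Next Obligation.
move=> [a b]; rewrite -[X in _ + X]/(a -i* b)%C /=; simpc.
by congr (_ +i* _)%C; ring.
Qed.
Next Obligation. by move=> a; rewrite ler0c. Qed.
Next Obligation. by case=> a b; rewrite lecE /= => /andP[/eqP->]. Qed.
Next Obligation. by move=> x; exact: complexE. Qed.
Next Obligation. by case=> a b [c d]. Qed.
Next Obligation. by case=> a b [c d]. Qed.
Next Obligation. by move=> a [b c] /=; rewrite mul0r subr0. Qed.
Next Obligation. by move=> a [b c] /=; rewrite mul0r addr0. Qed.
Next Obligation. by []. Qed.
Next Obligation. by []. Qed.
Next Obligation. by case=> a b /=; rewrite mul0r mul1r sub0r. Qed.
Next Obligation. by case=> a b /=; rewrite mul0r add0r. Qed.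
Next Obligation. by left. Qed.
Next Obligation.
move=> n A hA; have hA' : A \is hermsymmx.
  by apply/is_hermitianmxP; rewrite expr0 scale1r -{1}hA map_trmx.
have /orthomx_spectralP AE := hermitian_normalmx hA'.
have uP := spectral_unitarymx A.
exists (spectralmx A), (map_mx Cre (spectral_diag A)); split.
  by have /unitarymxP := uP; rewrite map_trmx.
rewrite {1}AE invmx_unitary// map_trmx; congr (_ *m diag_mx _ *m _).
have /mxOverP real := hermitian_spectral_diag_real hA'.
apply/rowP => i; rewrite !mxE.
by have /complex_realP[a ->] := real 0 i.
Qed.

End Instances.

(** The dimension formula at [sc_im sc_i = 0]. The division is exact since [k * (k + 1)] is even,
    and [0 < k] keeps the subtraction from truncating. *)
Lemma real_bundle_rank (R : realType) (k : nat) : (0 < k)%N ->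
  (k * (k + 1) %/ 2 + k - 1)%:R =
  (1 + 0) * k%:R + (1 + 0) / 2 * k%:R ^+ 2 + (1 - 0) / 2 * k%:R - 1 :> R.
Proof.
move=> k0; have e : (k * (k + 1) = 2 * (k * (k + 1) %/ 2))%N.
  by rewrite [RHS]mulnC divnK// dvdn2 oddM oddD; case: (odd k).
have /(congr1 (fun n => n%:R : R)) := e; rewrite !natrM natrD => e'.
rewrite natrB; last by lia.
rewrite natrD addr0 subr0; lra.
Qed.

Lemma complex_bundle_rank (R : realType) (k : nat) : (0 < k)%N ->
  (k ^ 2 + 2 * k - 1)%:R =
  (1 + 1) * k%:R + (1 + 1) / 2 * k%:R ^+ 2 + (1 - 1) / 2 * k%:R - 1 :> R.
Proof.
move=> k0; rewrite natrB; last by lia.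
by rewrite natrD natrX natrM; field.
Qed.

Theorem theorem1 (R : realType) (n k : nat) :
  (2 <= n)%N -> (1 <= k <= n - 1)%N ->
  (exists (E : vector_bundle R (grassmannian R k (n - 1))
                 (k * (k + 1) %/ 2 + k - 1)%N)
          (g : bundle_metric E),
     homotopy_equivalent R
       (set_type (@M_space R idfun n k)) (thom_space g)) /\
  (exists (E : vector_bundle R (grassmannian R[i] k (n - 1))
                 (k ^ 2 + 2 * k - 1)%N)
          (g : bundle_metric E),
     homotopy_equivalent R
       (set_type (@M_space R[i] (@Num.conj R[i]) n k)) (thom_space g)).
Proof.
case: n => [//|m _]; rewrite subn1 /= => /andP[k0 km]; split.
- exists (thom_bundle (K := real_scalars R) m k0 (real_bundle_rank R k0)).
  exists (thom_metric (K := real_scalars R) m k0 (real_bundle_rank R k0)).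
  have h := @M_space_thom_space R (real_scalars R) m k _ k0 km
    (real_bundle_rank R k0).
  exact: h.
- exists (thom_bundle (K := complex_scalars R) m k0 (complex_bundle_rank R k0)).
  exists (thom_metric (K := complex_scalars R) m k0 (complex_bundle_rank R k0)).
  have h := @M_space_thom_space R (complex_scalars R) m k _ k0 km
    (complex_bundle_rank R k0).
  exact: h.
Qed.
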